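(* Let $\varepsilon>0$. Any planar graph $G=(V,E,\ell)$ with a set $T\subset V$ of $k$ terminals admits a $(1+\varepsilon,\ \widetilde{\mathcal{O}}((k/\varepsilon)^2))$-DAM, where $\widetilde{\mathcal{O}}$ hides an absolute constant and factors polylogarithmic in $k$.
   Context: Graphs $G=(V,E,\ell)$ are finite and undirected, with an edge length function $\ell:E\to\mathbb{R}^+$ and a designated set $T\subset V$ of $k$ vertices called terminals; the other vertices are non-terminals. $d_G$ is the shortest-path distance. A minor of $G$ is a graph obtained by a sequence of vertex deletions, edge deletions and edge contractions, where no terminal may be deleted and no two terminals may be contracted together (so every terminal survives; a super-node containing terminal $t$ is identified with $t$); a minor carries its own edge length function $\ell'$. A minor $H=(V',E',\ell')$ of $G$ is an $\alpha$-distance approximating minor ($\alpha$-DAM) of $G$ if $d_G(t,t')\le d_H(t,t')\le\alpha\cdot d_G(t,t')$ for all $t,t'\in T$. It is an $(\alpha,y)$-DAM if in addition it has at most $y$ non-terminals. *)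

(* Defs.v *)
From HB Require Import structures.
From mathcomp Require Import all_boot all_order all_algebra.
From mathcomp Require Import all_classical all_reals all_analysis.

Set Implicit Arguments.
Unset Strict Implicit.
Unset Printing Implicit Defensive.

Import Order.TTheory GRing.Theory Num.Theory numFieldNormedType.Exports.

Local Open Scope ring_scope.

(* Finite simple graphs whose vertices are drawn from an ambient finite type.
   Keeping the ambient type fixed lets a graph and its minors share vertex
   names, so that a terminal is literally the same vertex in both. *)
Record graph (V : finType) := Graph {
  verts : {set V};
  edges : {set {set V}};
  edges_wf : edges \subset [set e : {set V} | (e \subset verts) && (#|e| == 2%N)]%SET
}.

Section Minors.
Variable V : finType.
Implicit Types (G H : graph V) (T e : {set V}) (u v x : V).

Lemma edge_wf G e : e \in edges G -> (e \subset verts G) && (#|e| == 2%N).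
Proof. by move=> /(fintype.subsetP (edges_wf G)); rewrite inE. Qed.

Definition del_vertex_edges G u := [set e in edges G | u \notin e]%SET.

Lemma del_vertex_wf G u : del_vertex_edges G u \subset
  [set e : {set V} | (e \subset verts G :\ u) && (#|e| == 2%N)]%SET.
Proof.
apply/fintype.subsetP => e; rewrite !inE => /andP[/edge_wf/andP[eG ->] ue].
by rewrite finset.subsetD1 eG ue.
Qed.

Definition del_vertex G u := Graph (del_vertex_wf G u).

Lemma del_edge_wf G e0 : edges G :\ e0 \subset
  [set e : {set V} | (e \subset verts G) && (#|e| == 2%N)]%SET.
Proof. by exact: fintype.subset_trans (finset.subD1set _ _) (edges_wf G). Qed.

Definition del_edge G e0 := Graph (del_edge_wf G e0).

(* Contraction of the edge uv; the super-node keeps the name v.  The loop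
   created by uv is discarded, and parallel edges are identified. *)
Definition merge_vertex u v x := if x == u then v else x.

Definition contract_edges G u v :=
  [set e in [set merge_vertex u v @: f | f : {set V} in edges G] | #|e| == 2%N]%SET.

Lemma contract_wf G u v (uv : [set u; v]%SET \in edges G) :
  contract_edges G u v \subset
  [set e : {set V} | (e \subset verts G :\ u) && (#|e| == 2%N)]%SET.
Proof.
apply/fintype.subsetP => e.
rewrite !inE => /andP[/imsetP[f /edge_wf/andP[/fintype.subsetP fG _] ->] ->].
rewrite andbT; have /andP[/fintype.subsetP uvG uv2] := edge_wf uv.
apply/fintype.subsetP => _ /imsetP[x xf ->]; rewrite !inE /merge_vertex.
have [_|xu] := eqVneq x u; last by rewrite xu fG.
rewrite uvG ?inE ?eqxx ?orbT// andbT.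
by apply: contraTneq uv2 => ->; rewrite finset.setUid cards1.
Qed.

Definition contract_edge G u v (uv : [set u; v]%SET \in edges G) :=
  Graph (contract_wf uv).

(* The disappearing vertex u of a contraction must be a non-terminal: of two
   adjacent vertices that are not both terminals, one may always choose u to be
   a non-terminal, and a super-node containing a terminal is thereby named after
   that terminal. *)
Inductive minor T G : graph V -> Prop :=
| minor_refl : minor T G G
| minor_del_vertex H u : minor T G H -> u \in verts H -> u \notin T ->
    minor T G (del_vertex H u)
| minor_del_edge H e : minor T G H -> e \in edges H ->
    minor T G (del_edge H e)
| minor_contract H u v (uv : [set u; v]%SET \in edges H) :
    minor T G H -> u \notin T -> minor T G (contract_edge uv).

End Minors.

Section Distances.
Variables (R : realType) (V : finType).
Implicit Types (G H : graph V) (T : {set V}) (l : {set V} -> R).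

Definition adj G : rel V := fun x y => [set x; y]%SET \in edges G.

Definition length_function G l := forall e, e \in edges G -> 0 < l e.

Definition walk_length l (x : V) (p : seq V) : R :=
  \sum_(e <- pairmap (fun a b => [set a; b]%SET) x p) l e.

(* The infimum of the empty set is +oo: vertices in different connected
   components are at infinite distance. *)
Definition dist G l (x y : V) : \bar R :=
  ereal_inf [set (walk_length l x p)%:E |
              p in [set p | path (adj G) x p /\ last x p = y]]%classic.

Definition DAM (alpha : R) T G l H l' :=
  [/\ minor T G H, length_function H l' &
      forall t t', t \in T -> t' \in T ->
        (dist G l t t' <= dist H l' t t')%E /\
        (dist H l' t t' <= alpha%:E * dist G l t t')%E].

Definition sized_DAM (alpha y : R) T G l H l' :=
  DAM alpha T G l H l' /\ #|verts H :\: T|%:R <= y.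

End Distances.

(* A drawing in the plane: distinct vertices are distinct points, each edge is a
   simple arc joining its two ends, and an arc meets the vertices and the other
   arcs at most at its ends. *)
Definition planar (R : realType) (V : finType) (G : graph V) :=
  exists (pos : V -> R * R) (arc : {set V} -> R -> R * R),
  [/\ {in verts G &, injective pos},
      forall e, e \in edges G ->
        [/\ {within `[0%R, 1%R], continuous (arc e)}%classic,
            {in `[0%R, 1%R] &, injective (arc e)} &
            [set pos x | x in [set` e]]%classic
              = [set arc e 0; arc e 1]%classic],
      forall e v (s : R), e \in edges G -> v \in verts G -> s \in `]0%R, 1%R[ ->
        arc e s <> pos v &
      forall e e' (s s' : R), e \in edges G -> e' \in edges G -> e <> e' ->
        s \in `]0%R, 1%R[ -> s' \in `]0%R, 1%R[ -> arc e s <> arc e' s'].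

(* Main.v *)
(* Put k = #|T|. Two constructions are used, according to whether eps is below or
   above (100 (1 + ln k))^2.

   Small eps. Perturb the lengths so that shortest paths become unique. For a
   shortest-path tree of a planar graph rooted at r, some three root paths leave
   components containing at most half of any prescribed set of terminals: a planar
   drawing makes the graph a minor of a triangulated square grid, where such paths
   are found on fundamental cycles. Recursively, every terminal gets O(log k)
   shortest paths from r such that a walk between two terminals of the component of
   r meets a path common to both. Each terminal t puts O(1/eps) portals on each of
   its paths, so that going to the path through a portal costs a factor 1 + eps.
   The shortest paths from terminals to portals and from r along the separators
   number O(k log k / eps); two of them meet in a common subpath, so contracting
   all but the O((k log k / eps)^2) vertices where they meet or part, and the
   terminals and portals, gives the minor.

   Large eps. There is a minor on T alone with stretch O((log k)^2), obtained by
   contracting the clusters of a relaxed Voronoi partition (Filtser): terminals in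
   turn absorb the free vertices v reachable by walks whose prefixes have length at
   most (1 + 1/m)^g times the distance from their end to T, with m = O(log k). For g
   truncated geometric, the clusters met by a shortest path cost O((log k)^2) times
   its length; the g are chosen one after the other by the method of conditional
   expectations for the sum over pairs of terminals of an exponential potential. *)

Require Import Defs.
From HB Require Import structures.
From mathcomp Require Import all_boot all_order all_algebra.
From mathcomp Require Import all_classical all_reals all_analysis.
From mathcomp Require Import zify ring lra.

Set Implicit Arguments.
Unset Strict Implicit.
Unset Printing Implicit Defensive.

Import Order.TTheory GRing.Theory Num.Theory numFieldNormedType.Exports.

Local Open Scope ring_scope.

(** * Separators of the triangular lattice *)

(** Drawings use arbitrary continuous arcs, and the obstacle is topological: a separator needs an
    inside and an outside. Cutting the arcs into thirds and sampling them finely replaces the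
    drawing by connected sets of grid cells, and in the grid the Jordan curve theorem becomes linear
    algebra mod 2: every cycle of the box bounds exactly one set of triangles. The tree is extended
    along the border of the box, so that one last border edge encloses the whole box and a descent
    can start there. The perturbation of the lengths makes the count quadratic: with unique shortest
    paths an ordered pair of paths contributes only two vertices, where the common subpath starts
    and ends. Two regimes are forced by the statement. For large $\varepsilon$ the bound falls below
    1, so a minor without non-terminals is needed, and its excess stretch $(100(1+\ln k))^2$ sets
    the threshold. Below it, the construction is run with $\min(\varepsilon,1)$; as $\varepsilon$
    may exceed this by a factor $O((\ln k)^2)$, squaring costs four logarithms and the hierarchy two
    more, hence the exponent 6. *)

Section Lattice.
Local Open Scope nat_scope.

(* Vertices of the triangular lattice are pairs of naturals; the edge (p, k)
   joins p to p + (1,0), p + (0,1), p + (1,1) for k = 0, 1, 2, and the triangles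
   (p, true), (p, false) are those below and above the diagonal at p. *)
Notation pt := (nat * nat)%type.
Notation edge := (pt * nat)%type.
Notation tri := (pt * bool)%type.
Implicit Types (p q z : pt) (e f g : edge) (t : tri) (c : edge -> bool)
  (A B : tri -> bool).

Definition edge_end e : pt :=
  match e.2 with 0 => (e.1.1.+1, e.1.2) | 1 => (e.1.1, e.1.2.+1)
  | _ => (e.1.1.+1, e.1.2.+1) end.

(** With truncated predecessors this is the star of [p] only when both coordinates are positive;
    this is why [posp] accompanies it and why boxes start at 1. *)
Definition edges_at p : seq edge :=
  [:: (p, 0); ((p.1.-1, p.2), 0); (p, 1); ((p.1, p.2.-1), 1); (p, 2);
      ((p.1.-1, p.2.-1), 2)].

Definition lattice_adj p q := [exists k : 'I_3,
  (q == edge_end (p, nat_of_ord k)) || (p == edge_end (q, nat_of_ord k))].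

Definition edge_of p q : edge :=
  if q == edge_end (p, 0) then (p, 0) else if q == edge_end (p, 1) then (p, 1)
  else if q == edge_end (p, 2) then (p, 2) else if p == edge_end (q, 0) then (q, 0)
  else if p == edge_end (q, 1) then (q, 1) else (q, 2).

Definition posp p := (0 < p.1) && (0 < p.2).

Lemma lattice_adjP p q : reflect
  (exists2 k, k < 3 & q = edge_end (p, k) \/ p = edge_end (q, k)) (lattice_adj p q).
Proof.
apply: (iffP existsP) => [[k /orP[]/eqP E]|[k k3 E]].
- by exists k => //; left.
- by exists k => //; right.
- by exists (Ordinal k3); case: E => /= <-; rewrite eqxx ?orbT.
Qed.

Lemma lattice_adj_sym p q : lattice_adj p q = lattice_adj q p.
Proof. by apply: eq_existsb => k; rewrite orbC. Qed.

Lemma edge_of_endl p k : k < 3 -> edge_of p (edge_end (p, k)) = (p, k).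
Proof.
case: p => x y; case: k => [|[|[|//]]] _; rewrite /edge_of /edge_end /= ?xpair_eqE /=;
  repeat (case: ifP; [move=> /andP[/eqP ? /eqP ?] | move=> ?]); try by []; exfalso; lia.
Qed.

Lemma edge_of_endr p k : k < 3 -> edge_of (edge_end (p, k)) p = (p, k).
Proof.
case: p => x y; case: k => [|[|[|//]]] _; rewrite /edge_of /edge_end /= ?xpair_eqE /=;
  repeat (case: ifP; [move=> /andP[/eqP ? /eqP ?] | move=> ?]); try by []; exfalso; lia.
Qed.

Lemma edge_of_sym p q : lattice_adj p q -> edge_of p q = edge_of q p.
Proof.
by move=> /lattice_adjP[k k3 [->|->]]; rewrite edge_of_endl // edge_of_endr.
Qed.

Lemma edges_atP p e : posp p -> e \in edges_at p ->
  e.2 < 3 /\ (e.1 = p \/ edge_end e = p).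
Proof.
case: p => x y /andP[/= x0 y0].
rewrite !inE => /or4P[|||/or3P[]] /eqP->; rewrite /edge_end /=; split=> //;
  rewrite ?prednK //; by [left | right].
Qed.

Lemma count_edges_at z p k : posp z -> k < 3 ->
  count_mem (p, k) (edges_at z) = (z == p) + (z == edge_end (p, k)).
Proof.
case: z p => [x y] [a b] /andP[/= x0 y0]; case: k => [|[|[|//]]] _;
  rewrite /edge_end /= !xpair_eqE /=; lia.
Qed.

(** The boundary operator mod 2 from edges to vertices. With [tri_bd], from triangles to edges, it
    forms a chain complex in which [bd_tri_bd] is the relation $\partial\partial=0$. *)
Definition bd c z := odd (count c (edges_at z)).

Lemma bdD c1 c2 z : bd (fun e => c1 e (+) c2 e) z = bd c1 z (+) bd c2 z.
Proof.
rewrite /bd; elim: (edges_at z) => //= e s IH; rewrite !oddD IH !oddb.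
by case: (c1 e) (c2 e) (odd _) (odd _) => [] [] [] [].
Qed.

Lemma eq_bd c1 c2 z : c1 =1 c2 -> bd c1 z = bd c2 z.
Proof. by move=> E; rewrite /bd (eq_count E). Qed.

Lemma bd_edge p q z : posp z -> lattice_adj p q ->
  bd (fun e => e == edge_of p q) z = (z == p) (+) (z == q).
Proof.
move=> z0 /lattice_adjP[k k3 E].
suff H a : bd (fun e => e == (a, k)) z = (z == a) (+) (z == edge_end (a, k)).
  by case: E => ->; rewrite ?edge_of_endl ?edge_of_endr ?H // addbC.
by rewrite /bd count_edges_at // oddD !oddb.
Qed.

Definition tri1 e : tri := match e.2 with 1 => (e.1, false) | _ => (e.1, true) end.
Definition tri2 e : tri := match e.2 with 0 => ((e.1.1, e.1.2.-1), false)
  | 1 => ((e.1.1.-1, e.1.2), true) | _ => (e.1, false) end.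
Definition tri_bd A e := (e.2 < 3) && (A (tri1 e) (+) A (tri2 e)).

Lemma bd_tri_bd A z : bd (tri_bd A) z = false.
Proof.
rewrite /bd /tri_bd /tri1 /tri2 /= !oddD !oddb /=.
by case: (A _) (A _) (A _) (A _) (A _) (A _) => [] [] [] [] [] [].
Qed.

Lemma tri_bdD A B e : tri_bd (fun t => A t (+) B t) e = tri_bd A e (+) tri_bd B e.
Proof.
rewrite /tri_bd; case: (_ < 3) => //=.
by case: (A _) (A _) (B _) (B _) => [] [] [] [].
Qed.

Lemma eq_tri_bd A B e : A =1 B -> tri_bd A e = tri_bd B e.
Proof. by move=> E; rewrite /tri_bd !E. Qed.

Variable N : nat.

Definition in_box p := [&& 0 < p.1, p.1 <= N, 0 < p.2 & p.2 <= N].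
Definition edge_in e := [&& e.2 < 3, in_box e.1 & in_box (edge_end e)].
Definition tri_in t := [&& 0 < t.1.1, t.1.1 < N, 0 < t.1.2 & t.1.2 < N].
Definition edge_chain c := forall e, c e -> edge_in e.
Definition tri_chain A := forall t, A t -> tri_in t.
Definition cycle_chain c := edge_chain c /\ forall z, posp z -> bd c z = false.

Lemma in_box_pos p : in_box p -> posp p.
Proof. by move=> /and4P[? _ ? _]; apply/andP. Qed.

Lemma tri_bd_chain A : tri_chain A -> edge_chain (tri_bd A).
Proof.
move=> hA [[x y] k]; rewrite /tri_bd /edge_in /in_box /edge_end /tri1 /tri2 /=.
move=> /andP[k3]; case: (boolP (A _)) => [/hA|_ /= /hA].
  by case: k k3 => [|[|[|//]]] _; rewrite /tri_in /=; lia.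
by case: k k3 => [|[|[|//]]] _; rewrite /tri_in /=; lia.
Qed.

(** A column of triangles is determined from below: the row under the box is empty, and each
    triangle differs from the one beneath it by the value of the boundary on their common horizontal
    or diagonal edge. *)
Lemma tri_bd_inj A B : tri_chain A -> tri_chain B ->
  (forall e, edge_in e -> tri_bd A e = tri_bd B e) -> A =1 B.
Proof.
move=> hA hB E [[x y] b].
have [t0|nt] := boolP (tri_in (x, y, b)); last first.
  by apply/idP/idP => [/hA|/hB]; rewrite (negPf nt).
have {t0} : [&& 0 < x, x < N & y < N] by move: t0; rewrite /tri_in /=; lia.
elim: y b => [|y IH] b /and3P[x0 xN yN].
  by apply/idP/idP => [/hA|/hB]; rewrite /tri_in /=; lia.
have IHf : A (x, y, false) = B (x, y, false) by apply: IH; rewrite x0 xN ltnW.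
have Eh : A (x, y.+1, true) = B (x, y.+1, true).
  have /E : edge_in ((x, y.+1), 0) by rewrite /edge_in /in_box /edge_end /=; lia.
  by rewrite /tri_bd /= /tri1 /tri2 /= IHf; case: (A _) (B _) (B (x, y, false)) => [] [] [].
case: b => //.
have /E : edge_in ((x, y.+1), 2) by rewrite /edge_in /in_box /edge_end /=; lia.
by rewrite /tri_bd /= /tri1 /tri2 /= Eh => /addbI.
Qed.

(** [fill] inverts the boundary by adding up, from the bottom of a column, the horizontal and
    diagonal edges crossed: the parity test for the inside of a closed curve. Vertical edges do not
    enter; [fill_v] recovers them from the cycle condition. *)
Fixpoint fill_above c y x : bool := if y is y'.+1
  then c ((x, y), 2) (+) (c ((x, y), 0) (+) fill_above c y' x) else false.
Definition fill c t : bool := if t.2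
  then c (t.1, 0) (+) fill_above c t.1.2.-1 t.1.1 else fill_above c t.1.2 t.1.1.

Lemma fill_h c x y : edge_chain c -> fill c ((x, y), true) = c ((x, y), 0) (+) fill c ((x, y.-1), false).
Proof. by []. Qed.

Lemma fill_d c x y : edge_chain c -> fill c ((x, y), false) = c ((x, y), 2) (+) fill c ((x, y), true).
Proof.
move=> hc; case: y => // /=.
rewrite /fill /=; have := hc (x, 0, 2); have := hc (x, 0, 0).
rewrite /edge_in /in_box /edge_end /= !andbF /=.
by case: (c _) => [/(_ isT)//|_]; case: (c _) => [/(_ isT)|].
Qed.

(** Induction up the column: evenness at [(x.+1, y.+1)] expresses the vertical edge above that
    vertex by the one below it and the four other edges there, and these are the four edges by which
    the two fillings change. *)
Lemma fill_v c x y : cycle_chain c ->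
  c ((x.+1, y), 1) = fill c ((x.+1, y), false) (+) fill c ((x, y), true).
Proof.
move=> [hc even]; elim: y => [|y IH].
  rewrite /fill /=; have := hc (x.+1, 0, 1); have := hc (x, 0, 0).
  rewrite /edge_in /in_box /edge_end /= !andbF /=.
  by case: (c _) => [/(_ isT)//|_]; case: (c _) => [/(_ isT)|].
have := even (x.+1, y.+1) isT.
rewrite /bd /= !oddD !oddb /= (fill_d _ _ hc) !(fill_h _ _ hc) /=.
move: IH; rewrite (fill_d x y hc).
case: (c _) (c _) (c _) (c _) (c _) (c _) (fill _ _) (fill _ _) => [] [] [] [] [] [] [] [] //.
Qed.

Lemma fill_chain c : cycle_chain c -> tri_chain (fill c).
Proof.
move=> hcc; have [hc even] := hcc.
have c0 e : edge_in e = false -> c e = false by move=> h; apply/negP => /hc; rewrite h.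
have F0 x y b : (x == 0) || (N <= x) -> fill c ((x, y), b) = false.
  move=> hx; have L0 : fill c ((x, y), false) = false.
    elim: y => [|y IH] //; rewrite fill_d // fill_h // IH !c0 //;
     by rewrite /edge_in /in_box /edge_end /=; lia.
  case: b => //; have := fill_d x y hc; rewrite L0 c0.
    by case: (fill c _).
  by rewrite /edge_in /in_box /edge_end /=; lia.
have Y0 x y : N <= y -> fill c ((x, y), true) = false.
  move=> Ny; elim: x => [|x IH]; first by rewrite F0.
  have := fill_v x y hcc; rewrite IH fill_d // !c0 /=; first by case: (fill _ _).
  by rewrite /edge_in /in_box /edge_end /=; lia.
  by rewrite /edge_in /in_box /edge_end /=; lia.
case=> [[x y] b]; apply: contraLR; rewrite /tri_in /= => h.
have [hx|hx] := boolP ((x == 0) || (N <= x)); first by rewrite F0.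
have {h} hy : y == 0 \/ N <= y by lia.
case: hy => hy.
  rewrite (eqP hy) /fill /= c0; first by case: b.
  by rewrite /edge_in /in_box /edge_end /=; lia.
case: b; first by rewrite Y0.
rewrite fill_d // Y0 // c0 //.
by rewrite /edge_in /in_box /edge_end /=; lia.
Qed.

(** With [tri_bd_inj], every cycle of the box bounds exactly one set of triangles. This plays the
    role of the Jordan curve theorem. *)
Lemma fill_bd c : cycle_chain c -> tri_bd (fill c) =1 c.
Proof.
move=> hcc [[x y] k]; have [hc _] := hcc.
have c0 e : edge_in e = false -> c e = false by move=> h; apply/negP => /hc; rewrite h.
rewrite /tri_bd /tri1 /tri2 /=; case: k => [|[|[|k]]] /=.
- by rewrite fill_h //; case: (c _) (fill _ _) => [] [].
- case: x => [|x] /=; last by rewrite -fill_v.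
  rewrite c0; last by rewrite /edge_in /in_box /edge_end /=; lia.
  apply/negbTE/negP => H; have := @fill_chain _ hcc (0, y, false).
  have := @fill_chain _ hcc (0, y, true); rewrite /tri_in /=.
  by move: H; case: (fill _ _) (fill _ _) => [] [] //= _ H1 H2; first [by have := H1 isT | by have := H2 isT].
- by rewrite (fill_d _ _ hc); case: (c _) (fill _ _) => [] [].
- by rewrite c0 // /edge_in.
Qed.

Lemma cycle0 c : edge_chain c -> (forall z, in_box z -> bd c z = false) -> cycle_chain c.
Proof.
move=> hc hz; split=> // z z0; have [/hz//|nz] := boolP (in_box z).
rewrite /bd (_ : count c _ = 0) //; apply/eqP; rewrite -leqn0 leqNgt -has_count.
apply/hasPn => e /(edges_atP z0)[e3 E]; apply: contra nz => /hc/and3P[_ h1 h2].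
by case: E => <-.
Qed.

Lemma cycleD c1 c2 : cycle_chain c1 -> cycle_chain c2 -> cycle_chain (fun e => c1 e (+) c2 e).
Proof.
move=> [h1 e1] [h2 e2]; split=> [e|z z0]; last by rewrite bdD e1 // e2.
by case: (boolP (c1 e)) => [/h1//|_]; case: (boolP (c2 e)) => [/h2|].
Qed.

Lemma cycle_scale (b : bool) c : cycle_chain c -> cycle_chain (fun e => b && c e).
Proof.
case: b => // _; split=> // z z0; rewrite /bd (eq_count (a2 := pred0)) ?count_pred0 //.
Qed.

Lemma tri_bd_cycle A : tri_chain A -> cycle_chain (tri_bd A).
Proof. by move=> hA; split=> [|z _]; [apply: tri_bd_chain | apply: bd_tri_bd]. Qed.

(** Consecutive triangles around [z] share an edge at [z], on which the boundary [c] of the filling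
    vanishes. So a vertex avoided by a cycle lies on a definite side of it, read off at
    [(z, true)]. *)
Lemma fill_star c z : cycle_chain c -> posp z ->
  (forall e, e \in edges_at z -> c e = false) ->
  [/\ fill c (z, false) = fill c (z, true),
      fill c ((z.1, z.2.-1), false) = fill c (z, true),
      fill c ((z.1.-1, z.2), true) = fill c (z, true),
      fill c ((z.1.-1, z.2.-1), true) = fill c (z, true) &
      fill c ((z.1.-1, z.2.-1), false) = fill c (z, true)].
Proof.
move=> hc z0 h0.
have {}h0 e : e \in edges_at z -> tri_bd (fill c) e = false by move=> /h0; rewrite fill_bd.
move: (h0 (z, 0)) (h0 ((z.1.-1, z.2), 0)) (h0 (z, 1)) (h0 ((z.1, z.2.-1), 1)) (h0 (z, 2))
  (h0 ((z.1.-1, z.2.-1), 2)).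
rewrite !inE !eqxx ?orbT /tri_bd /tri1 /tri2 /=.
by case: (fill c _) (fill c _) (fill c _) (fill c _) (fill c _) (fill c _) =>
  [] [] [] [] [] [] H1 H2 H3 H4 H5 H6; split=> //; move: (H1 isT) (H2 isT) (H3 isT) (H4 isT) (H5 isT) (H6 isT).
Qed.

(** * Fundamental cycles of a spanning tree of the box and the regions they bound *)

Variables (par : pt -> pt) (rk : pt -> nat) (root : pt).
Hypothesis parP : forall p, in_box p -> p != root ->
  [/\ lattice_adj p (par p), in_box (par p) & rk (par p) < rk p].

Definition tree_edge e := edge_in e &&
  ((e.1 != root) && (par e.1 == edge_end e) ||
   (edge_end e != root) && (par (edge_end e) == e.1)).

Lemma edge_of_in p q : in_box p -> in_box q -> lattice_adj p q -> edge_in (edge_of p q).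
Proof.
move=> pb qb /lattice_adjP[k k3 [] E]; rewrite {}E in pb qb *;
  by rewrite ?edge_of_endl ?edge_of_endr // /edge_in k3 pb qb.
Qed.

Lemma edge_in_adj e : edge_in e -> lattice_adj e.1 (edge_end e) /\ edge_of e.1 (edge_end e) = e.
Proof.
case: e => p k /and3P[k3 _ _]; rewrite /= edge_of_endl //.
by split=> //; apply/lattice_adjP; exists k => //; left.
Qed.

Lemma tree_edge_par p : in_box p -> p != root -> tree_edge (edge_of p (par p)).
Proof.
move=> pb pr; have [a b _] := parP pb pr.
rewrite /tree_edge edge_of_in //=.
move: a => /lattice_adjP[k k3 [] E].
  by rewrite (_ : edge_of p (par p) = (p, k)) ?E ?edge_of_endl //= -E pr eqxx.
have -> : edge_of p (par p) = (par p, k) by rewrite {1}E edge_of_endr.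
by rewrite /= -E pr eqxx orbT.
Qed.

(** Among the vertices whose parent edge lies in [c], one of maximal rank has no other edge of [c],
    since such an edge would be the parent edge of a vertex of larger rank; the boundary of [c] is
    odd there. *)
Lemma tree_acyclic c : cycle_chain c -> (forall e, c e -> tree_edge e) -> c =1 (fun=> false).
Proof.
move=> [hc even] ct.
pose good p := [&& in_box p, p != root & c (edge_of p (par p))].
have up e : c e -> exists2 p, good p & (p = e.1 \/ p = edge_end e).
  move=> ce; have /andP[ein /orP[]/andP[nr /eqP E]] := ct _ ce;
    have [a1 a2] := edge_in_adj ein; have /and3P[_ b1 b2] := ein.
    by exists e.1; [rewrite /good b1 nr E a2 | left].
  exists (edge_end e); last by right.
  by rewrite /good b2 nr E edge_of_sym 1?lattice_adj_sym // a2.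
suff ng p : ~~ good p.
  by move=> e; apply/negbTE/negP => /up[p gp _]; move: (ng p); rewrite gp.
pose bl := [seq (x, y) | x <- iota 0 N.+1, y <- iota 0 N.+1].
have inbl q : in_box q -> q \in bl.
  case: q => x y /and4P[/= _ xN _ yN].
  by apply/allpairsP; exists (x, y); rewrite !mem_iota !ltnS xN yN.
apply/negP => gp.
pose Q n := has (fun q => good q && (rk q == n)) bl.
have exQ : exists n, Q n.
  by exists (rk p); apply/hasP; exists p; rewrite ?gp ?eqxx //; apply: inbl; case/and3P: gp.
have bQ n : Q n -> n <= \max_(q <- bl) rk q.
  by move=> /hasP[q ql /andP[_ /eqP <-]]; apply: leq_bigmax_seq.
have [n] := ex_maxnP exQ bQ.
move=> /hasP[q ql /andP[/and3P[qb qr cq] /eqP <-]] mx.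
have [adj pb rlt] := parP qb qr.
have := even q (in_box_pos qb); rewrite /bd.
have E : {in edges_at q, c =1 pred1 (edge_of q (par q))}.
  move=> e eq; have [e3 qe] := edges_atP (in_box_pos qb) eq.
  apply/idP/idP => [ce|/eqP-> //].
  have /andP[ein te] := ct _ ce; have [a1 a2] := edge_in_adj ein; have /and3P[_ b1 b2] := ein.
  have abs u : in_box u -> u != root -> par u = q -> edge_of u q = e -> False.
    move=> ub ur pu eu; have := mx (rk u); have [_ _] := parP ub ur; rewrite pu ltnNge.
    move=> /negP nle /(_ _)/nle; apply; apply/hasP; exists u; first exact: inbl.
    by rewrite /good ub ur pu eu ce eqxx.
  case: qe te => [E1|E2] /orP[]/andP[nr /eqP E]; rewrite /=.
  - by rewrite -E1 E a2.
  - by case: (abs _ b2 nr); [rewrite E | rewrite -E1 edge_of_sym 1?lattice_adj_sym].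
  - by case: (abs _ b1 nr); [rewrite E | rewrite -E2].
  - by rewrite -E2 E edge_of_sym 1?lattice_adj_sym // a2.
rewrite (eq_in_count E); move: adj => /lattice_adjP[k k3 [] E'].
  rewrite E' edge_of_endl // count_edges_at ?in_box_pos // eqxx -E'.
  by move: rlt; case: eqP => // <-; rewrite ltnn.
have -> : edge_of q (par q) = (par q, k) by rewrite {1}E' edge_of_endr.
rewrite count_edges_at ?in_box_pos // -E' eqxx.
by move: rlt; case: eqP => // <-; rewrite ltnn.
Qed.

(** The first argument is fuel; as ranks drop along [par], the fuel [rk p] used in [Up] suffices to
    reach the root. *)
Fixpoint root_walk n p : seq pt :=
  p :: (if n is n'.+1 then if p == root then [::] else root_walk n' (par p) else [::]).
Fixpoint root_edges n p : seq edge :=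
  if n is n'.+1 then if p == root then [::] else edge_of p (par p) :: root_edges n' (par p)
  else [::].
Definition Up p := root_walk (rk p) p.
Definition path_chain p e := odd (count_mem e (root_edges (rk p) p)).

Lemma root_edges_bd n p z : in_box p -> rk p <= n -> posp z ->
  bd (fun e => odd (count_mem e (root_edges n p))) z = (z == p) (+) (z == root).
Proof.
have nil_bd : bd (fun e => odd (count_mem e [::])) z = false.
  by rewrite /bd (eq_count (a2 := pred0)) ?count_pred0.
elim: n p => [|n IH] p pb pn z0 /=.
  have [->|pr] := eqVneq p root; first by rewrite nil_bd addbb.
  by have [_ _] := parP pb pr; rewrite ltnNge (leq_trans pn).
have [->|pr] := eqVneq p root; first by rewrite nil_bd addbb.
have [adj pb' lt] := parP pb pr.
rewrite (@eq_bd _ (fun e => (e == edge_of p (par p)) (+) odd (count_mem e (root_edges n (par p))))).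
  rewrite bdD bd_edge // IH //; last by rewrite -ltnS (leq_trans lt).
  by case: (z == p) (z == par p) (z == root) => [] [] [].
by move=> e /=; rewrite oddD oddb eq_sym.
Qed.

Lemma root_edges_tree n p e : in_box p -> e \in root_edges n p -> tree_edge e.
Proof.
elim: n p => //= n IH p pb; have [//|pr] := eqVneq p root.
have [_ pb' _] := parP pb pr.
by rewrite inE => /orP[/eqP->|/IH-> //]; apply: tree_edge_par.
Qed.

Lemma root_edges_walk n p e : in_box p -> e \in root_edges n p ->
  e.1 \in root_walk n p /\ edge_end e \in root_walk n p.
Proof.
elim: n p => //= n IH p pb; have [//|pr] := eqVneq p root.
have [adj pb' _] := parP pb pr.
have hd m q : q \in root_walk m q by case: m => [|m]; rewrite /= inE eqxx.
rewrite inE => /orP[/eqP->|/IH[] // h1 h2]; last by rewrite !inE h1 h2 !orbT.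
move: adj => /lattice_adjP[k k3 [] E].
  have -> : edge_of p (par p) = (p, k) by rewrite E edge_of_endl.
  by rewrite -E /= !inE eqxx hd !orbT.
have -> : edge_of p (par p) = (par p, k) by rewrite {1}E edge_of_endr.
by rewrite -E /= !inE eqxx hd !orbT.
Qed.

(* For a tree edge e this chain is zero. *)
Definition fund e e' := (e' == e) (+) (path_chain e.1 e' (+) path_chain (edge_end e) e').
Definition region e := fill (fund e).

Lemma path_chain_tree p e : in_box p -> path_chain p e -> tree_edge e.
Proof.
move=> pb h; apply: (@root_edges_tree (rk p) p) => //.
by rewrite -has_pred1 has_count; move: h; rewrite /path_chain; case: (count_mem _ _).
Qed.

Lemma fund_tree e e' : edge_in e -> fund e e' -> e' != e -> tree_edge e'.
Proof.
move=> /and3P[_ b1 b2]; rewrite /fund => h /negPf ne; move: h; rewrite ne /=.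
by case: (boolP (path_chain e.1 e')) => [/path_chain_tree->//|_ /path_chain_tree->].
Qed.

Lemma fund_cycle e : edge_in e -> cycle_chain (fund e).
Proof.
move=> ein; have /and3P[k3 b1 b2] := ein; apply: cycle0 => [e' h|z zb].
  have [->//|ne] := eqVneq e' e; by have /andP[] := fund_tree ein h ne.
have z0 := in_box_pos zb; have [adj Ee] := edge_in_adj ein.
rewrite bdD -{1}Ee bd_edge // bdD !root_edges_bd //.
by case: (z == _) (z == _) (z == _) => [] [] [].
Qed.

Lemma fund_self e : edge_in e -> ~~ tree_edge e -> fund e e.
Proof.
move=> /and3P[_ b1 b2] nt; rewrite /fund eqxx.
case: (boolP (path_chain e.1 e)) => [/path_chain_tree te|_]; first by rewrite te in nt.
case: (boolP (path_chain _ e)) => [/path_chain_tree te|_//]; by rewrite te in nt.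
Qed.

Lemma fund0 e : edge_in e -> tree_edge e -> fund e =1 (fun=> false).
Proof.
move=> ein te; apply: tree_acyclic; first exact: fund_cycle.
by move=> e' h; have [->//|/(fund_tree ein h)] := eqVneq e' e.
Qed.

Lemma region_bd e : edge_in e -> tri_bd (region e) =1 fund e.
Proof. by move=> /fund_cycle; apply: fill_bd. Qed.

Lemma region_in e : edge_in e -> tri_chain (region e).
Proof. by move=> /fund_cycle; apply: fill_chain. Qed.

Lemma region0 e : edge_in e -> tree_edge e -> region e =1 (fun=> false).
Proof.
move=> ein te; have z := fund0 ein te.
apply: tri_bd_inj (region_in ein) _ _ => // e' _.
by rewrite region_bd // z /tri_bd /= andbF.
Qed.

(* The boundary of the intersection of two regions is supported on the tree and
   the two edges, hence is a combination of their two fundamental cycles. *)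
Lemma region_laminar e f : edge_in e -> edge_in f -> ~~ tree_edge e -> ~~ tree_edge f ->
  e != f -> [\/ forall t, ~~ (region e t && region f t),
    forall t, region e t -> region f t | forall t, region f t -> region e t].
Proof.
move=> ein fin nte ntf ef.
pose I t := region e t && region f t.
have Ich : tri_chain I by move=> t /andP[/(region_in ein)].
pose c e' := tri_bd I e' (+) ((tri_bd I e && fund e e') (+) (tri_bd I f && fund f e')).
have cc : cycle_chain c.
  apply: cycleD; first exact: tri_bd_cycle.
  by apply: cycleD; apply: cycle_scale; apply: fund_cycle.
have fe : fund e f = false.
  by apply/negP => /(fund_tree ein) te; move: ntf; rewrite te // eq_sym.
have ef0 : fund f e = false.
  by apply/negP => /(fund_tree fin) te; move: nte; rewrite te.
have c0 : c =1 (fun=> false).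
  apply: tree_acyclic => // e'; rewrite /c.
  have [->|e'e] := eqVneq e' e; first by rewrite fund_self // ef0; case: (tri_bd I e) (tri_bd I f) => [] [].
  have [->|e'f] := eqVneq e' f; first by rewrite fund_self // fe; case: (tri_bd I f) (tri_bd I e) => [] [].
  have [/(fund_tree ein)->//|Ze] := boolP (fund e e').
  have [/(fund_tree fin)->//|Zf] := boolP (fund f e').
  rewrite !andbF addbF.
  move: Ze Zf; rewrite -!region_bd // /tri_bd /I.
  case: (_ < 3) => //=.
  by case: (region e _) (region e _) (region f _) (region f _) => [] [] [] [].
pose J t := (tri_bd I e && region e t) (+) (tri_bd I f && region f t).
have Jch : tri_chain J.
  move=> t; rewrite /J; case: (boolP (region e t)) => [/(region_in ein)//|_].
  by rewrite andbF; case: (boolP (region f t)) => [/(region_in fin)//|_]; rewrite andbF.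
have sc (b : bool) A e' : tri_bd (fun t => b && A t) e' = b && tri_bd A e'.
  by case: b => //=; rewrite /tri_bd andbF.
have IJ : I =1 J.
  apply: tri_bd_inj => // e' _; have := c0 e'; rewrite /c /J tri_bdD !sc !region_bd //.
  by move/eqP; rewrite eqbF_neg negb_add => /eqP.
move: IJ; rewrite /I /J; case: (tri_bd I e) (tri_bd I f) => [] [] IJ.
- by constructor 1 => t; have := IJ t; case: (region e t) (region f t) => [] [].
- by constructor 2 => t; have := IJ t; case: (region e t) (region f t) => [] [].
- by constructor 3 => t; have := IJ t; case: (region e t) (region f t) => [] [].
- by constructor 1 => t; have := IJ t; case: (region e t) (region f t) => [] [].
Qed.

Definition tri_edges t : seq edge := if t.2
  then [:: (t.1, 0); ((t.1.1.+1, t.1.2), 1); (t.1, 2)]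
  else [:: (t.1, 1); ((t.1.1, t.1.2.+1), 0); (t.1, 2)].

Lemma tri_bd1 t e : edge_in e -> tri_bd (pred1 t) e = (e \in tri_edges t).
Proof.
case: t => [[x y] b]; case: e => [[x' y'] k]; rewrite /edge_in /in_box /tri_bd /tri_edges /tri1 /tri2 /=.
case: k => [|[|[|k]]] //= /and3P[/and4P[? ? ? ?] _ _]; case: b; rewrite /= ?inE /= !xpair_eqE /= ?xpair_eqE; lia.
Qed.

Lemma tri_edges_in t e : tri_in t -> e \in tri_edges t -> edge_in e.
Proof.
case: t => [[x y] b] h; move: h; rewrite /tri_in /tri_edges /edge_in /in_box /edge_end /= => h.
by case: b; rewrite !inE => /or3P[]/eqP-> /=; lia.
Qed.

Lemma tri1_edge e : e.2 < 3 -> posp e.1 -> forall t, t = tri1 e \/ t = tri2 e -> e \in tri_edges t.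
Proof.
case: e => [[x y] k] k3 /andP[/= x0 y0] t.
case: k k3 => [|[|[|//]]] _ [] ->; rewrite /tri1 /tri2 /tri_edges /= ?inE ?prednK ?eqxx ?orbT //.
Qed.

Lemma fund_nontree e e' : edge_in e -> ~~ tree_edge e' -> fund e e' = (e' == e).
Proof.
move=> ein nt; have [E|ne] := eqVneq e' e.
  by rewrite E in nt *; rewrite fund_self.
by apply/negP => /(fund_tree ein)/(_ ne); apply/negP.
Qed.

Lemma tri_edges_uniq t : uniq (tri_edges t).
Proof. by case: t => [[x y] []]; rewrite /tri_edges /= !inE !xpair_eqE /= !andbF /= ?andbT. Qed.

(** The boundary of the single triangle and the fundamental cycles of its three edges add up to a
    cycle in the tree, which is zero; so the three regions add up to the triangle. *)
Lemma region_split t e f : tri_in t -> e \in tri_edges t -> f \in tri_edges t -> e != f ->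
  exists g, [/\ edge_in g, g != e, g != f, (forall e', e' \in tri_edges t -> [|| e' == e, e' == f | e' == g])
    & forall t', (t' == t) = (region e t' (+) (region f t' (+) region g t'))].
Proof.
move=> tin et ft ef.
pose s := [seq x <- tri_edges t | x \notin [:: e; f]].
have sz : size s = 1.
  have := count_predC (mem [:: e; f]) (tri_edges t); rewrite -size_filter.
  have -> : size (tri_edges t) = 3 by rewrite /tri_edges; case: (t.2).
  have -> : size [seq x <- tri_edges t | mem [:: e; f] x] = 2.
    apply: (@perm_size _ _ [:: e; f]); apply: uniq_perm.
    - by rewrite filter_uniq // tri_edges_uniq.
    - by rewrite /= inE ef.
    by move=> x; rewrite mem_filter /= !inE; case: eqP => [->|_]; [rewrite et | case: eqP => [->|//]; rewrite ft].
  by rewrite /s size_filter; case.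
case E : s sz => [|g [|? ?]] // _.
have gs x : (x \in tri_edges t) = [|| x == e, x == f | x == g].
  have : x \in s = (x == g) by rewrite E inE.
  rewrite mem_filter /= !inE; have [->|xe] := eqVneq x e; first by rewrite et.
  by have [->|xf] := eqVneq x f; first by rewrite ft.
have : g \in s by rewrite E inE.
rewrite mem_filter /= !inE negb_or => /andP[/andP[ge gf] gt].
have [ein fin gin] := And3 (tri_edges_in tin et) (tri_edges_in tin ft) (tri_edges_in tin gt).
exists g; split=> // [e'|t']; first by rewrite gs.
have h1 : tri_chain (pred1 t) by move=> ? /eqP->.
have h2 : tri_chain (fun t' => region e t' (+) (region f t' (+) region g t')).
  move=> u; case: (boolP (region e u)) => [/(region_in ein)//|_].
  case: (boolP (region f u)) => [/(region_in fin)//|_].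
  by case: (boolP (region g u)) => [/(region_in gin)|].
apply: (tri_bd_inj h1 h2) => e' e'in.
pose c e' := tri_bd (pred1 t) e' (+) (fund e e' (+) (fund f e' (+) fund g e')).
have : c e' = false.
  apply: tree_acyclic.
    apply: cycleD; first exact: tri_bd_cycle.
    by apply: cycleD; [|apply: cycleD]; apply: fund_cycle.
  move=> e1; apply: contraLR => nt; rewrite /c !fund_nontree //.
  have [e1in|ne1] := boolP (edge_in e1); last first.
    rewrite (_ : tri_bd _ _ = false); last by apply/negP => /(tri_bd_chain h1); apply/negP.
    by do 3! [case: eqP => [e1E|_]; first by rewrite e1E ?ein ?fin ?gin in ne1].
  rewrite tri_bd1 // gs.
  have [->|e1e] := eqVneq e1 e; first by rewrite (negPf ef) eq_sym (negPf ge).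
  by have [->|e1f] := eqVneq e1 f; [rewrite eq_sym (negPf gf) | case: eqP].
rewrite /c !tri_bdD !region_bd //.
by case: (tri_bd _ _) (fund _ _) (fund _ _) (fund _ _) => [] [] [] [].
Qed.

(** Leaving [t] through another non-tree edge shrinks the region. Laminarity leaves two other cases.
    The disjoint one is excluded by looking at [f]. If the region of [e] lay inside that of [f],
    then by [region_split] it would meet the region of the third edge in [t] alone; by laminarity
    one of these two regions would be [t] alone, and both alternatives contradict that [f] is not on
    the boundary of the region of [e]. *)
Lemma region_descent t e f : tri_in t -> e \in tri_edges t -> f \in tri_edges t ->
  region e t -> e != f -> ~~ tree_edge e -> ~~ tree_edge f ->
  (forall t', region f t' -> region e t') /\ exists2 t', tri_in t' & region e t' && ~~ region f t'.
Proof.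
move=> tin et ft At ef nte ntf.
have ein := tri_edges_in tin et; have fin := tri_edges_in tin ft.
have Zef : fund e f = false by rewrite fund_nontree // eq_sym (negPf ef).
have fne : region e =1 region f -> False.
  move=> E; move: Zef; rewrite -region_bd // (eq_tri_bd _ E) region_bd //.
  by rewrite fund_self.
suff sub : forall t', region f t' -> region e t'.
  split=> //; apply: contrapT => H; apply: fne => t'; apply/idP/idP => [h|/sub//].
  by apply: contrapT => /negP nf; apply: H; exists t'; rewrite ?h //; apply: (region_in ein).
have /and3P[f3 fb _] := fin.
case: (region_laminar ein fin nte ntf ef) => // [dis|sub].
  (* as f is not in the boundary of region e, both triangles at f lie in it *)
  exfalso.
  have ff : tri_bd (region f) f by rewrite region_bd // fund_self.
  have fe : tri_bd (region e) f = false by rewrite region_bd.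
  have := tri_bd1 t fin; rewrite ft.
  move: ff fe; rewrite /tri_bd f3 /=.
  have := dis (tri1 f); have := dis (tri2 f).
  have [E|] := eqVneq (tri1 f) t.
    by rewrite E At /=; case: (region e _) (region f _) (region f _) => [] [] [].
  have [E|//] := eqVneq (tri2 f) t.
  by rewrite E At /=; case: (region e _) (region f _) (region f _) => [] [] [].
have [g [gin ge gf gs spl]] := region_split tin et ft ef.
have At2 : region f t by apply: sub.
have gt : region g t by have := spl t; rewrite At At2 eqxx; case: (region g t).
have ntg : ~~ tree_edge g by apply: contraL gt => te; rewrite region0.
have sing u : region e u && region g u -> u = t.
  move=> /andP[eu gu]; apply/eqP; rewrite spl eu gu (sub u eu) //.
have eg : e != g by rewrite eq_sym.
case: (region_laminar ein gin nte ntg eg) => [dis|eg'|ge'].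
- by have := dis t; rewrite At gt.
- have E1 : region e =1 pred1 t.
    move=> u /=; apply/idP/eqP => [eu|->//]; by apply: sing; rewrite eu eg'.
  by move: Zef; rewrite -region_bd // (eq_tri_bd _ E1) tri_bd1 // ft.
- case: fne => u; have := spl u.
  have -> : (u == t) = region g u.
    by apply/eqP/idP => [->//|gu]; apply: sing; rewrite gu ge'.
  by case: (region g u) (region e u) (region f u) => [] [] [].
Qed.

Definition off2 e p := (p \notin Up e.1) && (p \notin Up (edge_end e)).

Lemma off2_fund e p : edge_in e -> in_box p -> off2 e p ->
  forall e', e' \in edges_at p -> fund e e' = false.
Proof.
move=> /and3P[_ b1 b2] pb /andP[n1 n2] e' e'p; apply/negbTE/negP.
have [_ pe] := edges_atP (in_box_pos pb) e'p.
have self q : q \in Up q by rewrite /Up; case: (rk q) => [|n]; rewrite /= inE eqxx.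
have ctr q : in_box q -> p \notin Up q -> path_chain q e' = false.
  move=> qb nq; rewrite /path_chain; apply/negP => h.
  have : e' \in root_edges (rk q) q.
    by rewrite -has_pred1 has_count; move: h; case: (count_mem _ _).
  by case/(root_edges_walk qb) => h1 h2; move/negP: nq; case: pe => <-.
rewrite /fund !ctr // !addbF => /eqP E; move: n1 n2.
by case: pe => <-; rewrite E self ?andbF.
Qed.

(** By [fill_star] the six triangles around each of [p] and [q] lie on one side, and the two stars
    share a triangle. *)
Lemma region_const e p q : edge_in e -> in_box p -> in_box q -> lattice_adj p q ->
  off2 e p -> off2 e q -> region e (p, true) = region e (q, true).
Proof.
move=> ein; suff H a k : k < 3 -> in_box a -> in_box (edge_end (a, k)) ->
    off2 e a -> off2 e (edge_end (a, k)) -> region e (a, true) = region e (edge_end (a, k), true).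
  move=> pb qb /lattice_adjP[k k3 [] E] op oq; rewrite {}E in pb qb op oq *; first exact: H.
  by apply/esym; apply: H.
move=> k3 ab bb oa ob; have hc := fund_cycle ein.
have [a1 a2 a3 a4 a5] := fill_star hc (in_box_pos ab) (off2_fund ein ab oa).
have [] := fill_star hc (in_box_pos bb) (off2_fund ein bb ob).
move: a1 a2 a3 a4 a5; rewrite /region; case: a {ab oa bb ob} => x y.
by case: k k3 => [|[|[|//]]] _; rewrite /edge_end /= => *; congruence.
Qed.

Definition corners t : seq pt :=
  [:: t.1; edge_end (t.1, if t.2 then 0 else 1); edge_end (t.1, 2)].

Lemma tri_edges_corners t e : e \in tri_edges t -> (e.1 \in corners t) && (edge_end e \in corners t).
Proof.
case: t => [[x y] []]; rewrite /tri_edges /corners /= !inE => /or3P[]/eqP-> /=;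
  by rewrite /edge_end /= !eqxx ?orbT.
Qed.

(* A subset on which every function locally constant on [off] is constant: the
   connected components of [off] are of this kind. *)
Definition connected_in (off Q : pt -> bool) := forall phi : pt -> bool,
  (forall p q, in_box p -> in_box q -> off p -> off q -> lattice_adj p q -> phi p = phi q) ->
  forall p q, Q p -> Q q -> phi p = phi q.

Hypothesis N2 : 1 < N.
Let e0 : edge := ((N, N.-1), 1).
Hypothesis border_tree : forall e, edge_in e -> e != e0 ->
  tri_bd tri_in e -> tree_edge e.

(** [e0] is the one border edge that the tree may miss, so the border of the box and the fundamental
    cycle of [e0] differ by a cycle in the tree. *)
Lemma region_border : region e0 =1 tri_in.
Proof.
have ein : edge_in e0 by rewrite /edge_in /in_box /edge_end /=; lia.
have tc : tri_chain tri_in by [].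
apply: (tri_bd_inj (region_in ein) tc) => e e_in; rewrite region_bd //.
pose c e' := tri_bd tri_in e' (+) fund e0 e'.
suff : c e = false by rewrite /c; case: (tri_bd _ _) (fund _ _) => [] [].
apply: tree_acyclic; first by apply: cycleD; [apply: tri_bd_cycle | apply: fund_cycle].
move=> e'; rewrite /c; have [->|ne] := eqVneq e' e0.
  have [//|nt] := boolP (tree_edge e0).
  rewrite fund_self //= (_ : tri_bd _ _) // /tri_bd /tri1 /tri2 /tri_in /=; lia.
have [Z|_] := boolP (fund e0 e'); first by move=> _; apply: fund_tree Z _.
by rewrite addbF => h; apply: border_tree => //; apply: tri_bd_chain h.
Qed.

Variable W : seq pt.
Hypothesis Win : forall p, p \in W -> tri_in (p, true).

Definition separates (X : seq pt) := forall Q : pt -> bool, (forall p, Q p -> in_box p) ->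
  (forall p, Q p -> forall x, x \in X -> p \notin Up x) ->
  connected_in (fun p => all (fun x => p \notin Up x) X) Q -> 2 * count Q W <= size W.

(** Descent through heavy regions, which contain more than half of [W] off their two root paths. If
    no other non-tree edge of the triangle [t] inside at [e] is heavy, the corners of [t] separate:
    a component off their root paths lies outside the region of [e], which leaves it less than half,
    or inside the region of another edge of [t], which is not heavy. *)
Lemma lattice_separator : exists X, size X = 3 /\ all in_box X /\ separates X.
Proof.
pose inside e p := region e (p, true) && off2 e p.
pose heavy e := size W < 2 * count (inside e) W.
pose tl := [seq (p, b) | p <- [seq (x, y) | x <- iota 0 N.+1, y <- iota 0 N.+1], b <- [:: true; false]].
have intl t : tri_in t -> t \in tl.
  case: t => [[x y] b]; rewrite /tri_in /= => h.
  apply/allpairsP; exists ((x, y), b); split; last by []; last by case: b {h}; rewrite !inE.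
  by apply/allpairsP; exists (x, y); rewrite !mem_iota; split=> //=; lia.
have desc n e : count (region e) tl < n -> edge_in e -> ~~ tree_edge e -> heavy e ->
    exists X, size X = 3 /\ all in_box X /\ separates X.
  elim: n e => // n IH e mn ein nte he.
  have /and3P[e3 b1 b2] := ein.
  have [t [ee At]] : exists t, e \in tri_edges t /\ region e t.
    have := fund_self ein nte; rewrite -region_bd // /tri_bd e3 /=.
    have T := tri1_edge e3 (in_box_pos b1).
    case: (boolP (region e (tri1 e))) => [h _|_ /= h]; first by exists (tri1 e); rewrite T //; left.
    by exists (tri2 e); rewrite T //; right.
  have tin := region_in ein At.
  have [[f [ft ef ntf hf]]|nh] := pselect (exists f, [/\ f \in tri_edges t, e != f, ~~ tree_edge f & heavy f]).
    have [sub [u uin /andP[eu fu]]] := region_descent tin ee ft At ef nte ntf.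
    apply: (IH f) => //; last exact: tri_edges_in ft.
    suff lt : count (region f) tl < count (region e) tl by apply: leq_trans lt _; rewrite -ltnS.
    have utl := intl _ uin.
    have -> : count (region e) tl = count (region f) tl + count (fun t => region e t && ~~ region f t) tl.
      rewrite -count_predUI (@eq_count _ (predI _ _) pred0) ?count_pred0 ?addn0.
        by apply: eq_count => t' /=; case: (boolP (region f t')) => [/sub->//|]; rewrite andbT.
      by move=> t' /=; case: (region f t'); rewrite ?andbF.
    by rewrite -addn1 leq_add2l -has_count; apply/hasP; exists u => //; rewrite eu.
  exists (corners t); split=> //; split.
    case: (t) tin => [[x y] b]; rewrite /tri_in /= /in_box /edge_end /= => h.
    by case: b => /=; lia.
  move=> Q Qb Qoff Qc.
  set off := (fun p => _) in Qc.
  have offf f p : f \in tri_edges t -> off p -> off2 f p.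
    by move=> /tri_edges_corners/andP[c1 c2] /allP o; rewrite /off2 !o.
  have const f : f \in tri_edges t -> forall p q, Q p -> Q q -> region f (p, true) = region f (q, true).
    move=> ft; apply: Qc => p q pb qb op oq pq.
    by apply: region_const (tri_edges_in tin ft) pb qb pq (offf _ _ ft op) (offf _ _ ft oq).
  have Qo p : Q p -> off p by move=> h; apply/allP => x; apply: Qoff.
  have inQ f : f \in tri_edges t -> forall p, Q p -> region f (p, true) -> count Q W <= count (inside f) W.
    move=> ft p Qp fp; apply: sub_count => q Qq.
    by rewrite /= /inside (const f ft q p) // fp offf // Qo.
  have [/hasP[p pW Qp]|/hasPn nQ] := boolP (has Q W); last first.
    by rewrite (eq_in_count (a2 := pred0)) ?count_pred0 // => q /nQ /negPf.
  case: (boolP (region e (p, true))) => ep; last first.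
    have dis : count Q W + count (inside e) W <= size W.
      rewrite -count_predUI (_ : count (predI _ _) W = 0) ?addn0 ?count_size //.
      rewrite (eq_in_count (a2 := pred0)) ?count_pred0 // => q _ /=.
      by case: (boolP (Q q)) => //= Qq; rewrite /inside (const e ee q p) // (negPf ep).
    by move: he dis; rewrite /heavy; clear; lia.
  have [f [ft fe fp]] : exists f, [/\ f \in tri_edges t, f != e & region f (p, true)].
    have : exists2 f, f \in tri_edges t & e != f.
      have [a [b [s Es]]] : exists a b s, tri_edges t = [:: a, b & s].
        by rewrite /tri_edges; case: (t.2); do 3 eexists.
      have := tri_edges_uniq t; rewrite Es /= !inE negb_or => /andP[/andP[ab _] _].
      by have [->|ea] := eqVneq e a; [exists b | exists a]; rewrite ?inE ?eqxx ?orbT.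
    move=> [f ft ef]; have [g [gin ge gf gs spl]] := region_split tin ee ft ef.
    have := spl (p, true); rewrite ep.
    (* The triangle [(p, true)] has [p] as a corner, whereas [p] is off the root paths of the
       corners of [t]. So [region_split] puts [p] in the region of one more edge of [t]. *)
    have -> : ((p, true) == t) = false.
      apply/negP => /eqP E; have := Qoff _ Qp t.1; rewrite /corners inE eqxx => /(_ isT).
      by rewrite -E /= /Up; case: (rk p) => [|m]; rewrite /= inE eqxx.
    case: (boolP (region f (p, true))) => [fp _|_ /= gp]; first by exists f; rewrite eq_sym.
    exists g; rewrite ge; split=> //; last by case: (region g _) gp.
    (* If [g] were not an edge of [t], the boundary of [t] would vanish on [g], where the three
       fundamental cycles add up to 1. *)
    apply: contraT => gt; exfalso.
    have : (g \in tri_edges t) = tri_bd (pred1 t) g by rewrite tri_bd1.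
    rewrite (negPf gt).
    have [tg|ntg] := boolP (tree_edge g).
      by move: gp; rewrite region0.
    rewrite (eq_tri_bd (B := fun t' => region e t' (+) (region f t' (+) region g t'))); last by move=> u; rewrite /= spl.
    by rewrite !tri_bdD !region_bd // ?(tri_edges_in tin ft) // !fund_nontree // ?(tri_edges_in tin ft) // (negPf ge) (negPf gf) eqxx.
  have ntf : ~~ tree_edge f by apply: contraL fp => te; rewrite region0 // (tri_edges_in tin ft).
  have nhf : ~~ heavy f by apply/negP => hf; apply: nh; exists f; rewrite eq_sym.
  have := inQ f ft p Qp fp; move: nhf; rewrite /heavy; clear; lia.
have ein : edge_in e0 by rewrite /edge_in /in_box /edge_end /=; lia.
have /and3P[_ b1 b2] := ein.
have [te|nte] := boolP (tree_edge e0).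
  have := region0 ein te (1, 1, true); rewrite region_border /tri_in /=; lia.
have [he|nh] := boolP (heavy e0); first exact: (desc _ e0 (leqnn _)).
(* When not even the whole box is heavy, two root paths suffice; the list is padded to three. *)
exists [:: e0.1; edge_end e0; e0.1]; rewrite /= b1 b2; split=> //; split=> // Q Qb Qoff Qc.
apply: leq_trans (_ : 2 * count (inside e0) W <= _); last by rewrite leqNgt.
rewrite leq_mul2l /= (eq_in_count (a2 := predI Q (mem W))); last by move=> p pW /=; rewrite pW andbT.
apply: sub_count => p /andP[Qp /= pW]; rewrite /inside region_border Win //= /off2.
by rewrite !(Qoff _ Qp) // !inE eqxx ?orbT.
Qed.

End Lattice.

(** * From planar drawings to lattice minors *)

Section LatticeMinor.
Local Open Scope nat_scope.
Notation pt := (nat * nat)%type.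
Implicit Types (p q z : pt).

Definition lattice_step p q := (p == q) || lattice_adj p q.

Lemma lattice_step_sym p q : lattice_step p q = lattice_step q p.
Proof. by rewrite /lattice_step eq_sym lattice_adj_sym. Qed.

Variable V : finType.
Implicit Types (G : graph V) (u v : V) (e : {set V}).

(* G is a minor of the lattice: the cells labelled v form a connected set
   containing [cell v], and adjacent vertices have adjacent cells. *)
Definition lattice_minor G (N : nat) (lam : pt -> option V) (cell : V -> pt) :=
  [/\ forall u v, adj G u v -> lam (cell u) = Some u,
      forall p v, lam p = Some v -> v \in verts G /\ [&& 1 < p.1, p.1 < N, 1 < p.2 & p.2 < N],
      forall p v, lam p = Some v -> exists s, [/\ path lattice_step p s, last p s = cell v &
        all (fun q => lam q == Some v) s] &
      forall u v, adj G u v -> exists p q, [/\ lam p = Some u, lam q = Some v & lattice_step p q]].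

Variables (G : graph V) (N : nat) (cell : V -> pt) (fst_end snd_end : {set V} -> V)
  (w0 w1 w2 : {set V} -> seq pt).
Local Notation E := (edges G).
Hypothesis endsP : forall e, e \in E -> e = [set fst_end e; snd_end e]%SET.
Hypothesis w0P : forall e, e \in E ->
  exists s, [/\ w0 e = cell (fst_end e) :: s, path lattice_step (cell (fst_end e)) s &
    exists s', w1 e = last (cell (fst_end e)) s :: s' /\ path lattice_step (last (cell (fst_end e)) s) s' ].
Hypothesis w2P : forall e x s, e \in E -> w1 e = x :: s -> exists s',
  [/\ w2 e = last x s :: s', path lattice_step (last x s) s' & last (last x s) s' = cell (snd_end e)].
Hypothesis w_in : forall e p, e \in E -> [|| p \in w0 e, p \in w1 e | p \in w2 e] ->
  [&& 1 < p.1, p.1 < N, 1 < p.2 & p.2 < N].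
Hypothesis w1_w1 : forall e e' p, e \in E -> e' \in E -> e <> e' -> p \in w1 e ->
  [|| p \in w0 e', p \in w1 e' | p \in w2 e'] -> False.
Let star e v p := ((fst_end e == v) && (p \in w0 e)) || ((snd_end e == v) && (p \in w2 e)).
Hypothesis star_star : forall e e' v v' p, e \in E -> e' \in E -> star e v p -> star e' v' p -> v = v'.

(** The walks [w0 e], [w1 e], [w2 e] stand for the thirds of the arc of [e]. The outer thirds at [v]
    form its star; stars of different vertices are disjoint, and a middle third avoids the walks of
    all other edges. It may still run into the stars of its own ends, so it carries the label of the
    first end only up to the first cell in the star of the second. *)
Let S v p := [exists e in E, star e v p].
Let pre e := take (find (S (snd_end e)) (w1 e)) (w1 e).
Let lam p := if [pick v | S v p] is Some v then Some v
  else if [pick e in E | p \in pre e] is Some e then Some (fst_end e) else None.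

Lemma lattice_minor_of_walks : exists lam', lattice_minor G N lam' cell.
Proof.
exists lam.
have SS u v p : S u p -> S v p -> u = v.
  by move=> /exists_inP[e eE h] /exists_inP[e' eE' h']; apply: star_star h h'.
have ends_ne e : e \in E -> fst_end e != snd_end e.
  move=> eE; have /andP[_] := edge_wf eE; rewrite {1}(endsP eE) cards2.
  by case: (fst_end e != snd_end e).
have w0S e p : e \in E -> p \in w0 e -> S (fst_end e) p.
  by move=> eE h; apply/exists_inP; exists e; rewrite // /star eqxx h.
have w2S e p : e \in E -> p \in w2 e -> S (snd_end e) p.
  by move=> eE h; apply/exists_inP; exists e; rewrite // /star eqxx h orbT.
have lamS v p : S v p -> lam p = Some v.
  by rewrite /lam => h; case: pickP => [u Su|/(_ v)]; [rewrite (SS _ _ _ Su h) | rewrite h].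
have pre1 e p : p \in pre e -> p \in w1 e by apply: mem_take.
have preS e v p : e \in E -> p \in pre e -> S v p -> v = fst_end e.
  move=> eE pp Sv; have /exists_inP[e' eE' st] := Sv.
  have [Ee|ne] := pselect (e = e').
    move: st; rewrite -Ee /star => /orP[/andP[/eqP//]|/andP[/eqP vE _]].
    move: pp; rewrite /pre => /nthP-/(_ p)[i]; rewrite size_take_min leq_min => /andP[ilt _] ip.
    by have := before_find p ilt; rewrite nth_take // in ip *; rewrite ip vE Sv.
  case: (w1_w1 eE eE' ne (pre1 _ _ pp)).
  by move: st; rewrite /star => /orP[]/andP[_ ->]; rewrite ?orbT.
have lamP e p : e \in E -> p \in pre e -> lam p = Some (fst_end e).
  move=> eE pp; rewrite /lam; case: pickP => [u /(preS _ _ _ eE pp)->//|_].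
  case: pickP => [e' /andP[eE' pp']|/(_ e)]; last by rewrite eE pp.
  have [->//|ne] := pselect (e = e'); case: (w1_w1 eE eE' ne (pre1 _ _ pp)).
  by rewrite (pre1 _ _ pp') orbT.
have lam_inv p v : lam p = Some v -> S v p \/ exists e, [/\ e \in E, p \in pre e & v = fst_end e].
  rewrite /lam; case: pickP => [u Su [<-]|_]; first by left.
  by case: pickP => // e /andP[eE pp] [<-]; right; exists e.
pose conn v p q := exists s, [/\ path lattice_step p s, last p s = q & all (fun z => lam z == Some v) (p :: s)].
have connT v p q r : conn v p q -> conn v q r -> conn v p r.
  move=> [s [h1 h2 h3]] [s' [h4 h5 /= /andP[h6 h7]]]; exists (s ++ s').
  by rewrite cat_path last_cat h2 h1 h4 h5; split=> //; rewrite -cat_cons all_cat h3 h7.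
have connC v p q : conn v p q -> conn v q p.
  move=> [s [h1 h2 h3]]; exists (rev (belast p s)); rewrite -h2 rev_path; split.
  - by rewrite (eq_path (e' := lattice_step)) // => a b; rewrite lattice_step_sym.
  - by case: (s) => //= a s'; rewrite rev_cons last_rcons.
  by rewrite -[_ :: _]rev_rcons -lastI all_rev.
have conn_walk v x s p : path lattice_step x s -> all (fun z => lam z == Some v) (x :: s) ->
    p \in x :: s -> conn v x p.
  move=> h1 h2 ps; case: (splitPl ps) h1 h2 => s1 s2 E; rewrite cat_path -cat_cons all_cat.
  by move=> /andP[h1 _] /andP[h2 _]; exists s1.
have w0conn e p : e \in E -> p \in w0 e -> conn (fst_end e) (cell (fst_end e)) p.
  move=> eE pw; have [s [E1 h _]] := w0P eE; move: pw; rewrite E1; apply: conn_walk h _.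
  by apply/allP => z; rewrite -E1 => /(w0S _ _ eE)/lamS->.
(* The first cell of [w1 e] is in the star of the first end and the last cell in that of the second.
   So the cut has a cell on either side, and these two realise the edge [e]. *)
have find_lt e : e \in E -> 0 < find (S (snd_end e)) (w1 e) < size (w1 e).
  move=> eE; have [s [E0 _ [s' [E1 _]]]] := w0P eE.
  have [s2 [E2 _ _]] := w2P eE E1; rewrite -has_find; apply/andP; split.
    rewrite E1 /= ifN //; apply/negP => Sq.
    have S0 : S (fst_end e) (last (cell (fst_end e)) s) by apply: w0S; rewrite // E0 mem_last.
    by have := ends_ne e eE; rewrite (SS _ _ _ Sq S0) eqxx.
  apply/hasP; exists (last (last (cell (fst_end e)) s) s'); first by rewrite E1 mem_last.
  by apply: w2S; rewrite // E2 inE eqxx.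
have cellS v p : S v p -> conn v (cell v) p.
  move=> /exists_inP[e eE /orP[]/andP[/eqP<-]]; first exact: w0conn.
  move=> pw; have [s [_ _ [s' [E1 _]]]] := w0P eE.
  have [s2 [E2 h hl]] := w2P eE E1.
  have A : all (fun z => lam z == Some (snd_end e)) (last (last (cell (fst_end e)) s) s' :: s2).
    by apply/allP => z; rewrite -E2 => /(w2S _ _ eE)/lamS->.
  rewrite E2 in pw; apply: connT (conn_walk _ _ _ _ h A pw).
  by rewrite -hl; apply: connC; apply: conn_walk h A _; apply: mem_last.
have pre_conn e p : e \in E -> p \in pre e -> conn (fst_end e) (cell (fst_end e)) p.
  move=> eE pp; have [s [E0 _ [s' [E1 h']]]] := w0P eE.
  have := w0conn e (last (cell (fst_end e)) s) eE; rewrite E0 mem_last => /(_ isT) c0.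
  apply: connT c0 _; have /andP[f0 _] := find_lt e eE.
  have Ep : pre e = last (cell (fst_end e)) s :: take (find (S (snd_end e)) (w1 e)).-1 s'.
    by rewrite /pre; case: (find _ _) f0 => // n _; rewrite E1.
  have A : all (fun z => lam z == Some (fst_end e)) (pre e).
    by apply/allP => z zp; rewrite (lamP e).
  rewrite Ep in A pp; apply: conn_walk A pp.
  by apply: take_path.
have conn_cell p v : lam p = Some v -> conn v (cell v) p.
  by move=> /lam_inv[/cellS//|[e [eE pp ->]]]; apply: pre_conn.
have adjE u v : adj G u v -> exists2 e, e \in E & (u = fst_end e /\ v = snd_end e) \/ (u = snd_end e /\ v = fst_end e).
  rewrite /adj => eE; exists [set u; v]%SET => //; set e := [set u; v]%SET in eE *.
  have ne := ends_ne e eE.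
  have : fst_end e \in e by rewrite {2}(endsP eE) !inE eqxx.
  have : snd_end e \in e by rewrite {2}(endsP eE) !inE eqxx orbT.
  move: ne; rewrite !inE => ne /orP[]/eqP h1 /orP[]/eqP h2; rewrite h1 h2 ?eqxx // in ne *; by [left|right].
split.
- move=> u v /adjE[e eE h]; apply: lamS.
  case: h => -[-> _]; first by apply: w0S => //; have [s [-> _ _]] := w0P eE; rewrite inE eqxx.
  apply: w2S => //; have [s [_ _ [s' [E1 _]]]] := w0P eE; have [s2 [-> _ <-]] := w2P eE E1.
  exact: mem_last.
- have vin e : e \in E -> fst_end e \in verts G /\ snd_end e \in verts G.
    move=> eE; have /andP[/fintype.subsetP sub _] := edge_wf eE.
    by split; apply: sub; rewrite {2}(endsP eE) !inE eqxx ?orbT.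
  move=> p v /lam_inv[/exists_inP[e eE /orP[]/andP[/eqP<- pw]]|[e [eE pp ->]]].
  + by split; [case: (vin e eE) | apply: (w_in eE); rewrite pw].
  + by split; [case: (vin e eE) | apply: (w_in eE); rewrite pw !orbT].
  + by split; [case: (vin e eE) | apply: (w_in eE); rewrite (pre1 _ _ pp) !orbT].
- move=> p v /conn_cell/connC[s [h1 h2 /= /andP[_ h3]]]; by exists s.
suff H e : e \in E -> exists p q, [/\ lam p = Some (fst_end e), lam q = Some (snd_end e) & lattice_step p q].
  move=> u v /adjE[e eE [[-> ->]|[-> ->]]]; first exact: H.
  by have [p [q [h1 h2 h3]]] := H e eE; exists q, p; rewrite lattice_step_sym.
move=> eE; have /andP[f0 f1] := find_lt e eE.
have [s [E0 _ [s' [E1 h']]]] := w0P eE.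
set i := find _ _ in f0 f1; set d := cell (fst_end e).
exists (nth d (w1 e) i.-1), (nth d (w1 e) i); split.
- apply: lamP => //; rewrite /pre -/i -(@nth_take i) ?prednK //.
  by apply: mem_nth; rewrite size_take f1 prednK.
- by apply: lamS; apply: nth_find; rewrite has_find.
by have /(pathP d)/(_ i.-1) := h'; rewrite E1 in f1 *; case: (i) f0 f1 => //= j _ jl; apply.
Qed.

End LatticeMinor.

(** * Uniform estimates on arcs *)

Section Compactness.
Variable R : realType.
Implicit Types (f g : R -> R * R) (a b s : R).

Lemma within_ball f a b x (d : R) : {within `[a, b], continuous f}%classic -> a <= x <= b ->
  0 < d -> exists2 e, 0 < e & forall y, a <= y <= b -> `|x - y| < e -> `|f x - f y| < d.
Proof.
move=> cf xab d0.
have /subspace_continuousP/(_ x) := cf.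
have xI : `[a, b]%classic x by rewrite /= in_itv.
move=> /(_ xI)/cvg_ballP/(_ d d0).
rewrite near_withinE => /nbhs_ballP[e /= e0 he]; exists e => // y yab xy.
have := he y xy; rewrite /= in_itv /= => /(_ yab).
by rewrite -ball_normE.
Qed.

(** Compactness in its near-covering form: what holds for all small radii, locally uniformly, holds
    for one radius on the whole segment. *)
Lemma uniform_continuity f a b (d : R) : {within `[a, b], continuous f}%classic -> 0 < d ->
  exists2 e, 0 < e & forall x y, a <= x <= b -> a <= y <= b -> `|x - y| < e -> `|f x - f y| < d.
Proof.
move=> cf d0.
pose P (e x : R) := forall y, a <= y <= b -> `|x - y| < e -> `|f x - f y| < d.
have : \forall e \near (0^'+)%classic, (`[a, b]%classic `<=` P e)%classic.
  have /compact_near_coveringP/near_covering_withinP := @segment_compact R a b.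
  apply => x /=; rewrite in_itv /= => xab.
  have [e e0 he] := within_ball cf xab (divr_gt0 d0 (ltr0n _ 2)).
  exists ([set y | `|x - y| < e / 2], [set e' | e' < e / 2])%classic => /=; first split.
  - by apply/nbhs_ballP; exists (e / 2); rewrite /= ?divr_gt0 // -ball_normE.
  - by apply: nbhs_right_lt; lra.
  move=> [y e'] /= [xy ee']; rewrite /P in_itv /= => yab z zab yz.
  have -> : f y - f z = (f y - f x) + (f x - f z) by rewrite addrA subrK.
  apply: le_lt_trans (ler_normD _ _) _.
  rewrite (splitr d) ltrD // ?he //; first by rewrite distrC he //; lra.
  have -> : x - z = (x - y) + (y - z) by rewrite addrA subrK.
  apply: le_lt_trans (ler_normD _ _) _; lra.
move=> H; have [e [e0 he]] : exists e, 0 < e /\ (`[a, b]%classic `<=` P e)%classic.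
  near ((0 : R)^'+)%classic => e; exists e; split; last by near: e.
  by near: e; exact: nbhs_right_gt.
by exists e => // x y xab yab; apply: he => //=; rewrite in_itv.
Unshelve. all: by end_near. Qed.

(** The image of [g] is closed, so [f x] has a distance [d > 0] to it, and by continuity the
    distance stays above [d / 2] near [x]; the near-covering argument makes this uniform. *)
Lemma disjoint_arcs_apart f g a b a' b' : {within `[a, b], continuous f}%classic ->
  {within `[a', b'], continuous g}%classic ->
  (forall s s', a <= s <= b -> a' <= s' <= b' -> f s <> g s') ->
  exists2 e, 0 < e & forall s s', a <= s <= b -> a' <= s' <= b' -> e <= `|f s - g s'|.
Proof.
move=> cf cg dis.
have cB := continuous_compact cg (@segment_compact R a' b').
have clB := compact_closed (@norm_hausdorff _ _) cB.
pose P (e x : R) := forall y, a' <= y <= b' -> e <= `|f x - g y|.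
have : \forall e \near (0^'+)%classic, (`[a, b]%classic `<=` P e)%classic.
  have /compact_near_coveringP/near_covering_withinP := @segment_compact R a b.
  apply => x /=; rewrite in_itv /= => xab.
  have nB : ~ [set g x | x in `[a', b']]%classic (f x).
    by case=> y /=; rewrite in_itv /= => yab E; apply: (dis x y) => //; rewrite E.
  have [d /= d0 hd] : exists2 d : R, 0 < d & forall y, a' <= y <= b' -> d <= `|f x - g y|.
    have := clB; rewrite -openC openE => /(_ _ nB) /= /nbhs_ballP[d /= d0 hd].
    exists d => // y yab; rewrite leNgt; apply/negP => lt.
    by apply: (hd (g y)); [rewrite -ball_normE | exists y; rewrite //= in_itv].
  have [e e0 he] := within_ball cf xab (divr_gt0 d0 (ltr0n _ 2)).
  exists ([set y | `|x - y| < e], [set e' | e' < d / 2])%classic => /=; first split.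
  - by apply/nbhs_ballP; exists e; rewrite //= -ball_normE.
  - by apply: nbhs_right_lt; lra.
  move=> [y e'] /= [xy ee']; rewrite /P in_itv /= => yab z zab.
  have h1 := he y yab xy; have h2 := hd z zab.
  have : `|f x - g z| <= `|f x - f y| + `|f y - g z|.
    by have -> : f x - g z = (f x - f y) + (f y - g z); [rewrite addrA subrK | apply: ler_normD].
  lra.
move=> H; have [e [e0 he]] : exists e, 0 < e /\ (`[a, b]%classic `<=` P e)%classic.
  near ((0 : R)^'+)%classic => e; exists e; split; last by near: e.
  by near: e; exact: nbhs_right_gt.
by exists e => // x y xab yab; apply: he => //=; rewrite in_itv.
Unshelve. all: by end_near. Qed.

End Compactness.

Section Discretization.
Local Open Scope nat_scope.
Notation pt := (nat * nat)%type.

Definition close_pt (p q : pt) := [&& p.1 <= q.1.+1, q.1 <= p.1.+1, p.2 <= q.2.+1 & q.2 <= p.2.+1].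

(** Consecutive cells may differ in both coordinates, so the walk turns a corner between them. The
    initial cell [f 0] is left out, as in the second argument of [path]. *)
Definition lattice_walk (f : nat -> pt) n : seq pt :=
  flatten [seq [:: ((f i.+1).1, (f i).2); f i.+1] | i <- iota 0 n].

Lemma lattice_step_h (x x' y : nat) : x <= x'.+1 -> x' <= x.+1 -> lattice_step (x, y) (x', y).
Proof.
move=> h1 h2; rewrite /lattice_step xpair_eqE eqxx andbT.
have [//|ne] := eqVneq x x'; apply/lattice_adjP; exists 0 => //; rewrite /edge_end /=.
by have [h|h] := leqP x x'; [left | right]; congr pair; lia.
Qed.

Lemma lattice_step_v (x y y' : nat) : y <= y'.+1 -> y' <= y.+1 -> lattice_step (x, y) (x, y').
Proof.
move=> h1 h2; rewrite /lattice_step xpair_eqE eqxx /=.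
have [//|ne] := eqVneq y y'; apply/lattice_adjP; exists 1 => //; rewrite /edge_end /=.
by have [h|h] := leqP y y'; [left | right]; congr pair; lia.
Qed.

Lemma lattice_walkP (f : nat -> pt) n : (forall i, i < n -> close_pt (f i) (f i.+1)) ->
  [/\ path lattice_step (f 0) (lattice_walk f n), last (f 0) (lattice_walk f n) = f n &
   forall p, p \in f 0 :: lattice_walk f n -> exists2 i, i <= n & close_pt p (f i)].
Proof.
have cl0 (p : pt) : close_pt p p by rewrite /close_pt !leqnSn.
elim: n => [|n IH] h; first by split=> // p; rewrite inE => /eqP->; exists 0.
have [|h1 h2 h3] := IH; first by move=> i il; apply: h; apply: ltnW.
have /and4P[c1 c2 c3 c4] := h n (leqnn _).
have E : lattice_walk f n.+1 = lattice_walk f n ++ [:: ((f n.+1).1, (f n).2); f n.+1].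
  by rewrite /lattice_walk -addn1 iotaD map_cat flatten_cat /= add0n addn1.
rewrite E; split.
- rewrite cat_path h1 h2 /= andbT; move: c1 c2 c3 c4.
  case: (f n) (f n.+1) => [x y] [x' y'] /= c1 c2 c3 c4.
  by rewrite lattice_step_h // lattice_step_v.
- by rewrite last_cat.
move=> p; rewrite -cat_cons mem_cat => /orP[/h3[i il c]|]; first by exists i => //; apply: leqW.
rewrite !inE => /orP[]/eqP->; last by exists n.+1.
by exists n; rewrite ?leqnSn // /close_pt /= c1 c2 !leqnSn.
Qed.

End Discretization.

Section PlanarLattice.
Variables (R : realType) (V : finType) (G : graph V).
Implicit Types (e : {set V}) (z : R * R).

Lemma prod_norm_lt z (d : R) : (`|z| < d) = (`|z.1| < d) && (`|z.2| < d).
Proof. by rewrite prod_normE gt_max. Qed.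

Lemma truncn_close (x y : R) : 0 <= x -> 0 <= y -> `|x - y| < 1 ->
  (Num.truncn x <= (Num.truncn y).+1)%N.
Proof.
move=> x0 y0; rewrite ltr_norml => /andP[_ h].
have /andP[a1 a2] := truncn_itv x0; have /andP[b1 b2] := truncn_itv y0.
rewrite -ltnS -(ltr_nat R) [X in _ < X]mulrS; lra.
Qed.

(** Both truncations are within 1 of [p], hence within 2 of each other, and truncation loses less
    than 1. *)
Lemma truncn_far (x y : R) (p q r : nat) : 0 <= x -> 0 <= y ->
  (p <= (Num.truncn x).+1)%N -> (Num.truncn x <= p.+1)%N ->
  (p <= (Num.truncn y).+1)%N -> (Num.truncn y <= p.+1)%N -> `|x - y| < 3.
Proof.
move=> x0 y0.
have /andP[a1 a2] := truncn_itv x0; have /andP[b1 b2] := truncn_itv y0.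
move: a1 a2 b1 b2; set u := Num.truncn x; set v := Num.truncn y.
move=> a1 a2 b1 b2 h1 h2 h3 h4.
have h5 : (u <= v.+2)%N by lia.
have h6 : (v <= u.+2)%N by lia.
move: h5 h6 a2 b2; rewrite -!(ler_nat R) -[v.+2]addn2 -[u.+2]addn2 !natrD !(mulrS 1) => h5 h6 a2 b2.
rewrite ltr_norml; apply/andP; split; lra.
Qed.

Lemma norm_sum_bounds (a b c : R) : `|a| + `|b| <= c - 3 ->
  [/\ 3 <= a + c, a + c <= 2 * c, 3 <= b + c & b + c <= 2 * c].
Proof.
have [a1 a2] : - `|a| <= a /\ a <= `|a| by rewrite lerNnormlW // ler_norm.
have [b1 b2] : - `|b| <= b /\ b <= `|b| by rewrite lerNnormlW // ler_norm.
by have := normr_ge0 a; have := normr_ge0 b; split; lra.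
Qed.

Lemma planar_lattice_minor : planar R G ->
  exists (N : nat) lam (cell : V -> nat * nat), lattice_minor G N lam cell.
Proof.
move=> [pos [arc [posI arcP arc_v arc_arc]]].
have [E0|[ee eeE]] := set_0Vmem (edges G).
  exists 0%N, (fun=> None), (fun=> (0, 0)%N).
  by split=> // u v; rewrite /adj E0 inE.
have [v0 _] : exists v0 : V, true.
  have /andP[_ /eqP c2] := edge_wf eeE.
  have /card_gt0P[v _] : (0 < #|ee|)%N by rewrite c2.
  by exists v.
(* Each edge is oriented by its arc: the first end is the one at parameter 0. *)
have /choice[ends endsP] : forall e, exists p : V * V, e \in edges G ->
    [/\ e = [set p.1; p.2]%SET, arc e 0 = pos p.1 & arc e 1 = pos p.2].
  move=> e; have [eE|] := boolP (e \in edges G); last by exists (v0, v0).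
  have [_ inj sE] := arcP e eE; have /andP[_ /cards2P[u [v [uv E]]]] := edge_wf eE.
  have ne : arc e 0 <> arc e 1.
    move=> /inj; rewrite !in_itv /= !lexx ler01 => /(_ isT isT)/eqP; by rewrite eq_sym oner_eq0.
  have pu : pos u = arc e 0 \/ pos u = arc e 1.
    by have : [set pos x | x in [set` e]]%classic (pos u); [exists u => //; rewrite /= E !inE eqxx | rewrite sE].
  have pv : pos v = arc e 0 \/ pos v = arc e 1.
    by have : [set pos x | x in [set` e]]%classic (pos v); [exists v => //; rewrite /= E !inE eqxx orbT | rewrite sE].
  have a0 : pos u = arc e 0 \/ pos v = arc e 0.
    have : [set arc e 0; arc e 1]%classic (arc e 0) by left.
    by rewrite -sE => -[x /=]; rewrite E !inE => /orP[]/eqP-> ->; [left|right].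
  have a1 : pos u = arc e 1 \/ pos v = arc e 1.
    have : [set arc e 0; arc e 1]%classic (arc e 1) by right.
    by rewrite -sE => -[x /=]; rewrite E !inE => /orP[]/eqP-> ->; [left|right].
  case: pu => hu; [exists (u, v)|exists (v, u)] => _; split=> //=; rewrite 1?finset.setUC //.
    by case: a1 => // h; case: ne; rewrite -hu h.
  by case: a0 => // h; case: ne; rewrite -hu h.
pose fe e := (ends e).1; pose se e := (ends e).2.
have fP e : e \in edges G -> [/\ e = [set fe e; se e]%SET, arc e 0 = pos (fe e) & arc e 1 = pos (se e)].
  exact: endsP.
have vfe e : e \in edges G -> fe e \in verts G /\ se e \in verts G.
  move=> eE; have [E _ _] := fP e eE; have /andP[/fintype.subsetP sub _] := edge_wf eE.
  by split; apply: sub; rewrite {2}E !inE eqxx ?orbT.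
pose J (k : nat) (s : R) := k%:R / 3 <= s <= k.+1%:R / 3.
have J01 k s : (k < 3)%N -> J k s -> 0 <= s <= 1.
  move=> k3; rewrite /J => /andP[h1 h2]; apply/andP; split.
    by apply: le_trans h1; rewrite divr_ge0.
  by apply: le_trans h2 _; rewrite ler_pdivrMr // mul1r ler_nat.
pose far e k e' k' := forall s s', J k s -> J k' s' -> arc e s <> arc e' s'.
have cont e k : e \in edges G -> (k < 3)%N -> {within `[k%:R / 3, k.+1%:R / 3], continuous (arc e)}%classic.
  move=> eE k3; have [c _ _] := arcP e eE; apply: continuous_subspaceW c.
  by move=> s /=; rewrite !in_itv /= => /(J01 k s k3).
have /choice[dl dlP] : forall x : ({set V} * 'I_3) * ({set V} * 'I_3), exists d : R, 0 < d /\
    (x.1.1 \in edges G -> x.2.1 \in edges G -> far x.1.1 x.1.2 x.2.1 x.2.2 ->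
     forall s s', J x.1.2 s -> J x.2.2 s' -> d <= `|arc x.1.1 s - arc x.2.1 s'|).
  move=> [[e k] [e' k']] /=.
  have [eE|_] := boolP (e \in edges G); last by exists 1.
  have [e'E|_] := boolP (e' \in edges G); last by exists 1.
  have [fr|nf] := pselect (far e k e' k'); last by exists 1.
  have [d d0 dP] := disjoint_arcs_apart (cont e k eE (ltn_ord k)) (cont e' k' e'E (ltn_ord k')) fr.
  by exists d.
(* The scale [m] exceeds [3 / dl x] for all pairs of thirds at once; by [truncn_far], the walks of
   two disjoint thirds then have no cell in common. *)
pose M := \sum_x 3 / dl x; pose m := (Num.truncn M).+1.
have Mt x : 3 / dl x < m%:R.
  apply: le_lt_trans (truncnS_gt M); rewrite /M (bigD1 x) //= lerDl.
  by apply: sumr_ge0 => y _; apply: divr_ge0 => //; have [/ltW] := dlP y.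
have m0 : 0 < m%:R :> R by rewrite ltr0n.
have /choice[ep epP] : forall e, exists d : R, 0 < d /\ (e \in edges G -> forall x y,
    0 <= x <= 1 -> 0 <= y <= 1 -> `|x - y| < d -> `|arc e x - arc e y| < m%:R^-1).
  move=> e; have [eE|_] := boolP (e \in edges G); last by exists 1.
  have [c _ _] := arcP e eE; have im0 : 0 < m%:R^-1 :> R by rewrite invr_gt0.
  by have [d d0 dP] := uniform_continuity c im0; exists d.
pose n := (Num.truncn (\sum_e (ep e)^-1)).+1.
have n0 : 0 < n%:R :> R by rewrite ltr0n.
have nP e : n%:R^-1 < ep e.
  have [e0 _] := epP e; rewrite -[ep e]invrK ltf_pV2 ?posrE ?invr_gt0 //.
  apply: le_lt_trans (truncnS_gt _); rewrite (bigD1 e) //= lerDl.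
  by apply: sumr_ge0 => y _; rewrite invr_ge0; have [/ltW] := epP y.
pose t (k i : nat) : R := (k%:R + i%:R / n%:R) / 3.
have tJ k i : (i <= n)%N -> J k (t k i).
  move=> il; have h1 : 0 <= i%:R / n%:R :> R by rewrite divr_ge0.
  have h2 : i%:R / n%:R <= 1 :> R by rewrite ler_pdivrMr // mul1r ler_nat.
  rewrite /J /t -[k.+1]addn1 natrD; apply/andP; split; lra.
have t00 k : t k 0%N = k%:R / 3 by rewrite /t mul0r addr0.
have tn k : t k n = k.+1%:R / 3 by rewrite /t divff ?gt_eqF // -[k.+1]addn1 natrD.
pose z e k i := arc e (t k i).
(* The offset makes all scaled coordinates at least 3. This survives truncation, and the corners of
   [lattice_walk] lose at most 1, so the cells stay strictly inside the border at 1. *)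
pose B : R := 3 + \sum_(e in edges G) \sum_(k < 3) \sum_(i < n.+1)
  (`|m%:R * (z e k i).1| + `|m%:R * (z e k i).2|).
have B3 : 3 <= B by rewrite lerDl; do 3! (apply: sumr_ge0 => ? _); rewrite addr_ge0.
have Bz e k i : e \in edges G -> (k < 3)%N -> (i <= n)%N ->
    `|m%:R * (z e k i).1| + `|m%:R * (z e k i).2| <= B - 3.
  move=> eE k3 il; rewrite /B addrAC subrr add0r.
  rewrite (bigD1 e) //= (bigD1 (Ordinal k3)) //= (bigD1 (Ordinal (il : (i < n.+1)%N))) //=.
  have F0 (x y : R) : 0 <= `|x| + `|y| by rewrite addr_ge0.
  rewrite -[leLHS]addr0 -!addrA !lerD2l; apply: addr_ge0; first by apply: sumr_ge0.
  by apply: addr_ge0; do !(apply: sumr_ge0 => ? _).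
pose cl (y : R * R) := (Num.truncn (m%:R * y.1 + B), Num.truncn (m%:R * y.2 + B)).
have zpos e k i : e \in edges G -> (k < 3)%N -> (i <= n)%N ->
    [/\ 3 <= m%:R * (z e k i).1 + B, m%:R * (z e k i).1 + B <= 2 * B,
       3 <= m%:R * (z e k i).2 + B & m%:R * (z e k i).2 + B <= 2 * B].
  by move=> eE k3 il; apply/norm_sum_bounds/Bz.
pose N := (Num.truncn (2 * B)).+4.
pose w (k : nat) e := cl (z e k 0%N) :: lattice_walk (fun i => cl (z e k i)) n.
have wP e k : e \in edges G -> (k < 3)%N ->
   [/\ path lattice_step (cl (z e k 0%N)) (lattice_walk (fun i => cl (z e k i)) n),
    last (cl (z e k 0%N)) (lattice_walk (fun i => cl (z e k i)) n) = cl (z e k n) &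
    forall p, p \in w k e -> exists2 i, (i <= n)%N & close_pt p (cl (z e k i))].
  move=> eE k3; apply: lattice_walkP => i il.
  have [_ /(_ eE) ec] := epP e.
  have := ec (t k i) (t k i.+1) (J01 _ _ k3 (tJ _ _ (ltnW il))) (J01 _ _ k3 (tJ _ _ il)).
  have -> : t k i - t k i.+1 = - (n%:R^-1 / 3) by rewrite /t -[i.+1]addn1 natrD; field; rewrite gt_eqF.
  have in0 : 0 < n%:R^-1 :> R by rewrite invr_gt0.
  rewrite normrN ger0_norm; last by rewrite divr_ge0 // ltW.
  have h : n%:R^-1 / 3 < ep e by apply: le_lt_trans (nP e); lra.
  move=> /(_ h); rewrite prod_norm_lt /=.
  have [a1 _ a2 _] := zpos e k i eE k3 (ltnW il); have [b1 _ b2 _] := zpos e k i.+1 eE k3 il.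
  have D (x y : R) : `|x - y| < m%:R^-1 -> `|m%:R * x + B - (m%:R * y + B)| < 1.
    move=> hxy; have -> : m%:R * x + B - (m%:R * y + B) = m%:R * (x - y) by ring.
    by rewrite normrM (ger0_norm (ltW m0)) -ltr_pdivlMl // mulr1.
  have pos3 (x : R) : 3 <= x -> 0 <= x by move=> hx; apply: le_trans hx.
  move=> /andP[d1 d2]; have {}d1 := D _ _ d1; have {}d2 := D _ _ d2.
  rewrite /close_pt /=; apply/and4P; split; apply: truncn_close; rewrite ?pos3 // distrC //.
have sep e k e' k' p : e \in edges G -> e' \in edges G -> (k < 3)%N -> (k' < 3)%N ->
   far e k e' k' -> p \in w k e -> p \in w k' e' -> False.
  move=> eE e'E k3 k3' fr pw pw'.
  have [_ _ /(_ p pw)[i il ci]] := wP e k eE k3.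
  have [_ _ /(_ p pw')[i' il' ci']] := wP e' k' e'E k3'.
  have [d0 dd] := dlP ((e, Ordinal k3), (e', Ordinal k3')); have mt := Mt ((e, Ordinal k3), (e', Ordinal k3')).
  have := dd eE e'E fr _ _ (tJ k i il) (tJ k' i' il'); apply/negP; rewrite -ltNge /=.
  move: d0 mt; rewrite /=; set d := dl _ => d0 mt; rewrite prod_norm_lt.
  have [a1 _ a2 _] := zpos e k i eE k3 il; have [b1 _ b2 _] := zpos e' k' i' e'E k3' il'.
  have D (x y : R) : `|m%:R * x + B - (m%:R * y + B)| < 3 -> `|x - y| < d.
    have -> : m%:R * x + B - (m%:R * y + B) = m%:R * (x - y) by ring.
    rewrite normrM (ger0_norm (ltW m0)) => hxy.
    move: mt; rewrite ltr_pdivrMr // => mt.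
    by rewrite -(ltr_pM2l m0); apply: lt_trans mt.
  have pos3 (x : R) : 3 <= x -> 0 <= x by move=> hx; apply: le_trans hx.
  move: ci ci' => /and4P[c1 c2 c3 c4] /and4P[c5 c6 c7 c8].
  by apply/andP; split; apply: D; [apply: (@truncn_far _ _ p.1) | apply: (@truncn_far _ _ p.2)]; rewrite ?pos3.
pose cell v := cl (pos v).
exists N; suff [lam h] : exists lam, lattice_minor G N lam cell by exists lam, cell.
have int01 k (s : R) : J k s -> k = 1%N -> s \in `]0%R, 1%R[.
  by rewrite /J => /andP[h1 h2] k1; rewrite k1 in h1 h2; rewrite in_itv /=; apply/andP; split; lra.
have J3 (s : R) : 0 <= s <= 1 -> s = 0 \/ s = 1 \/ s \in `]0%R, 1%R[.
  rewrite in_itv /= => /andP[h1 h2].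
  have [->|n1] := eqVneq s 0; first by left.
  have [->|n2] := eqVneq s 1; first by right; left.
  by right; right; rewrite !lt_neqAle h1 h2 n2 eq_sym n1.
have arc_ends e e' s s' : e \in edges G -> e' \in edges G -> e <> e' -> s \in `]0%R, 1%R[ ->
    0 <= s' <= 1 -> arc e s <> arc e' s'.
  move=> eE e'E ne si s'i; have [_ p0 p1] := fP e' e'E; have [v1 v2] := vfe e' e'E.
  case: (J3 s' s'i) => [->|[->|]]; first by rewrite p0; apply: arc_v.
  - by rewrite p1; apply: arc_v.
  - by apply: arc_arc.
apply: (@lattice_minor_of_walks _ _ _ _ fe se (w 0%N) (w 1%N) (w 2%N)).
- by move=> e /fP[].
- move=> e eE; have [h1 h2 _] := wP e 0%N eE isT; have [h3 _ _] := wP e 1%N eE isT.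
  have E0 : cl (z e 0%N 0%N) = cell (fe e) by rewrite /z t00 mul0r; have [_ -> _] := fP e eE.
  have E1 : cl (z e 0%N n) = cl (z e 1%N 0%N) by rewrite /z tn t00.
  exists (lattice_walk (fun i => cl (z e 0%N i)) n); rewrite -E0; split=> //.
  by exists (lattice_walk (fun i => cl (z e 1%N i)) n); rewrite h2 E1.
- move=> e x s eE [<- <-]; have [_ h2 _] := wP e 1%N eE isT; have [h3 h4 _] := wP e 2%N eE isT.
  have E1 : cl (z e 1%N n) = cl (z e 2%N 0%N) by rewrite /z tn t00.
  have E2 : cl (z e 2%N n) = cell (se e) by rewrite /z tn divff // /cell; have [_ _ ->] := fP e eE.
  by exists (lattice_walk (fun i => cl (z e 2%N i)) n); rewrite h2 E1 h4 E2.
- move=> e p eE; suff H k : (k < 3)%N -> p \in w k e -> [&& 1 < p.1, p.1 < N, 1 < p.2 & p.2 < N]%N.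
    by case/or3P; apply: H.
  move=> k3 pw; have [_ _ /(_ p pw)[i il /and4P[c1 c2 c3 c4]]] := wP e k eE k3.
  have [a1 a1' a2 a2'] := zpos e k i eE k3 il.
  have tr (x : R) : 3 <= x -> x <= 2 * B -> (3 <= Num.truncn x)%N /\ (Num.truncn x <= Num.truncn (2 * B))%N.
    move=> x3 xB; have x0 : 0 <= x by apply: le_trans x3.
    by rewrite truncn_ge_nat // x3 le_truncn.
  have [h1 h2] := tr _ a1 a1'; have [h3 h4] := tr _ a2 a2'.
  move: c1 c2 c3 c4; rewrite /cl /= /N; move: h1 h2 h3 h4.
  by move: (Num.truncn _) (Num.truncn _) (Num.truncn _); clear => x y b; lia.
- move=> e e' p eE e'E ne p1.
  have H k : (k < 3)%N -> p \in w k e' -> False.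
    move=> k3; apply: sep p1 => // s s' Js Js'.
    by apply: arc_ends => //; [apply: int01 Js _ | apply: J01 Js'].
  by case/or3P; apply: H.
have Jstar k s (b : bool) : k = (if b then 2 else 0)%N -> J k s -> (s \in `]0%R, 1%R[) \/ s = b%:R.
  move=> kb Js; have k3 : (k < 3)%N by rewrite kb; case: b {kb}.
  case: (J3 s (J01 _ _ k3 Js)) => [s0|[s1|]]; [|by move: Js; rewrite /J kb s1; case: (b) => /andP[h1 h2]; [right | exfalso; lra]|by left].
  by move: Js; rewrite /J kb s0; case: (b) => /andP[h1 h2]; [exfalso; lra | right].
have starP e v p : (fe e == v) && (p \in w 0%N e) || (se e == v) && (p \in w 2%N e) ->
    e \in edges G -> exists b : bool, p \in w (if b then 2 else 0)%N e /\ arc e b%:R = pos v.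
  move=> h eE; have [_ p0 p1] := fP e eE.
  case/orP: h => /andP[/eqP<- h]; [by exists false | by exists true].
move=> e e' v v' p eE e'E st st'.
have vv e1 v1 p1 : (fe e1 == v1) && (p1 \in w 0%N e1) || (se e1 == v1) && (p1 \in w 2%N e1) ->
    e1 \in edges G -> v1 \in verts G.
  by move=> /orP[]/andP[/eqP<- _] /vfe[].
have [b [pw pb]] := starP e v p st eE; have [b' [pw' pb']] := starP e' v' p st' e'E.
have [->//|ne] := eqVneq v v'.
have nbb : pos v <> pos v' by move/(posI _ _ (vv _ _ _ st eE) (vv _ _ _ st' e'E)); apply/eqP.
have b3 (c : bool) : ((if c then 2 else 0) < 3)%N by case: c.
(* Outer thirds at different vertices are disjoint: on one arc by injectivity, on two arcs because
   these meet only at common ends. *)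
exfalso; apply: sep pw pw' => //.
move=> s s' Js Js' Ea.
have [eq|nee] := pselect (e = e').
  rewrite -eq in pb' Ea.
  have [_ inj _] := arcP e eE.
  have ss : s = s' by apply: inj => //; rewrite in_itv /=; [apply: J01 Js | apply: J01 Js'].
  move: Js Js' pb pb'; rewrite /J ss; case: (b); case: (b') => //=.
  - by move=> _ _ -> /nbb.
  - by move=> /andP[? ?] /andP[? ?]; exfalso; lra.
  - by move=> /andP[? ?] /andP[? ?]; exfalso; lra.
  - by move=> _ _ -> /nbb.
case: (Jstar _ s b erefl Js) => [si|sb].
  by apply: (arc_ends _ _ _ _ eE e'E nee si (J01 _ _ _ Js')) => //.
case: (Jstar _ s' b' erefl Js') => [si|sb'].
  apply: (arc_ends _ _ _ _ e'E eE _ si (J01 _ _ _ Js)) => //.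
  by move=> h; apply: nee.
by apply: nbb; rewrite -pb -pb' -sb -sb'.
Qed.

End PlanarLattice.

(** * Separators of planar graphs *)

(** [rk p] is the length of a shortest walk in [Y] from [p] to [Z], and [par p] is its second point.
    The type is a mere [eqType] because the lemma serves for lattice points. *)
Lemma bfs_parents (T : eqType) (e : rel T) (Y Z : pred T) :
  exists (par : T -> T) (rk : T -> nat), forall p s, path e p s -> all Y (p :: s) ->
    Z (last p s) -> ~~ Z p -> [/\ e p (par p), (rk (par p) < rk p)%N &
      exists s', [/\ path e (par p) s', all Y (par p :: s') & Z (last (par p) s')]].
Proof.
pose good p s := [/\ path e p s, all Y (p :: s) & Z (last p s)].
pose has_len p n := exists2 s, size s = n & good p s.
have rkP p : exists n, (forall m, has_len p m -> (n <= m)%N) /\ ((exists m, has_len p m) -> has_len p n).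
  have [[m hm]|no] := pselect (exists m, has_len p m); last first.
    by exists 0%N; split=> // m hm; case: no; exists m.
  have ex : exists m, `[< has_len p m >] by exists m; apply/asboolP.
  have [n /asboolP hn mn] := ex_minnP ex.
  by exists n; split=> // k hk; apply: mn; apply/asboolP.
have [rk rkH] := choice rkP.
have parP p : exists q, ~~ Z p -> (exists s, good p s) -> exists2 s, good p (q :: s) & size s = (rk p).-1.
  have [[m hm]|no] := pselect (exists m, has_len p m); last first.
    by exists p => _ [s gs]; case: no; exists (size s); exists s.
  have [s sz gs] := (rkH p).2 (ex_intro _ m hm).
  case: s sz gs => [|q s] sz gs; last by exists q => _ _; exists s; rewrite // -sz.
  by exists p => /negP; case: gs => _ _ /= h /(_ h).
have [par parH] := choice parP.
exists par, rk => p s h1 h2 h3 nz.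
have ex : exists s, good p s by exists s.
have [s' [/= /andP[g1 g2] /and3P[g3 g4 g5] g6] sz] := parH p nz ex.
split=> //; last by exists s'; split=> //=; rewrite g4.
have gs' : has_len (par p) (size s') by exists s'; rewrite // /good /= g4.
have := (rkH (par p)).1 _ gs'; rewrite sz.
have [t st gt] := (rkH p).2 (ex_intro _ _ (ex_intro2 _ _ s erefl (And3 h1 h2 h3))).
case: t st gt => [|? ?] <- [_ _ h] /=; last by rewrite ltnS.
by rewrite h in nz.
Qed.

Section Separator.
Local Open Scope nat_scope.
Notation pt := (nat * nat)%type.
Variables (R : realType) (V : finType) (G : graph V).
Hypothesis planarG : planar R G.
Implicit Types (u v w : V) (p q : pt).

Lemma adj_sym : symmetric (adj G).
Proof. by move=> x y; rewrite /adj finset.setUC. Qed.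

Lemma connect_adj_sym : connect_sym (adj G).
Proof. exact/sym_connect_sym/adj_sym. Qed.

Variables (r : V) (par : V -> V) (rk : V -> nat).
Hypothesis par_root : par r = r.
Hypothesis parP : forall v, connect (adj G) r v -> v != r -> adj G v (par v) /\ rk (par v) < rk v.

Let border (N : nat) p := [|| p.1 == 1, p.1 == N, p.2 == 1 | p.2 == N].
(** Top and bottom rows are followed to the left, side columns downwards, and [(1, 1)] leads into
    the interior. The only border edge left out joins [(N, N.-1)] to [(N, N)]: it is the edge [e0]
    of the lattice separator. *)
Let border_par (N : nat) p : pt :=
  if (p.2 == N) && (1 < p.1) then (p.1.-1, p.2) else if (p.1 == 1) && (1 < p.2) then (p.1, p.2.-1)
  else if (p.1 == N) && (1 < p.2) then (p.1, p.2.-1) else if 1 < p.1 then (p.1.-1, p.2) else (2, 2).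

Lemma lattice_adj_h (x y : nat) : 0 < x -> lattice_adj (x, y) (x.-1, y).
Proof. by move=> x0; apply/lattice_adjP; exists 0 => //; right; rewrite /edge_end /= prednK. Qed.

Lemma lattice_adj_v (x y : nat) : 0 < y -> lattice_adj (x, y) (x, y.-1).
Proof. by move=> x0; apply/lattice_adjP; exists 1 => //; right; rewrite /edge_end /= prednK. Qed.

Lemma border_parP N p : 2 < N -> in_box N p -> border N p ->
  lattice_adj p (border_par N p) /\ in_box N (border_par N p) /\
  (~~ border N (border_par N p) \/ (border_par N p).1 + (border_par N p).2 < p.1 + p.2).
Proof.
case: p => x y N2; rewrite /in_box /border /border_par /= => h b.
case: ifP => c1; first by split; [apply: lattice_adj_h; lia | split; [|right] => /=; lia].
case: ifP => c2; first by split; [apply: lattice_adj_v; lia | split; [|right] => /=; lia].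
case: ifP => c3; first by split; [apply: lattice_adj_v; lia | split; [|right] => /=; lia].
case: ifP => c4; first by split; [apply: lattice_adj_h; lia | split; [|right] => /=; lia].
have -> : (x, y) = (1, 1) by congr pair; lia.
split; last by rewrite /=; split; [lia | left; lia].
by apply/lattice_adjP; exists 2 => //; left.
Qed.

Lemma interior_walk N p q : in_box N p -> ~~ border N p -> in_box N q -> ~~ border N q ->
  exists s, [/\ path lattice_step p s, last p s = q & all (fun z => in_box N z && ~~ border N z) (p :: s)].
Proof.
have step_h n x y x' : x <= x' + n -> x' <= x + n -> in_box N (x, y) -> ~~ border N (x, y) -> in_box N (x', y) ->
   ~~ border N (x', y) -> exists s, [/\ path lattice_step (x, y) s, last (x, y) s = (x', y) &
     all (fun z => in_box N z && ~~ border N z) ((x, y) :: s)].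
  elim: n x => [|n IH] x h1 h2 b1 b2 b3 b4.
    by exists [::]; rewrite /= b1 b2; split=> //; congr pair; lia.
  have [x1 [hx1 [hx2 [hx3 hx4]]]] : exists x1, x1 <= x.+1 /\ (x <= x1.+1 /\ (x1 <= x' + n /\ x' <= x1 + n) /\
      in_box N (x1, y) /\ ~~ border N (x1, y)).
    move: b1 b2 b3 b4; rewrite /in_box /border /=.
    have [h|h] := leqP x x'; have [h'|h'] := leqP x x'.-1.
    - by exists x.+1; lia.
    - by exists x; lia.
    - by exists x.-1; lia.
    - by exists x.-1; lia.
  have [s [s1 s2 s3]] := IH x1 hx3.1 hx3.2 hx4.1 hx4.2 b3 b4.
  exists ((x1, y) :: s); rewrite /= lattice_step_h // s1 s2; split=> //.
  by rewrite b1 b2.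
have step_v n x y y' : y <= y' + n -> y' <= y + n -> in_box N (x, y) -> ~~ border N (x, y) -> in_box N (x, y') ->
   ~~ border N (x, y') -> exists s, [/\ path lattice_step (x, y) s, last (x, y) s = (x, y') &
     all (fun z => in_box N z && ~~ border N z) ((x, y) :: s)].
  elim: n y => [|n IH] y h1 h2 b1 b2 b3 b4.
    by exists [::]; rewrite /= b1 b2; split=> //; congr pair; lia.
  have [x1 [hx1 [hx2 [hx3 hx4]]]] : exists x1, x1 <= y.+1 /\ (y <= x1.+1 /\ (x1 <= y' + n /\ y' <= x1 + n) /\
      in_box N (x, x1) /\ ~~ border N (x, x1)).
    move: b1 b2 b3 b4; rewrite /in_box /border /=.
    have [h|h] := leqP y y'; have [h'|h'] := leqP y y'.-1.
    - by exists y.+1; lia.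
    - by exists y; lia.
    - by exists y.-1; lia.
    - by exists y.-1; lia.
  have [s [s1 s2 s3]] := IH x1 hx3.1 hx3.2 hx4.1 hx4.2 b3 b4.
  exists ((x, x1) :: s); rewrite /= lattice_step_v // s1 s2; split=> //.
  by rewrite b1 b2.
case: p q => [x y] [x' y'] b1 b2 b3 b4.
have [b5 b6] : in_box N (x', y) /\ ~~ border N (x', y) by move: b1 b2 b3 b4; rewrite /in_box /border /=; lia.
have [s [s1 s2 s3]] := step_h (x + x') x y x' (leq_trans (leq_addr x' x) (leq_addl _ _)) (leq_trans (leq_addl x x') (leq_addl _ _)) b1 b2 b5 b6.
have [t [t1 t2 t3]] := step_v (y + y') x' y y' (leq_trans (leq_addr y' y) (leq_addl _ _)) (leq_trans (leq_addl y y') (leq_addl _ _)) b5 b6 b3 b4.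
exists (s ++ t); rewrite cat_path last_cat s2 s1 t1 t2; split=> //.
by move: s3 t3 => /= /andP[-> s3] /andP[_ t3]; rewrite all_cat s3 t3.
Qed.

(* The spanning tree of G lifts to a spanning tree of the box: labelled cells
   lead to the label of the parent, unlabelled ones to a labelled one, and the
   border is followed around. *)
Lemma lattice_tree N (lam : pt -> option V) (cell : V -> pt) : lattice_minor G N lam cell ->
  (exists u, adj G r u) -> exists (lpar : pt -> pt) (lrk : pt -> nat),
  [/\ forall p, in_box N p -> p != cell r -> [/\ lattice_adj p (lpar p), in_box N (lpar p) & lrk (lpar p) < lrk p],
    forall p, in_box N p -> border N p -> lpar p = border_par N p &
    forall p v, lam p = Some v -> connect (adj G) r v -> p != cell r ->
      lam (lpar p) = Some v \/ (v != r /\ lam (lpar p) = Some (par v))].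
Proof.
move=> [lam1 lam2 lam3 lam4] [r' rr'].
have lamr := lam1 _ _ rr'.
have N2 : 2 < N by have [_] := lam2 _ _ lamr; lia.
pose lb v p := lam p == Some v.
have lb_int v p : lb v p -> in_box N p && ~~ border N p.
  by move=> /eqP/lam2[_]; rewrite /in_box /border; lia.
have nbr v : connect (adj G) r v -> exists u, adj G v u.
  move=> cv; have [->|vr] := eqVneq v r; first by exists r'.
  by have [a _] := parP cv vr; exists (par v).
(* For each [v] a fixed pair of cells realises the edge to its parent; within the label [v] the tree
   will lead to the first of them, [tgt v]. *)
have exitP v : exists pq : pt * pt, connect (adj G) r v -> v != r ->
    [/\ lam pq.1 = Some v, lam pq.2 = Some (par v) & lattice_step pq.1 pq.2].
  have [cv|_] := boolP (connect (adj G) r v); last by exists ((0, 0), (0, 0)).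
  have [_|vr] := eqVneq v r; first by exists ((0, 0), (0, 0)).
  by have [/lam4[p [q h]] _] := parP cv vr; exists (p, q).
have [ex exP] := choice exitP.
pose tgt v := if v == r then cell r else (ex v).1.
have /choice[bp /choice[brk bP]] : forall v, exists bp : pt -> pt, exists brk : pt -> nat,
   forall p s, path lattice_step p s -> all (lb v) (p :: s) -> last p s == tgt v -> p != tgt v ->
   [/\ lattice_step p (bp p), brk (bp p) < brk p & lam (bp p) = Some v].
  move=> v; have [bp [brk H]] := bfs_parents lattice_step (lb v) (pred1 (tgt v)).
  exists bp, brk => p s h1 h2 h3 h4; have [a b [s' [_ /= /andP[/eqP c _] _]]] := H p s h1 h2 h3 h4.
  by split.
have tgt_lam v : connect (adj G) r v -> lam (tgt v) = Some v.
  move=> cv; rewrite /tgt; have [->//|vr] := eqVneq v r; by have [] := exP v cv vr.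
have conn v p q : connect (adj G) r v -> lam p = Some v -> lam q = Some v ->
    exists s, [/\ path lattice_step p s, last p s = q & all (lb v) (p :: s)].
  move=> cv pv qv; have [s [s1 s2 s3]] := lam3 p v pv; have [t [t1 t2 t3]] := lam3 q v qv.
  exists (s ++ rev (belast q t)); rewrite cat_path last_cat s2 -t2 rev_path s1; split.
  - by rewrite (eq_path (e' := lattice_step)) // => a b; rewrite lattice_step_sym.
  - by case: (t) => //= a t'; rewrite rev_cons last_rcons.
  rewrite -cat_cons all_cat /= {1}/lb pv eqxx s3 all_rev /=.
  have : all (lb v) (rcons (belast q t) (last q t)) by rewrite -lastI /= /lb qv eqxx.
  by rewrite all_rcons => /andP[].
pose labelled p := if lam p is Some v then connect (adj G) r v else false.
have [up [urk uP]] := bfs_parents lattice_step (fun z => in_box N z && ~~ border N z) labelled.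
pose lpar p := if p == cell r then p else if border N p then border_par N p else
  if lam p is Some v then if connect (adj G) r v then
      if p == tgt v then (ex v).2 else bp v p else up p else up p.
have not_step p q (f : pt -> nat) : lattice_step p q -> f q < f p -> lattice_adj p q.
  by rewrite /lattice_step; case: eqP => // ->; rewrite ltnn.
have stepB p : in_box N p -> p != cell r -> border N p -> lpar p = border_par N p.
  by rewrite /lpar => _ /negPf-> ->.
have stepU p : in_box N p -> ~~ border N p -> ~~ labelled p ->
    [/\ lattice_adj p (lpar p), in_box N (lpar p) && ~~ border N (lpar p), lpar p = up p & urk (lpar p) < urk p].
  move=> pb nb nl.
  have pr : p == cell r = false.
    by apply: contraNF nl => /eqP->; rewrite /labelled lamr connect0.
  have /andP[rb nrb] := lb_int r (cell r) (introT eqP lamr).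
  have [s [s1 s2 s3]] := interior_walk pb nb rb nrb.
  have [|a b [s' [_ /= /andP[c _] _]]] := uP p s s1 s3 _ nl; first by rewrite s2 /labelled lamr connect0.
  have Ep : lpar p = up p.
    by rewrite /lpar pr (negPf nb); move: nl; rewrite /labelled; case: (lam p) => // v /negPf->.
  by rewrite Ep; split=> //; apply: not_step b.
have stepL p v : lam p = Some v -> connect (adj G) r v -> p != cell r ->
    lattice_adj p (lpar p) /\ ((lam (lpar p) = Some v /\ brk v (lpar p) < brk v p) \/
      (v != r /\ lam (lpar p) = Some (par v))).
  move=> pv cv pr; have /andP[pb nb] := lb_int v p (introT eqP pv).
  have Ep : lpar p = if p == tgt v then (ex v).2 else bp v p.
    by rewrite /lpar (negPf pr) (negPf nb) pv cv.
  have [E|ne] := eqVneq p (tgt v).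
    have vr : v != r by apply: contra pr => /eqP vr; rewrite E /tgt vr eqxx.
    have [a b c] := exP v cv vr.
    rewrite Ep E eqxx; split; last by right.
    move: c; rewrite /tgt (negPf vr) /lattice_step; case: eqP => // E'.
    have [av] := parP cv vr; move: b; rewrite -E' a => -[<-]; by rewrite ltnn.
  have [s [s1 s2 s3]] := conn v p (tgt v) cv pv (tgt_lam v cv).
  have [|a b c] := bP v p s s1 s3 _ ne; first by rewrite s2.
  by rewrite Ep (negPf ne); split; [apply: not_step b | left].
have lparr : lpar (cell r) = cell r by rewrite /lpar eqxx.
have cpar v : connect (adj G) r v -> v != r -> connect (adj G) r (par v).
  by move=> cv vr; have [a _] := parP cv vr; apply: connect_trans cv (connect1 a).
(* Lexicographic induction on the rank of the label in the tree of [G], then on the rank of the cell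
   within its label. *)
have reachL n m p v : lam p = Some v -> connect (adj G) r v -> rk v < n -> brk v p < m -> exists i, iter i lpar p = cell r.
  elim: n m p v => // n IHn; elim=> // m IHm p v pv cv vn pm.
  have [->|pr] := eqVneq p (cell r); first by exists 0.
  have [_ [[h1 h2]|[vr h1]]] := stepL p v pv cv pr.
    have [|i hi] := IHm (lpar p) v h1 cv vn; first exact: leq_trans h2 _.
    by exists i.+1; rewrite iterSr.
  have [_ lt] := parP cv vr.
  have [|i hi] := IHn (brk (par v) (lpar p)).+1 (lpar p) (par v) h1 (cpar v cv vr) _ (leqnn _).
    exact: leq_trans lt _.
  by exists i.+1; rewrite iterSr.
have reachU n p : in_box N p -> ~~ border N p -> urk p < n -> exists i, iter i lpar p = cell r.
  elim: n p => // n IHn p pb nb pn.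
  have [lp|nl] := boolP (labelled p).
    by move: lp; rewrite /labelled; case E: (lam p) => [v|//] cv; apply: (reachL (rk v).+1 (brk v p).+1 p v).
  have [_ /andP[h1 h2] _ h3] := stepU p pb nb nl.
  have [|i hi] := IHn (lpar p) h1 h2; first exact: leq_trans h3 _.
  by exists i.+1; rewrite iterSr.
have reachB n p : in_box N p -> p.1 + p.2 < n -> exists i, iter i lpar p = cell r.
  elim: n p => // n IHn p pb pn.
  have [nb|nb] := boolP (border N p); last exact: (reachU (urk p).+1).
  have [->|pr] := eqVneq p (cell r); first by exists 0.
  have [_ [h1 [h2|h2]]] := border_parP N2 pb nb.
    have [i hi] := reachU (urk (border_par N p)).+1 _ h1 h2 (leqnn _).
    by exists i.+1; rewrite iterSr stepB.
  have [|i hi] := IHn (border_par N p) h1; first exact: leq_trans h2 _.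
  by exists i.+1; rewrite iterSr stepB.
(* The local ranks decrease only within their own phase, so the number of steps to the root is taken
   as rank for the whole tree. *)
have lrkP p : exists n, in_box N p -> iter n lpar p = cell r /\ forall m, iter m lpar p = cell r -> n <= m.
  have [pb|_] := boolP (in_box N p); last by exists 0.
  have [i hi] := reachB _ p pb (leqnn _).
  have exi : exists i, iter i lpar p == cell r by exists i; apply/eqP.
  have [n /eqP hn mn] := ex_minnP exi.
  by exists n => _; split=> // m /eqP; apply: mn.
have [lrk lrkH] := choice lrkP.
have cellr_nb : ~~ border N (cell r) by have /andP[] := lb_int r (cell r) (introT eqP lamr).
have step p : in_box N p -> p != cell r -> lattice_adj p (lpar p) /\ in_box N (lpar p).
  move=> pb pr; have [nb|nb] := boolP (border N p).
    by rewrite stepB //; have [? [? _]] := border_parP N2 pb nb.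
  have [lp|nl] := boolP (labelled p); last by have [? /andP[]] := stepU p pb nb nl.
  move: lp; rewrite /labelled; case E: (lam p) => [v|//] cv.
  have [a [[h _]|[_ h]]] := stepL p v E cv pr; split=> //.
    by have /andP[] := lb_int v (lpar p) (introT eqP h).
  by have /andP[] := lb_int _ (lpar p) (introT eqP h).
exists lpar, lrk; split.
- move=> p pb pr; have [a b] := step p pb pr; split=> //.
  have [h1 _] := lrkH p pb; have [_ h2] := lrkH (lpar p) b.
  case E: (lrk p) h1 => [|n] h1; first by rewrite -h1 eqxx in pr.
  by rewrite ltnS; apply: h2; rewrite -iterSr.
- by move=> p pb nb; apply: stepB => //; apply: contraTneq nb => ->.
- move=> p v pv cv pr; by have [_ [[]|]] := stepL p v pv cv pr; [left | right].
Qed.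

(** [fconnect par a v] says that [v] lies on the root path of [a]. *)
Definition off_paths (X : seq V) v := all (fun a => ~~ fconnect par a v) X.
Definition off_adj (X : seq V) : rel V := [rel x y | [&& adj G x y, off_paths X x & off_paths X y]].

(** The three lattice paths project to root paths of [G], since by [lattice_tree] the labels met on
    a lattice path climb the tree of [G]. Conversely, a component off these root paths lifts to
    cells that are connected off the lattice paths. *)
Lemma planar_separator (W : {set V}) : (forall w, w \in W -> connect (adj G) r w) ->
  exists X : seq V, size X = 3 /\ all (connect (adj G) r) X /\
    forall v, off_paths X v -> 2 * #|[set w in W | connect (off_adj X) v w]%SET| <= #|W|.
Proof.
move=> Wr; have [ex|nex] := pselect (exists u, adj G r u); last first.
  (* Without an edge at [r] the set [W] contains at most [r], which lies on its own root path. *)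
  exists [:: r; r; r]; rewrite /= connect0; split=> //; split=> // v; rewrite /off_paths /= => /andP[vr _].
  rewrite (_ : [set w in W | _]%SET = finset.set0) ?cards0 ?muln0 //.
  apply/setP => w; rewrite !inE; apply/negP => /andP[/Wr cw].
  have wr : w = r.
    by case/connectP: cw => -[|u s] //= /andP[ru _]; case: nex; exists u.
  rewrite wr => /connectP[s ps rE]; move: ps vr; rewrite rE.
  case/lastP: s {rE} => [|s x]; first by rewrite connect0.
  rewrite rcons_path last_rcons => /andP[_ /and3P[_ _]].
  by rewrite /off_paths /= connect0.
have [N [lam [cell lm]]] := planar_lattice_minor planarG.
have [lpar [lrk [T1 T2 T3]]] := lattice_tree lm ex.
have [lam1 lam2 lam3 lam4] := lm; have [r' rr'] := ex.
have lamr := lam1 _ _ rr'.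
have N2 : 2 < N by have [_] := lam2 _ _ lamr; lia.
have nbr v : connect (adj G) r v -> exists u, adj G v u.
  move=> cv; have [->|vr] := eqVneq v r; first by exists r'.
  by have [a _] := parP cv vr; exists (par v).
have lamc v : connect (adj G) r v -> lam (cell v) = Some v by move=> /nbr[u /lam1].
have tree e : edge_in N e -> e != ((N, N.-1), 1) -> tri_bd (tri_in N) e -> tree_edge N lpar (cell r) e.
  move=> ein ne bd.
  have /andP[rb nrb] : in_box N (cell r) && ~~ border N (cell r).
    by have [_] := lam2 _ _ lamr; rewrite /in_box /border; lia.
  have /and3P[_ b1 b2] := ein.
  rewrite /tree_edge ein /=; apply/orP; right.
  have H : border N (edge_end e) -> border_par N (edge_end e) = e.1 ->
      (edge_end e != cell r) && (lpar (edge_end e) == e.1).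
    by move=> hb hp; rewrite T2 // hp eqxx andbT; apply: contraNneq nrb => <-.
  case: e ne bd ein b1 b2 H => [[x y] k]; rewrite /edge_in /tri_bd /tri1 /tri2 /tri_in /in_box /edge_end /border /border_par /=.
  rewrite !xpair_eqE.
  case: k => [|[|[|k]]] //= ne bd ein b1 b2 H; apply: H; try lia.
  - case: ifP => c1 //; case: ifP => c2; first lia.
    by case: ifP => c3; [lia | case: ifP => c4 //; lia].
  - case: ifP => c1; first lia. case: ifP => c2 //; case: ifP => c3 //; lia.
pose WL := [seq cell w | w <- enum W].
have WLin p : p \in WL -> tri_in N (p, true).
  by move=> /mapP[w]; rewrite mem_enum => /Wr/lamc/lam2[_] h ->; rewrite /tri_in /=; lia.
have [XL [szX [inX sepX]]] := lattice_separator T1 (ltnW N2) tree WLin.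
(* the labels met by a root path of the box lie on one root path of G *)
have topP n p : in_box N p -> exists t, [/\ connect (adj G) r t,
    (forall v, lam p = Some v -> connect (adj G) r v -> t = v) &
    forall q v, q \in root_walk lpar (cell r) n p -> lam q = Some v -> connect (adj G) r v -> fconnect par t v].
  elim: n p => [|n IH] p pb.
    case E: (lam p) => [v|]; last first.
      by exists r; split=> // q v; rewrite inE => /eqP->; rewrite E.
    have [cv|ncv] := boolP (connect (adj G) r v).
      by exists v; split=> // [u [->]//|q u]; rewrite inE => /eqP->; rewrite E => -[->].
    exists r; split=> // [u [<-]|q u]; first by rewrite (negPf ncv).
    by rewrite inE => /eqP->; rewrite E => -[<-]; rewrite (negPf ncv).
  have [pr|pr] := eqVneq p (cell r).
    exists r; split=> // [v|q v]; first by rewrite pr lamr => -[].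
    by rewrite /= pr eqxx inE => /eqP->; rewrite lamr => -[->].
  have [a b _] := T1 p pb pr; have [t [t1 t2 t3]] := IH _ b.
  have [[v [pv cv]]|nl] := pselect (exists v, lam p = Some v /\ connect (adj G) r v).
    exists v; split=> // [u|q u]; first by rewrite pv => -[].
    rewrite /= (negPf pr) inE => /orP[/eqP->|qs]; first by rewrite pv => -[->].
    move=> qu cu; have fc := t3 q u qs qu cu.
    have [h|[vr h]] := T3 p v pv cv pr; first by rewrite -(t2 v h cv).
    have [av _] := parP cv vr; have cp := connect_trans cv (connect1 av).
    by rewrite (t2 _ h cp) in fc; apply: connect_trans fc; apply: connect1; rewrite /= eqxx.
  exists t; split=> // [v pv cv|q u]; first by case: nl; exists v.
  rewrite /= (negPf pr) inE => /orP[/eqP->|qs]; last exact: t3.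
  by move=> pu cu; case: nl; exists u.
have /choice[top topH] : forall p, exists t, in_box N p -> [/\ connect (adj G) r t,
    (forall v, lam p = Some v -> connect (adj G) r v -> t = v) &
    forall q v, q \in Up lpar lrk (cell r) p -> lam q = Some v -> connect (adj G) r v -> fconnect par t v].
  move=> p; have [pb|_] := boolP (in_box N p); last by exists r.
  by have [t h] := topP (lrk p) p pb; exists t.
exists (map top XL); rewrite size_map; split=> //; split.
  by apply/allP => _ /mapP[p pX ->]; have [] := topH p (allP inX _ pX).
set X := map top XL => v offv.
pose comp := connect (off_adj X) v.
pose Q p := if lam p is Some u then connect (adj G) r u && comp u else false.
have off_comp u : comp u -> off_paths X u.
  move=> /connectP[s ps ->]; case/lastP: s ps => // s x; rewrite rcons_path last_rcons.
  by move=> /andP[_ /and3P[]].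
have off_lat p u : lam p = Some u -> connect (adj G) r u -> off_paths X u ->
    forall x, x \in XL -> p \notin Up lpar lrk (cell r) x.
  move=> pu cu /allP offu x xX; apply/negP => px.
  have [_ _ h] := topH x (allP inX _ xX).
  by have := offu (top x) (map_f _ xX); rewrite (h p u px pu cu).
have := sepX Q; rewrite count_map size_map -cardE => H.
apply: leq_trans (H _ _ _) => {H}.
- rewrite leq_mul2l /= cardE -size_filter; apply: uniq_leq_size (enum_uniq _) _ => w.
  rewrite mem_enum inE mem_filter mem_enum => /andP[wW cw].
  by rewrite wW andbT /= /Q lamc Wr.
- move=> p; rewrite /Q; case E: (lam p) => [u|//] _.
  by have [_] := lam2 _ _ E; rewrite /in_box; lia.
- move=> p; rewrite /Q; case E: (lam p) => [u|//] /andP[cu /off_comp ou].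
  exact: off_lat E cu ou.
(* A locally constant [phi] is constant on the connected set of cells of one label, and adjacent
   vertices of the component have adjacent cells. *)
move=> phi hphi.
have inb p u : lam p = Some u -> in_box N p by move=> /lam2[_]; rewrite /in_box; lia.
have offL p u : lam p = Some u -> connect (adj G) r u -> off_paths X u -> all (fun x => p \notin Up lpar lrk (cell r) x) XL.
  by move=> pu cu ou; apply/allP => x; apply: off_lat pu cu ou x.
have step p q u u' : lattice_step p q -> lam p = Some u -> lam q = Some u' -> connect (adj G) r u ->
    connect (adj G) r u' -> off_paths X u -> off_paths X u' -> phi p = phi q.
  rewrite /lattice_step => /orP[/eqP->//|pq] pu qu cu cu' ou ou'.
  by apply: hphi; rewrite ?(inb _ _ pu) ?(inb _ _ qu) ?(offL _ _ pu) ?(offL _ _ qu).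
have cst p u : lam p = Some u -> connect (adj G) r u -> off_paths X u -> phi p = phi (cell u).
  move=> pu cu ou; have [s [s1 <- s3]] := lam3 p u pu.
  elim: s p pu s1 s3 => //= q s IH p pu /andP[pq ps] /andP[/eqP qu als].
  by rewrite (step _ _ _ _ pq pu qu cu cu ou ou); apply: IH.
have cst2 u u' : connect (adj G) r u -> off_adj X u u' -> phi (cell u) = phi (cell u').
  move=> cu /and3P[uu' ou ou']; have cu' := connect_trans cu (connect1 uu').
  have [p [q [pu qu pq]]] := lam4 _ _ uu'.
  by rewrite -(cst p u) // -(cst q u') //; apply: step pq pu qu cu cu' ou ou'.
have sym : connect_sym (off_adj X).
  by apply: sym_connect_sym => x y; apply/and3P/and3P => -[a b c]; split; rewrite // adj_sym.
move=> p q; rewrite /Q; case E: (lam p) => [u|//] /andP[cu vu]; case E': (lam q) => [u'|//] /andP[cu' vu'].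
rewrite (cst p u) ?off_comp // (cst q u') ?off_comp //.
have : connect (off_adj X) u u' by apply: connect_trans vu'; rewrite sym.
move=> /connectP[s ps ->]; elim: s u cu ps {E vu} => //= w s IH u cu /andP[uw ps].
rewrite (cst2 u w) //; apply: IH => //; have /and3P[a _ _] := uw; exact: connect_trans cu (connect1 a).
Qed.

End Separator.

(** * Shortest paths *)

Section Metric.
Variables (R : realType) (V : finType) (G : graph V).
Implicit Types (l : {set V} -> R) (x y z w : V) (p q : seq V).

Lemma walk_nil l x : walk_length l x [::] = 0.
Proof. by rewrite /walk_length big_nil. Qed.

Lemma walk_cons l x y p : walk_length l x (y :: p) = l [set x; y]%SET + walk_length l y p.
Proof. by rewrite /walk_length /= big_cons. Qed.

Lemma walk_cat l x p q : walk_length l x (p ++ q) = walk_length l x p + walk_length l (last x p) q.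
Proof.
elim: p x => [|y p IH] x; first by rewrite walk_nil add0r.
by rewrite cat_cons !walk_cons IH addrA.
Qed.

Lemma walk_rev l x p : walk_length l (last x p) (rev (belast x p)) = walk_length l x p.
Proof.
elim: p x => [|y p IH] x; first by rewrite !walk_nil.
rewrite /= rev_cons -cats1 walk_cat IH walk_cons.
have -> : last (last y p) (rev (belast y p)) = y by case: (p) => //= z s; rewrite rev_cons last_rcons.
by rewrite walk_cons walk_nil addr0 finset.setUC addrC.
Qed.

Definition shortest l x y p := [/\ path (adj G) x p, last x p = y, uniq (x :: p) &
  forall q, path (adj G) x q -> last x q = y -> walk_length l x p <= walk_length l x q].

(** Between unconnected vertices the geodesic is empty and [gdist] is 0, not infinite; hence the
    connectedness hypotheses in symmetry and the triangle inequality. *)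
Definition geodesic l x y : seq V :=
  if pselect (exists p, shortest l x y p) is left H then projT1 (cid H) else [::].

Definition gdist l x y : R := walk_length l x (geodesic l x y).

Local Notation conn := (connect (adj G)).

Lemma path_rev x p : path (adj G) x p -> path (adj G) (last x p) (rev (belast x p)).
Proof. by rewrite rev_path; apply: sub_path => a b; rewrite adj_sym. Qed.

Lemma last_rev_belast x p : last (last x p) (rev (belast x p)) = x.
Proof. by case: p => //= y p; rewrite rev_cons last_rcons. Qed.

Lemma path_conn x p : path (adj G) x p -> conn x (last x p).
Proof. by move=> h; apply/connectP; exists p. Qed.

Lemma adj_neq x y : adj G x y -> x != y.
Proof.
by rewrite /adj => /edge_wf/andP[_]; apply: contraTneq => ->; rewrite finset.setUid cards1.
Qed.

Section Fixed.
Variable l : {set V} -> R.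
Hypothesis l_gt0 : length_function G l.
Local Notation d := (gdist l).

Lemma walk_ge0 x p : path (adj G) x p -> 0 <= walk_length l x p.
Proof.
elim: p x => [|y p IH] x /=; first by rewrite walk_nil.
by move=> /andP[xy /IH h]; rewrite walk_cons addr_ge0 // ltW // l_gt0.
Qed.

Lemma walk_gt0 x p : path (adj G) x p -> p != [::] -> 0 < walk_length l x p.
Proof.
case: p => //= y p /andP[xy /walk_ge0 h] _.
by rewrite walk_cons ltr_wpDr // l_gt0.
Qed.

Lemma uniq_subwalk x p : path (adj G) x p -> exists q, [/\ path (adj G) x q, last x q = last x p,
  uniq (x :: q) & walk_length l x q <= walk_length l x p].
Proof.
have [n] := ubnP (size p); elim: n x p => // n IH x [|y p]; first by exists [::].
rewrite /= ltnS => sz /andP[xy ps].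
have [q [q1 q2 q3 q4]] := IH y p sz ps.
have [xq|nxq] := boolP (x \in y :: q); last first.
  exists (y :: q); rewrite /= xy q1 q2; split=> //; first by rewrite nxq.
  by rewrite !walk_cons lerD2l.
case: (splitPl xq) q1 q2 q4 q3 => s1 s2 E; rewrite cat_path last_cat E walk_cat E => /andP[h1 h2] <- q4 q3.
exists s2; split=> //.
  move: q3; rewrite -cat_cons cat_uniq => /and3P[u1 u2 u3] /=; rewrite u3 andbT.
  by apply: contra u2 => xs; apply/hasP; exists x => //; rewrite -E mem_last.
rewrite walk_cons; have := walk_ge0 h1; have := l_gt0 xy; lra.
Qed.

Lemma shorter_walk x p : path (adj G) x p -> ~~ uniq (x :: p) ->
  exists q, [/\ path (adj G) x q, last x q = last x p & walk_length l x q < walk_length l x p].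
Proof.
elim: p x => // y p IH x /= /andP[xy ps]; rewrite -[~~ _]/(~~ ((x \notin y :: p) && uniq (y :: p))).
rewrite negb_and negbK => /orP[xp|nu]; last first.
  have [q [q1 q2 q3]] := IH y ps nu.
  by exists (y :: q); rewrite /= xy q1 q2 !walk_cons ltrD2l.
case: (splitPl xp) ps => s1 s2 E; rewrite cat_path last_cat walk_cons walk_cat E => /andP[h1 h2].
by exists s2; split=> //; have := walk_ge0 h1; have := l_gt0 xy; lra.
Qed.

Lemma shortest_exists x y : conn x y -> exists p, shortest l x y p.
Proof.
move=> /connectP[p0 /uniq_subwalk[p [p1 p2 p3 _]] yE]; rewrite yE -p2 {p0 yE p2 y}.
pose good (b : #|V|.-bseq V) := [&& path (adj G) x b, last x b == last x p & uniq (x :: b)].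
have size_u q : uniq (x :: q) -> (size q <= #|V|)%N.
  by move=> /card_uniqP E; rewrite ltnW //; have := max_card (mem (x :: q)); rewrite E.
have g0 : good (Bseq (size_u p p3)) by rewrite /good /= p1 eqxx.
case: (@Order.TotalTheory.arg_minP _ _ _ _ good (fun b => walk_length l x b) g0) => b /and3P[b1 /eqP b2 b3] bm.
exists b; split=> // q q1 q2.
have [q' [q1' q2' q3' q4']] := uniq_subwalk q1.
apply: le_trans q4'; apply: (bm (Bseq (size_u q' q3'))).
by rewrite /good /= q1' q2' q2 eqxx.
Qed.

Lemma geodesicP x y : conn x y -> shortest l x y (geodesic l x y).
Proof.
move=> /shortest_exists H; rewrite /geodesic; case: pselect => // H'; exact: projT2 (cid H').
Qed.

Lemma gdist_le x p : path (adj G) x p -> d x (last x p) <= walk_length l x p.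
Proof. by move=> h; have [_ _ _] := geodesicP (path_conn h); apply. Qed.

Lemma gdist_ge0 x y : 0 <= d x y.
Proof.
have [/geodesicP[h _ _ _]|nc] := boolP (conn x y); first exact: walk_ge0.
rewrite /gdist /geodesic; case: pselect => [H|_]; last by rewrite walk_nil.
by case: (cid H) => p /= [/path_conn h E _ _]; rewrite E in h; rewrite h in nc.
Qed.

Lemma gdist0 x : d x x = 0.
Proof.
apply/eqP; rewrite eq_le gdist_ge0 andbT.
by have := @gdist_le x [::] isT; rewrite walk_nil.
Qed.

Lemma gdist_leC x y : conn x y -> d y x <= d x y.
Proof.
move=> /geodesicP[h1 h2 _ _]; rewrite {2}/gdist -walk_rev h2.
by have := gdist_le (path_rev h1); rewrite last_rev_belast h2.
Qed.

Lemma conn_sym x y : conn x y = conn y x.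
Proof. exact: connect_adj_sym. Qed.

Lemma gdistC x y : conn x y -> d x y = d y x.
Proof. by move=> h; apply/eqP; rewrite eq_le !gdist_leC // conn_sym. Qed.

Lemma gdist_tri x y z : conn x y -> conn y z -> d x z <= d x y + d y z.
Proof.
move=> /geodesicP[h1 h2 _ _] /geodesicP[h3 h4 _ _].
have := @gdist_le x (geodesic l x y ++ geodesic l y z).
by rewrite cat_path last_cat h2 h1 h4 walk_cat h2; apply.
Qed.

Lemma gdist_gt0 x y : conn x y -> x != y -> 0 < d x y.
Proof.
move=> /geodesicP[h1 h2 _ _] xy; apply: walk_gt0 => //.
by apply: contraNneq xy => E; rewrite -h2 E.
Qed.

Lemma gdist_adj x y : adj G x y -> d x y <= l [set x; y]%SET.
Proof.
by move=> h; have := @gdist_le x [:: y]; rewrite /= h walk_cons walk_nil addr0; apply.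
Qed.

Lemma dist_conn x y : conn x y -> dist G l x y = (d x y)%:E.
Proof.
move=> /geodesicP[h1 h2 _ h3]; apply/eqP; rewrite eq_le; apply/andP; split.
  by apply: ereal_inf_lbound; exists (geodesic l x y).
by apply: le_ereal_inf_tmp => _ [p [p1 p2] <-]; rewrite lee_fin h3.
Qed.

Lemma dist_nconn x y : ~~ conn x y -> dist G l x y = +oo%E.
Proof.
move=> nc; apply/eqP; rewrite -leye_eq; apply: le_ereal_inf_tmp => z [p [/path_conn p1 p2] _].
by rewrite p2 (negPf nc) in p1.
Qed.

Definition between x y w := [&& conn x w, conn w y & d x w + d w y == d x y].

Lemma shortest_len x y p : shortest l x y p -> walk_length l x p = d x y.
Proof.
move=> [h1 h2 h3 h4]; have c : conn x y by rewrite -h2 path_conn.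
have [g1 g2 g3 g4] := geodesicP c.
by apply/eqP; rewrite eq_le h4 // g4.
Qed.

Lemma shortest_cat x y p1 p2 : shortest l x y (p1 ++ p2) ->
  [/\ conn x (last x p1), conn (last x p1) y, walk_length l x p1 = d x (last x p1),
      walk_length l (last x p1) p2 = d (last x p1) y & d x (last x p1) + d (last x p1) y = d x y].
Proof.
move=> sp; have E := shortest_len sp; have [h1 h2 _ _] := sp.
move: h1 h2; rewrite cat_path last_cat => /andP[h1 h2] h3.
have c1 := path_conn h1; have c2 := path_conn h2; rewrite h3 in c2.
have := gdist_le h1; have := gdist_le h2; rewrite h3.
have := gdist_tri c1 c2; rewrite -E walk_cat => ? ? ?; split=> //; lra.
Qed.

Lemma shortest_between x y p w : shortest l x y p -> w \in x :: p -> between x y w.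
Proof.
move=> sp wp; case: (splitPl wp) sp => p1 p2 <- /shortest_cat[c1 c2 _ _ E].
by rewrite /between c1 c2 E eqxx.
Qed.

(** The concatenation has length [d x y]; if a vertex were repeated, cutting out the closed part
    would give a strictly shorter walk. *)
Lemma between_cat x y w : between x y w -> shortest l x y (geodesic l x w ++ geodesic l w y).
Proof.
move=> /and3P[c1 c2 /eqP E]; have [h1 h2 _ _] := geodesicP c1; have [h3 h4 _ _] := geodesicP c2.
have hp : path (adj G) x (geodesic l x w ++ geodesic l w y) by rewrite cat_path h1 h2.
have hl : last x (geodesic l x w ++ geodesic l w y) = y by rewrite last_cat h2.
have hw : walk_length l x (geodesic l x w ++ geodesic l w y) = d x y by rewrite walk_cat h2 -E.
split=> // [|q q1 q2]; last by rewrite hw -q2 gdist_le.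
set p := _ ++ _ in hp hl hw *.
apply: contraT => nu; have [q [q1 q2]] := shorter_walk hp nu.
by rewrite ltNge hw -[in d x y]hl -q2 gdist_le.
Qed.

Lemma geodesic_between x y w : conn x y -> w \in x :: geodesic l x y -> between x y w.
Proof. by move=> c; apply: shortest_between; apply: geodesicP. Qed.

Lemma between_l x y : conn x y -> between x y x.
Proof. by move=> c; rewrite /between connect0 c gdist0 add0r eqxx. Qed.
Lemma between_r x y : conn x y -> between x y y.
Proof. by move=> c; rewrite /between connect0 c gdist0 addr0 eqxx. Qed.

Lemma between_sym x y w : between x y w = between y x w.
Proof.
suff H a b : between a b w -> between b a w by apply/idP/idP; apply: H.
move=> /and3P[c1 c2 /eqP E]; rewrite /between (conn_sym b w) (conn_sym w a) c1 c2 /=.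
have c3 := connect_trans c1 c2.
by rewrite -(gdistC c1) -(gdistC c2) -(gdistC c3) -E addrC.
Qed.

Lemma between_trans x y w z : between x y w -> between x w z -> between x y z.
Proof.
move=> /and3P[c1 c2 /eqP E] /and3P[c3 c4 /eqP F]; rewrite /between c3 (connect_trans c4 c2) /=.
have := gdist_tri c4 c2; have := gdist_tri c3 (connect_trans c4 c2).
by move=> ? ?; apply/eqP; lra.
Qed.

End Fixed.

Local Open Scope ring_scope.

Definition walk_edges x p : {set {set V}} := [set e in pairmap (fun a b => [set a; b]%SET) x p]%SET.

Lemma walk_edges_mem x p a b : path (adj G) a p -> [set x; b]%SET \in pairmap (fun a b => [set a; b]%SET) a p ->
  x \in a :: p.
Proof.
elim: p a => //= c p IH a /andP[_ ps]; rewrite inE => /orP[/eqP E|/(IH _ ps) h]; last by rewrite inE h orbT.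
have : x \in [set x; b]%SET by rewrite !inE eqxx.
by rewrite E !inE => /orP[]/eqP->; rewrite eqxx ?orbT.
Qed.

Lemma walk_edges_uniq x p : path (adj G) x p -> uniq (x :: p) -> uniq (pairmap (fun a b => [set a; b]%SET) x p).
Proof.
elim: p x => // y p IH x /andP[xy ps] /andP[xp up] /=; rewrite IH // andbT.
by apply: contra xp; apply: walk_edges_mem.
Qed.

Lemma walk_length_set l x p : path (adj G) x p -> uniq (x :: p) ->
  walk_length l x p = \sum_(e in walk_edges x p) l e.
Proof.
move=> h1 h2; rewrite /walk_length (big_uniq _ (walk_edges_uniq h1 h2)) /=.
by apply: eq_bigl => e; rewrite inE.
Qed.

Lemma mem_walk_edges x p w : p != [::] -> w \in x :: p -> exists2 e, e \in walk_edges x p & w \in e.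
Proof.
elim: p x => // y p IH x _; rewrite inE => /orP[/eqP->|wp].
  by exists [set x; y]%SET; rewrite !inE eqxx.
case: p IH wp => [|z p] IH wp.
  by move: wp; rewrite inE => /eqP->; exists [set x; y]%SET; rewrite !inE eqxx ?orbT.
have [//|e e1 e2] := IH y _ wp; exists e => //.
by move: e1; rewrite !inE /= => ->; rewrite orbT.
Qed.

Lemma walk_edges_vertex x p e w : e \in walk_edges x p -> w \in e -> w \in x :: p.
Proof.
rewrite inE; elim: p x => //= y p IH x; rewrite inE => /orP[/eqP->|h] we; last by rewrite inE (IH _ h we) orbT.
by move: we; rewrite !inE => /orP[]->; rewrite ?orbT.
Qed.

(** Powers of 2: the first element weighs 1 and the weights of the others are doubled, so the parity
    of a sum tells whether the first element is in it. *)
Lemma distinct_subset_sums (T : eqType) (s : seq T) : uniq s -> exists w : T -> nat,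
  forall A B : pred T, (\sum_(e <- s | A e) w e = \sum_(e <- s | B e) w e)%N -> {in s, A =1 B}.
Proof.
elim: s => [|e s IH] /=; first by exists (fun=> 0%N).
move=> /andP[es /IH[w wP]]; exists (fun x : T => if x == e then 1%N else (2 * w x)%N) => A B.
have S C : (\sum_(x <- e :: s | C x) (if x == e then 1 else 2 * w x) = C e + 2 * \sum_(x <- s | C x) w x)%N.
  rewrite big_cons eqxx big_distrr /=.
  rewrite (_ : \sum_(x <- s | C x) (if x == e then 1 else 2 * w x) = \sum_(x <- s | C x) 2 * w x)%N; first by case: (C e).
  rewrite [LHS]big_mkcond [RHS]big_mkcond; apply: eq_big_seq => x xs.
  by case: eqP => // xe; rewrite -xe xs in es.
rewrite !S => E; have [Ae Es] : A e = B e /\ (\sum_(x <- s | A x) w x = \sum_(x <- s | B x) w x)%N.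
  by move: E; case: (A e) (B e) => [] []; split; lia.
by move=> x; rewrite inE => /orP[/eqP->//|]; apply: wP.
Qed.

(* Shortest lt-paths are shortest l-paths, and they are unique. *)
Definition generic l (lt : {set V} -> R) := forall E1 E2 : {set {set V}},
  (\sum_(e in E1) lt e <= \sum_(e in E2) lt e -> \sum_(e in E1) l e <= \sum_(e in E2) l e) /\
  (\sum_(e in E1) lt e = \sum_(e in E2) lt e -> E1 = E2).

Lemma generic_lengths l : length_function G l ->
  exists lt : {set V} -> R, length_function G lt /\ generic l lt.
Proof.
move=> l0; have [w wP] := distinct_subset_sums (index_enum_uniq {set V}).
pose sl (E : {set {set V}}) := \sum_(e in E) l e.
(* [S] exceeds the inverse of every positive difference of two length sums, and [eta] keeps the
   perturbation of any sum below [S^-1]: strict comparisons survive, and ties are broken by [w]. *)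
pose S := 1 + \sum_(P : {set {set V}} * {set {set V}} | sl P.1 < sl P.2) (sl P.2 - sl P.1)^-1.
have S0 : 0 < S.
  by rewrite ltr_pwDl // sumr_ge0 // => P h; rewrite invr_ge0 subr_ge0 ltW.
pose W : R := 1 + (\sum_e w e)%:R.
have W0 : 0 < W by rewrite ltr_pwDl.
pose eta := (S * W)^-1; have eta0 : 0 < eta by rewrite invr_gt0 mulr_gt0.
have gap E1 E2 : sl E1 < sl E2 -> S^-1 <= sl E2 - sl E1.
  move=> h; rewrite -[leRHS]invrK lef_pV2 ?posrE ?invr_gt0 ?subr_gt0 //.
  rewrite /S (bigD1 (E1, E2)) //= addrCA lerDl addr_ge0 // sumr_ge0 // => P /andP[h' _].
  by rewrite invr_ge0 subr_ge0 ltW.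
pose lt e := l e + eta * (w e)%:R.
have sumE (E : {set {set V}}) : \sum_(e in E) lt e = sl E + eta * (\sum_(e in E) w e)%:R.
  by rewrite big_split /= natr_sum mulr_sumr.
have wW (E : {set {set V}}) : eta * (\sum_(e in E) w e)%:R < S^-1.
  rewrite /eta invfM -mulrA -[ltRHS]mulr1 ltr_pM2l ?invr_gt0 // mulrC ltr_pdivrMr // mul1r.
  apply: le_lt_trans (_ : (\sum_e w e)%:R < W); last by rewrite /W ltrDr.
  by rewrite ler_nat [leqRHS](bigID [in E]) /= leq_addr.
have wW0 (E : {set {set V}}) : 0 <= eta * (\sum_(e in E) w e)%:R :> R by rewrite mulr_ge0 // ltW.
have mono (E1 E2 : {set {set V}}) : \sum_(e in E1) lt e <= \sum_(e in E2) lt e -> sl E1 <= sl E2.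
  rewrite !sumE => h; rewrite leNgt; apply/negP => /gap.
  have := wW E2; have := wW0 E1; lra.
exists lt; split; first by move=> e eG; rewrite ltr_wpDr ?l0 // mulr_ge0 // ltW.
move=> E1 E2; split; first exact: mono.
move=> E; have El : sl E1 = sl E2 by apply/eqP; rewrite eq_le !mono // E.
move: E; rewrite !sumE El => /addrI/(mulfI (lt0r_neq0 eta0))/eqP; rewrite eqr_nat => /eqP E.
by apply/setP => e; apply: (wP [in E1] [in E2] E e (mem_index_enum e)).
Qed.

Section GenericPaths.
Variables (l lt : {set V} -> R).
Hypotheses (l_gt0 : length_function G l) (lt_gt0 : length_function G lt).
Hypothesis gen : generic l lt.

Lemma shortest_generic x y p : shortest lt x y p -> shortest l x y p.
Proof.
move=> [h1 h2 h3 h4]; split=> // q0 q01 q02.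
have [q [q1 q2 q3 q4]] := uniq_subwalk l_gt0 q01.
apply: le_trans q4; rewrite !walk_length_set //.
by apply: (gen _ _).1; rewrite -!walk_length_set // h4 // q2.
Qed.

(** The two edge sets have the same [lt]-sum, so they coincide by genericity, and the vertices of a
    nonempty path are those of its edges. *)
Lemma shortest_unique x y p q w : shortest lt x y p -> shortest lt x y q -> w \in x :: p -> w \in x :: q.
Proof.
move=> hp hq wp; have [p1 p2 p3 _] := hp; have [q1 q2 q3 _] := hq.
have E : walk_edges x p = walk_edges x q.
  by apply: (gen _ _).2; rewrite -!walk_length_set // (shortest_len lt_gt0 hp) (shortest_len lt_gt0 hq).
have [p0|np] := eqVneq p [::].
  by move: wp; rewrite p0 inE => /eqP->; rewrite inE eqxx.
by have [e e1 e2] := mem_walk_edges np wp; rewrite E in e1; apply: walk_edges_vertex e1 e2.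
Qed.

Lemma between_generic x y w : between lt x y w -> between l x y w.
Proof.
move=> h; have /and3P[c1 _ _] := h.
have sp := shortest_generic (between_cat lt_gt0 h).
apply: (shortest_between l_gt0 sp); rewrite -cat_cons mem_cat.
by have [_ E _ _] := geodesicP lt_gt0 c1; rewrite -{1}E mem_last.
Qed.

Lemma between_generic_mem x y w p : between lt x y w -> shortest lt x y p -> w \in x :: p.
Proof.
move=> h sp; have /and3P[c1 _ _] := h.
apply: shortest_unique (between_cat lt_gt0 h) sp _; rewrite -cat_cons mem_cat.
by have [_ E _ _] := geodesicP lt_gt0 c1; rewrite -{1}E mem_last.
Qed.

Lemma between_generic_chain x y w w' : between lt x y w -> between lt x y w' ->
  gdist lt x w <= gdist lt x w' -> between lt x w' w.
Proof.
move=> h h' le; have /and3P[c1 c2 _] := h; have /and3P[c1' c2' _] := h'.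
have U := shortest_unique (between_cat lt_gt0 h) (between_cat lt_gt0 h') (w := w).
have [_ E _ _] := geodesicP lt_gt0 c1; have [_ E' _ _] := geodesicP lt_gt0 c1'.
have w0 : w \in x :: geodesic lt x w ++ geodesic lt w y.
  by rewrite -cat_cons mem_cat -{1}E mem_last.
move: (U w0); rewrite -cat_cons mem_cat => /orP[|ws]; first exact: geodesic_between.
have /(geodesic_between lt_gt0 c2')/and3P[c3 c4 /eqP E2] : w \in w' :: geodesic lt w' y by rewrite inE ws orbT.
have [-> |ne] := eqVneq w' w; first by rewrite between_r // -?E //.
have := gdist_gt0 lt_gt0 c3 ne; move: h h' => /and3P[_ _ /eqP F] /and3P[_ _ /eqP F'].
move: le E2 F F'; lra.
Qed.

Lemma between_chain_dist x y w w' : between lt x y w -> between lt x y w' ->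
  gdist lt x w <= gdist lt x w' -> gdist l x w + gdist l w w' = gdist l x w'.
Proof. by move=> h h' /(between_generic_chain h h')/between_generic/and3P[_ _ /eqP]. Qed.

End GenericPaths.

End Metric.

(** * Minors from connected fibres *)

Section Retraction.
Variables (V : finType) (T : {set V}) (G0 : graph V).
Implicit Types (G H : graph V) (K U : {set V}) (f : V -> V).

Definition fibre_adj G U f : rel V := [rel a b | [&& adj G a b, a \in U, b \in U & f a == f b]].

Lemma connect_hom (V1 V2 : finType) (e : rel V1) (e' : rel V2) (m : V1 -> V2) :
  (forall a b, e a b -> m a = m b \/ e' (m a) (m b)) ->
  forall x y, connect e x y -> connect e' (m x) (m y).
Proof.
move=> h x y /connectP[p + ->]; elim: p x => //= z p IH x /andP[xz /IH c].
by apply: connect_trans c; case: (h _ _ xz) => [->|/connect1].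
Qed.

Lemma adj_verts G x y : adj G x y -> x \in verts G /\ y \in verts G.
Proof.
by rewrite /adj => /edge_wf/andP[/fintype.subsetP h _]; split; apply: h; rewrite !inE eqxx ?orbT.
Qed.

Lemma connect_verts G x y : connect (adj G) x y -> x \in verts G -> y \in verts G.
Proof.
by move=> /connectP[p + ->]; elim: p x => //= z p IH x /andP[/adj_verts[_ h] ps] _; apply: IH.
Qed.

Lemma adj_del_vertex G v x y : adj (del_vertex G v) x y = [&& adj G x y, v != x & v != y].
Proof. by rewrite /adj inE !inE negb_or. Qed.

Lemma adj_contract G u v (uv : [set u; v]%SET \in edges G) x y :
  adj (contract_edge uv) x y <->
  x <> y /\ exists a b, [/\ adj G a b, merge_vertex u v a = x & merge_vertex u v b = y].
Proof.
split=> [h|[/eqP xy [a [b [ab ma mb]]]]].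
  have xy := adj_neq h; split; first exact/eqP.
  move: h; rewrite /adj /= inE => /andP[/imsetP[e eG E] _].
  have /andP[_ /cards2P[a [b [ab eE]]]] := edge_wf eG.
  have : [set x; y]%SET = [set merge_vertex u v a; merge_vertex u v b]%SET.
    by rewrite E eE imsetU1 imset_set1.
  move=> E2; have : x \in [set merge_vertex u v a; merge_vertex u v b]%SET by rewrite -E2 !inE eqxx.
  have : y \in [set merge_vertex u v a; merge_vertex u v b]%SET by rewrite -E2 !inE eqxx orbT.
  rewrite !inE => /orP[]/eqP hy /orP[]/eqP hx; try by rewrite hx hy eqxx in xy.
    by exists b, a; rewrite /adj finset.setUC -eE.
  by exists a, b; rewrite /adj -eE.
rewrite /adj /= inE; apply/andP; split; last by rewrite cards2 xy.
by apply/imsetP; exists [set a; b]%SET; rewrite // imsetU1 imset_set1 -ma -mb.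
Qed.

(** Induction on the number of vertices. Vertices outside [U] are deleted; then a vertex outside [K]
    is contracted into a neighbour in its fibre, which exists because the vertex is joined within
    the fibre to its image in [K]. The contracted vertex loses its name, so those of [K] survive. *)
Lemma retraction_minor G K U f : minor T G0 G -> T \subset K -> K \subset U -> U \subset verts G ->
  (forall v, v \in U -> f v \in K) -> (forall c, c \in K -> f c = c) ->
  (forall v, v \in U -> connect (fibre_adj G U f) v (f v)) ->
  exists H, [/\ minor T G0 H, verts H = K & forall c c', adj H c c' <->
    c <> c' /\ exists u v, [/\ u \in U, v \in U, f u = c, f v = c' & adj G u v]].
Proof.
have [n] := ubnP #|verts G|; elim: n G U => // n IH G U szn mG TK KU UG fK fid conn.
have subE (A B : {set V}) x : A \subset B -> x \in A -> x \in B by move/fintype.subsetP; apply.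
have [/subsetPn[v vG vU]|/negbNE GU] := boolP (~~ (verts G \subset U)).
  have vT : v \notin T by apply: contra vU => /(subE _ _ _ TK)/(subE _ _ _ KU).
  have sz' : (#|verts (del_vertex G v)| < n)%N.
    by move: szn; rewrite (cardsD1 v) vG.
  have neU w : w \in U -> v != w by move=> wU; apply: contraNneq vU => ->.
  have UG' : U \subset verts (del_vertex G v).
    apply/fintype.subsetP => w wU; rewrite /= !inE eq_sym neU //=; exact: subE wU.
  have [|H [h1 h2 h3]] := IH _ _ sz' (minor_del_vertex mG vG vT) TK KU UG' fK fid.
    move=> w /conn; apply: (@connect_hom _ _ _ _ id) => a b /and4P[ab aU bU fab]; right.
    by rewrite /fibre_adj /= adj_del_vertex ab aU bU fab !neU.
  exists H; split=> // c c'; rewrite h3; split=> -[cc [a [b [aU bU fa fb ab]]]]; split=> //; exists a, b; split=> //.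
    by move: ab; rewrite adj_del_vertex => /and3P[].
  by rewrite adj_del_vertex ab !neU.
have EU : U = verts G by apply/eqP; rewrite finset.eqEsubset UG.
have [/subsetPn[v vU vK]|/negbNE UK] := boolP (~~ (U \subset K)); last first.
  have EK : U = K by apply/eqP; rewrite finset.eqEsubset UK.
  exists G; split; rewrite -?EU // => c c'; split.
    move=> cc; have [h1 h2] := adj_verts cc; split; first by apply/eqP; apply: adj_neq cc.
    by exists c, c'; rewrite EU h1 h2 !fid // -EK EU.
  by move=> [_ [u [w [uU wU <- <- uw]]]]; rewrite !fid // -EK.
have [v' vv'] : exists v', fibre_adj G U f v v'.
  have /connectP[[|v' p] /=] := conn v vU; last by move=> /andP[h _] _; exists v'.
  by move=> _ E; move: vK; rewrite -E fK.
have /and4P[av _ v'U /eqP fv] := vv'.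
have vT : v \notin T by apply: contra vK; apply: subE.
pose m := merge_vertex v v'.
have v'v : v' != v by rewrite eq_sym; apply: adj_neq av.
have mU a : a \in U -> m a \in U :\ v.
  by move=> aU; rewrite /m /merge_vertex; case: eqP => [_|/eqP ne]; rewrite !inE ?v'U ?v'v ?ne.
have fm a : f (m a) = f a.
  by rewrite /m /merge_vertex; case: eqP => // ->.
have mK c : c \in K -> m c = c.
  by rewrite /m /merge_vertex; case: eqP => // ->; rewrite (negPf vK).
pose G' := contract_edge av.
have szG' : (#|verts G'| < n)%N by move: szn; rewrite /G' /= -EU (cardsD1 v) vU.
have KU' : K \subset U :\ v by rewrite finset.subsetD1 KU vK.
have UG' : U :\ v \subset verts G' by rewrite EU.
have fK' w : w \in U :\ v -> f w \in K by rewrite inE => /andP[_ /fK].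
have [|H [h1 h2 h3]] := IH G' (U :\ v)%SET szG' (minor_contract av mG vT) TK KU' UG' fK' fid.
  move=> w; rewrite !inE => /andP[wv wU].
  have mw : m w = w by rewrite /m /merge_vertex (negPf wv).
  suff : connect (fibre_adj G' (U :\ v)%SET f) (m w) (m (f w)) by rewrite mw (mK _ (fK _ wU)).
  move: (conn w wU); apply: connect_hom => a b /and4P[ab aU bU fab].
  have [->|ne] := eqVneq (m a) (m b); [by left | right].
  rewrite /fibre_adj /= !mU // !fm fab !andbT.
  by apply/adj_contract; split; [apply/eqP | exists a, b].
exists H; split=> // c c'; rewrite h3; split=> -[cc [a [b [aU bU fa fb ab]]]]; split=> //.
  have /adj_contract[_ [a' [b' [ab' ma mb]]]] := ab; have [] := adj_verts ab'; rewrite -EU => a'U b'U.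
  by exists a', b'; rewrite -(fm a') -(fm b') /m ma mb.
exists (m a), (m b); rewrite !mU // !fm; split=> //.
apply/adj_contract; split; last by exists a, b.
by move=> E; apply: cc; rewrite -fa -fb -(fm a) -(fm b) E.
Qed.

End Retraction.

Section RetractionMetric.
Variables (R : realType) (V : finType) (G : graph V) (l : {set V} -> R).
Hypothesis l_gt0 : length_function G l.
Local Notation conn := (connect (adj G)).

Lemma dist_ge0 x y : (0 <= dist G l x y)%E.
Proof.
have [c|nc] := boolP (conn x y); last by rewrite dist_nconn // leey.
by rewrite dist_conn // lee_fin gdist_ge0.
Qed.

Lemma dist_refl x : dist G l x x = 0%E.
Proof. by rewrite dist_conn ?connect0 // gdist0. Qed.

Lemma dist_tri x y z : (dist G l x z <= dist G l x y + dist G l y z)%E.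
Proof.
have ny a b : dist G l a b != -oo%E by rewrite gt_eqF // (lt_le_trans _ (dist_ge0 a b)) // ltNy0.
have [c1|nc] := boolP (conn x y); last by rewrite [dist G l x y]dist_nconn // addye // leey.
have [c2|nc] := boolP (conn y z); last by rewrite [dist G l y z]dist_nconn // addey // leey.
by rewrite !dist_conn // ?(connect_trans c1) // -EFinD lee_fin gdist_tri.
Qed.

(** An edge of the minor gets the distance in [G] of its ends. The halved double sum avoids ordering
    them, and its diagonal terms vanish. *)
Definition metric_length (e : {set V}) : R := (\sum_(x in e) \sum_(y in e) gdist G l x y) / 2.

Lemma metric_length2 x y : x != y -> conn x y -> metric_length [set x; y]%SET = gdist G l x y.
Proof.
move=> xy c; have S F : \sum_(z in [set x; y]%SET) F z = F x + F y :> R.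
  by rewrite big_setU1 ?inE //= big_set1.
rewrite /metric_length !S !gdist0 // add0r addr0.
have -> : gdist G l y x = gdist G l x y by apply/esym/gdistC.
by field.
Qed.

(** Distances do not shrink, by the triangle inequality in [G] along a path of the minor, each of
    whose edges is as long as the distance it spans. *)
Lemma retraction_DAM (T K U : {set V}) (f : V -> V) : T \subset K -> K \subset U -> U \subset verts G ->
  (forall v, v \in U -> f v \in K) -> (forall c, c \in K -> f c = c) ->
  (forall v, v \in U -> connect (fibre_adj G U f) v (f v)) ->
  exists H l', [/\ minor T G H, verts H = K, length_function H l',
    forall t t', (dist G l t t' <= dist H l' t t')%E &
    forall u v, u \in U -> v \in U -> adj G u v ->
      (dist H l' (f u) (f v) <= (gdist G l (f u) (f v))%:E)%E].
Proof.
move=> TK KU UG fK fid cf.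
have [H [h1 h2 h3]] := retraction_minor (minor_refl T G) TK KU UG fK fid cf.
have cfib v : v \in U -> conn v (f v).
  move=> /cf; apply: (@connect_hom _ _ _ _ id) => a b /and4P[ab _ _ _]; by right.
have adjc c c' : adj H c c' -> conn c c'.
  move=> /h3[_ [u [v [uU vU <- <- uv]]]].
  by apply: connect_trans (cfib v vU); apply: connect_trans (connect1 uv); rewrite conn_sym cfib.
have l'0 : length_function H metric_length.
  move=> e eH; have /andP[_ /cards2P[a [b [ab E]]]] := edge_wf eH.
  have ca : conn a b by apply: adjc; rewrite /adj -E.
  by rewrite E metric_length2 // gdist_gt0.
exists H, metric_length; split=> //.
  move=> t t'; have [c|nc] := boolP (connect (adj H) t t'); last by rewrite [leRHS]dist_nconn // leey.
  have W p x : path (adj H) x p -> (dist G l x (last x p) <= (walk_length metric_length x p)%:E)%E.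
    elim: p x => [|y p IH] x /=; first by rewrite dist_refl walk_nil.
    move=> /andP[xy ps]; rewrite walk_cons EFinD.
    apply: le_trans (dist_tri x y _) _; apply: leeD; last exact: IH.
    by rewrite dist_conn ?adjc // lee_fin metric_length2 ?adjc // (adj_neq xy).
  have [p1 p2 _ _] := geodesicP l'0 c.
  by rewrite [leRHS]dist_conn // /gdist -{1}p2 W.
move=> u v uU vU uv; have [->|ne] := eqVneq (f u) (f v).
  by rewrite dist_conn ?connect0 // lee_fin gdist0 // gdist_ge0.
have a : adj H (f u) (f v) by apply/h3; split; [apply/eqP | exists u, v].
rewrite dist_conn ?connect1 // lee_fin -metric_length2 ?adjc //.
exact: gdist_adj.
Qed.

End RetractionMetric.

(** * Networks of unique shortest paths *)

Section PathNetwork.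
Variables (R : realType) (V : finType) (G : graph V) (l lt : {set V} -> R).
Hypotheses (l_gt0 : length_function G l) (lt_gt0 : length_function G lt).
Hypothesis gen : generic l lt.
Local Notation conn := (connect (adj G)).
Local Notation dt := (gdist G lt).
Implicit Types (u v w x y z c : V) (i j : V * V).

Definition on_path i v := between G lt i.1 i.2 v.

Lemma between_eq x w w' : between G lt x w' w -> dt x w = dt x w' -> w = w'.
Proof.
move=> /and3P[_ c /eqP E] E'; apply/eqP; apply: contraT => ne.
have := gdist_gt0 lt_gt0 c ne; move: E E'; lra.
Qed.

Lemma on_chain i u v : on_path i u -> on_path i v -> dt i.1 u <= dt i.1 v -> between G lt i.1 v u.
Proof. exact: between_generic_chain. Qed.

Lemma on_between i u v w : on_path i u -> on_path i v -> on_path i w ->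
  dt i.1 u <= dt i.1 w -> dt i.1 w <= dt i.1 v -> between G lt u v w.
Proof.
move=> iu iv iw h1 h2.
have /and3P[_ _ /eqP E1] := on_chain iu iv (le_trans h1 h2).
have /and3P[_ c2 /eqP E2] := on_chain iu iw h1.
have /and3P[_ c3 /eqP E3] := on_chain iw iv h2.
by rewrite /between c2 c3; apply/eqP; move: E1 E2 E3; clear; lra.
Qed.

Lemma on_convex i u v w : on_path i u -> on_path i v -> between G lt u v w ->
  dt i.1 u <= dt i.1 v -> [/\ on_path i w, dt i.1 u <= dt i.1 w & dt i.1 w <= dt i.1 v].
Proof.
move=> iu iv /and3P[c1 c2 /eqP E] h.
have /and3P[b1 b2 /eqP E1] := on_chain iu iv h; have /and3P[b3 b4 /eqP E2] := iv.
have t1 := gdist_tri lt_gt0 b1 c1; have t2 := gdist_tri lt_gt0 c2 b4.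
have t3 := gdist_tri lt_gt0 (connect_trans b1 c1) (connect_trans c2 b4).
have t4 := gdist_ge0 lt_gt0 u w; have t5 := gdist_ge0 lt_gt0 w v.
split; [|by move: E E1 E2 t1 t2 t3 t4 t5; clear; lra|by move: E E1 E2 t1 t2 t3 t4 t5; clear; lra].
rewrite /on_path /between (connect_trans b1 c1) (connect_trans c2 b4); apply/eqP.
by move: E E1 E2 t1 t2 t3 t4 t5; clear; lra.
Qed.

(** An edge may be longer than the distance of its ends. This singles out the edges that occur in
    shortest [lt]-paths, see [shortest_sub]. *)
Definition link u v := adj G u v && [forall w, between G lt u v w ==> ((w == u) || (w == v))].

Lemma link_sym u v : link u v = link v u.
Proof.
suff H a b : link a b -> link b a by apply/idP/idP; apply: H.
move=> /andP[ab /forallP h]; rewrite /link adj_sym ab; apply/forallP => w.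
by rewrite between_sym // orbC.
Qed.

Lemma link_on i u v w : link u v -> on_path i u -> on_path i v -> on_path i w ->
  dt i.1 u <= dt i.1 w -> dt i.1 w <= dt i.1 v -> w = u \/ w = v.
Proof.
move=> /andP[_ /forallP/(_ w)/implyP h] iu iv iw h1 h2.
by case/orP: (h (on_between iu iv iw h1 h2)) => /eqP->; [left|right].
Qed.

Lemma shortest_sub x y p1 a b p2 : shortest G lt x y (p1 ++ b :: p2) -> last x p1 = a -> link a b.
Proof.
move=> sp E; have [h1 h2 h3 h4] := sp.
move: h1; rewrite cat_path E => /andP[h1 /= /andP[ab h5]].
rewrite /link ab; apply/forallP => w; apply/implyP => bw.
have sab : shortest G lt a b [:: b].
  split; rewrite /= ?ab ?andbT ?inE ?(adj_neq ab) // => q q1 q2.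
  have [q' q'1 q'2] : exists2 q', path (adj G) x q' & last x q' = y /\
      walk_length lt x q' = walk_length lt x p1 + (walk_length lt a q + walk_length lt b p2).
    exists (p1 ++ (q ++ p2)); first by rewrite !cat_path h1 E q1 q2 h5.
    by rewrite !last_cat !walk_cat E q2 -h2 last_cat.
  have [q'3 q'4] := q'2; have := h4 q' q'1 q'3.
  rewrite q'4 walk_cat E walk_cons walk_cons walk_nil; clear; lra.
by have := between_generic_mem lt_gt0 gen bw sab; rewrite !inE.
Qed.

Variables (K0 : {set V}) (P : seq (V * V)).
Hypothesis P_conn : forall i, i \in P -> conn i.1 i.2.

(** The default [i.1], for disjoint paths, keeps [kept] inside the graph; the case [j = i] puts the
    ends of path [i] into it. *)
Definition meet_first i j : V := odflt i.1 [pick v | [&& on_path i v, on_path j v &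
  [forall w, on_path i w && on_path j w ==> (dt i.1 v <= dt i.1 w)]]].
Definition meet_last i j : V := odflt i.1 [pick v | [&& on_path i v, on_path j v &
  [forall w, on_path i w && on_path j w ==> (dt i.1 w <= dt i.1 v)]]].

Lemma meet_firstP i j v : on_path i v -> on_path j v ->
  [/\ on_path i (meet_first i j), on_path j (meet_first i j) & dt i.1 (meet_first i j) <= dt i.1 v].
Proof.
move=> iv jv; rewrite /meet_first; case: pickP => [w /and3P[h1 h2 /forallP h3]|no] /=.
  by split=> //; move: (h3 v); rewrite iv jv.
have /= := @Order.TotalTheory.arg_minP _ _ _ v (fun w => on_path i w && on_path j w) (dt i.1).
rewrite iv jv => /(_ isT)[w /andP[h1 h2] h3]; move: (no w); rewrite h1 h2 /=.
by move=> /negP; case; apply/forallP => w'; apply/implyP => /h3.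
Qed.

Lemma meet_lastP i j v : on_path i v -> on_path j v ->
  [/\ on_path i (meet_last i j), on_path j (meet_last i j) & dt i.1 v <= dt i.1 (meet_last i j)].
Proof.
move=> iv jv; rewrite /meet_last; case: pickP => [w /and3P[h1 h2 /forallP h3]|no] /=.
  by split=> //; move: (h3 v); rewrite iv jv.
have /= := @Order.TotalTheory.arg_maxP _ _ _ v (fun w => on_path i w && on_path j w) (dt i.1).
rewrite iv jv => /(_ isT)[w /andP[h1 h2] h3]; move: (no w); rewrite h1 h2 /=.
by move=> /negP; case; apply/forallP => w'; apply/implyP => /h3.
Qed.

Definition kept : {set V} := K0 :|: [set v in
  [seq meet_first i j | i <- P, j <- P] ++ [seq meet_last i j | i <- P, j <- P]]%SET.

Lemma card_kept : (#|kept| <= #|K0| + 2 * size P ^ 2)%N.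
Proof.
apply: leq_trans (leq_card_setU _ _) _; rewrite leq_add2l cardsE.
by apply: leq_trans (card_size _) _; rewrite size_cat !size_allpairs mulnn addnn mul2n.
Qed.

Lemma meet_kept i j : i \in P -> j \in P -> meet_first i j \in kept /\ meet_last i j \in kept.
Proof.
move=> iP jP; rewrite /kept; split; rewrite !inE mem_cat; apply/orP; right; apply/orP; [left|right];
  by apply/allpairsP; exists (i, j).
Qed.

Lemma ends_kept i : i \in P -> i.1 \in kept /\ i.2 \in kept.
Proof.
move=> iP; have c := P_conn iP; have [k1 k2] := meet_kept iP iP.
have o1 : on_path i i.1 by apply: between_l.
have o2 : on_path i i.2 by apply: between_r.
have [h1 _] := meet_firstP o1 o1; have [h2 _] := meet_lastP o2 o2.
rewrite gdist0 // => h3 h4; split.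
  rewrite -(_ : meet_first i i = i.1) //; apply/esym/(@between_eq i.1).
    by apply: on_chain => //; rewrite gdist0 ?gdist_ge0.
  by apply/eqP; rewrite eq_le gdist0 // h4 gdist_ge0.
rewrite -(_ : meet_last i i = i.2) //; apply: (@between_eq i.1); first exact: h2.
apply/eqP; rewrite eq_le h3 andbT; have /and3P[_ _ /eqP E] := h2.
by have := gdist_ge0 lt_gt0 (meet_last i i) i.2; lra.
Qed.

Definition network_adj u v := link u v && has (fun i => on_path i u && on_path i v) P.

Lemma network_adj_sym u v : network_adj u v = network_adj v u.
Proof. by rewrite /network_adj link_sym; congr andb; apply: eq_has => i; rewrite andbC. Qed.

(* Two unique shortest paths meet in a common subpath. *)
Lemma network_adj_on j u v : j \in P -> u \notin kept -> on_path j u -> network_adj u v -> on_path j v.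
Proof.
move=> jP uK ju /andP[lk /hasP[i iP /andP[iu iv]]].
have [k1 k2] := meet_kept iP jP.
have [h1 h2 h3] := meet_firstP iu ju; have [h4 h5 h6] := meet_lastP iu ju.
have lk' : link v u by rewrite link_sym.
have [h|/ltW h] := leP (dt i.1 (meet_first i j)) (dt i.1 v); last first.
  have [E|E] := link_on lk' iv iu h1 h h3; last by rewrite -E k1 in uK.
  by rewrite -E.
have [h'|/ltW h'] := leP (dt i.1 v) (dt i.1 (meet_last i j)); last first.
  have [E|E] := link_on lk iu iv h4 h6 h'; first by rewrite -E k2 in uK.
  by rewrite -E.
have b := on_between h1 h4 iv h h'.
have [hj|/ltW hj] := leP (dt j.1 (meet_first i j)) (dt j.1 (meet_last i j)).
  by have [] := on_convex h2 h5 b hj.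
by rewrite between_sym // in b; have [] := on_convex h5 h2 b hj.
Qed.

Definition inner_adj : rel V := [rel u v | [&& network_adj u v, u \notin kept & v \notin kept]].

(** A component of network vertices outside [kept] goes to one of its kept neighbours. The picked
    vertex depends only on the component, which makes the fibres connected. *)
Definition collapse v := if v \in kept then v else
  odflt v [pick c in kept | [exists w, connect inner_adj v w && network_adj w c]].

Lemma inner_sym : connect_sym inner_adj.
Proof.
by apply: sym_connect_sym => u v; apply/and3P/and3P => -[a b c]; split; rewrite // network_adj_sym.
Qed.

Lemma collapse_pick u c w : u \notin kept -> c \in kept -> connect inner_adj u w -> network_adj w c ->
  (collapse u \in kept /\ exists2 w', connect inner_adj u w' & network_adj w' (collapse u)) /\
  forall v, v \notin kept -> connect inner_adj u v -> collapse v = collapse u.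
Proof.
move=> uK cK uw wc; have ex : (c \in kept) && [exists w, connect inner_adj u w && network_adj w c].
  by rewrite cK; apply/existsP; exists w; rewrite uw.
split.
  rewrite /collapse (negPf uK); case: pickP => [x /andP[xK /existsP[w' /andP[uw' w'x]]]|/(_ c)] /=.
    by split=> //; exists w'.
  by rewrite ex.
move=> v vK uv; rewrite /collapse (negPf uK) (negPf vK).
have E x : (x \in kept) && [exists w, connect inner_adj v w && network_adj w x] =
     (x \in kept) && [exists w, connect inner_adj u w && network_adj w x].
  by congr andb; apply: eq_existsb => z; rewrite (same_connect inner_sym uv).
by rewrite (eq_pick E); case: pickP => // /(_ c); rewrite ex.
Qed.

Section Segment.
Variables (i : V * V) (c c' : V).
Hypotheses (iP : i \in P) (cK : c \in kept) (c'K : c' \in kept) (ic : on_path i c) (ic' : on_path i c').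
Hypothesis cc' : dt i.1 c < dt i.1 c'.
Hypothesis gap : forall w, w \in kept -> on_path i w -> dt i.1 c <= dt i.1 w -> dt i.1 w <= dt i.1 c' ->
  w = c \/ w = c'.

Let inside u := [&& on_path i u, dt i.1 c < dt i.1 u & dt i.1 u < dt i.1 c'].

Lemma inside_notin u : inside u -> u \notin kept.
Proof.
move=> /and3P[iu h1 h2]; apply/negP => uK.
by case: (gap uK iu (ltW h1) (ltW h2)) => E; move: h1 h2; rewrite E ltxx.
Qed.

(** By [network_adj_on] no path of the network branches off between two consecutive kept vertices,
    so nothing outside the segment belongs to the component of its interior. *)
Lemma inside_link u v : inside u -> network_adj u v -> v = c \/ v = c' \/ inside v.
Proof.
move=> su uv; have uK := inside_notin su; have /and3P[iu h1 h2] := su.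
have iv := network_adj_on iP uK iu uv; have /andP[lk _] := uv.
have lk' : link v u by rewrite link_sym.
have [h3|h3] := ltP (dt i.1 c) (dt i.1 v); last first.
  by have [->|E] := link_on lk' iv iu ic h3 (ltW h1); [left | move: uK; rewrite -E cK].
have [h4|h4] := ltP (dt i.1 v) (dt i.1 c'); last first.
  by have [E|->] := link_on lk iu iv ic' (ltW h2) h4; [move: uK; rewrite -E c'K | right; left].
by right; right; rewrite /inside iv h3 h4.
Qed.

Lemma inside_connect u v : inside u -> connect inner_adj u v -> inside v.
Proof.
move=> + /connectP[p + ->]; elim: p u => //= z p IH u su /andP[/and3P[uz _ zK] ps].
apply: IH ps; case: (inside_link su uz) => [E|[E|//]]; by move: zK; rewrite E ?cK ?c'K.
Qed.

(** The [lt]-geodesic from [c] to [c'] is a chain of links that passes through every vertex inside,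
    so the interior is connected. *)
Lemma segment_walk : link c c' \/ exists w w', [/\ inside w, inside w', network_adj w c, network_adj w' c' &
  forall u, inside u -> connect inner_adj w u].
Proof.
have b := on_chain ic ic' (ltW cc').
have /and3P[_ ccon _] := b.
have sp := geodesicP lt_gt0 ccon; have [p1 p2 p3 _] := sp.
have ins u : u \in geodesic G lt c c' -> u = c' \/ inside u.
  move=> ug; have uc : u != c by apply: contraTneq ug => ->; case/andP: p3.
  have [->|uc'] := eqVneq u c'; [by left | right].
  have bu : between G lt c c' u by apply: geodesic_between; rewrite // inE ug orbT.
  have [iu h1 h2] := on_convex ic ic' bu (ltW cc').
  rewrite /inside iu !lt_neqAle h1 h2 !andbT /=; apply/andP; split.
    by apply: contraNneq uc => E; apply/eqP/esym; apply: (between_eq (on_chain ic iu h1) E).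
  by apply: contraNneq uc' => E; apply/eqP; apply: (between_eq (on_chain iu ic' h2) E).
have mem u : inside u -> u \in geodesic G lt c c'.
  move=> /and3P[iu h1 h2]; have bu := on_between ic ic' iu (ltW h1) (ltW h2).
  have := between_generic_mem lt_gt0 gen bu sp; rewrite inE => /orP[/eqP E|//].
  by move: h1; rewrite E ltxx.
case: (lastP (geodesic G lt c c')) sp p1 p2 p3 ins mem => [|r z] sp p1 p2 p3 ins mem.
  by move: cc'; rewrite -p2 ltxx.
have zc' : z = c' by move: p2; rewrite last_rcons.
rewrite {z p2}zc' in sp p1 p3 ins mem *.
case: r sp p1 p3 ins mem => [|w r] sp p1 p3 ins mem.
  by left; apply: (@shortest_sub c c' [::] c c' [::]).
have c'r : c' \notin w :: r by have := p3; rewrite cons_uniq rcons_uniq => /and3P[].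
have inr u : u \in w :: r -> inside u.
  move=> ur; have um : u \in rcons (w :: r) c' by rewrite mem_rcons inE ur orbT.
  by case: (ins u um) => // E; move: c'r; rewrite -E ur.
have lnk p1' a b' p2' : w :: rcons r c' = p1' ++ b' :: p2' -> last c p1' = a -> link a b'.
  by move=> E; apply: (@shortest_sub c c' _ _ _ p2'); rewrite -E.
have nadj a b' : link a b' -> on_path i a -> on_path i b' -> network_adj a b'.
  by move=> h h1 h2; rewrite /network_adj h; apply/hasP; exists i; rewrite // h1 h2.
have on u : inside u -> on_path i u by case/and3P.
right; exists w, (last w r); split.
- by apply: inr; rewrite inE eqxx.
- by apply: inr; apply: mem_last.
- rewrite network_adj_sym; apply: nadj => //; first exact: (@lnk [::] c w (rcons r c')).
  by apply/on/inr; rewrite inE eqxx.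
- apply: nadj => //; last by apply/on/inr/mem_last.
  by apply: (@lnk (w :: r) _ c' [::]); rewrite // cats1.
move=> u su; have := mem u su; rewrite mem_rcons inE => /orP[/eqP E|ur].
  by have /and3P[_ _] := su; rewrite E ltxx.
case: (splitPl ur) inr lnk => s1 s2 <- inr lnk; apply/connectP; exists s1 => //.
have : forall q1 q2, s1 = q1 ++ q2 -> path inner_adj (last w q1) q2.
  move=> q1 q2; elim: q2 q1 => // b' q2 IH q1 E; rewrite /= -(last_rcons w q1 b') IH ?cat_rcons // andbT.
  rewrite last_rcons; have h1 : inside (last w q1).
    apply: inr; rewrite E -catA -cat_cons mem_cat mem_last //.
  have h2 : inside b' by apply: inr; rewrite E inE -!catA mem_cat /= !inE eqxx ?orbT.
  rewrite /inner_adj /= !inside_notin // !andbT; apply: nadj; rewrite ?on //.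
  by apply: (@lnk (w :: q1) _ b' (q2 ++ rcons s2 c')); rewrite // E rcons_cat -!catA.
by move=> /(_ [::] s1 erefl).
Qed.

(** The interior collapses to a single vertex, which can only be [c] or [c']; the end edge on the
    other side then becomes an edge between [c] and [c'] in the minor. *)
Lemma segment_collapse : link c c' \/ exists w w', [/\ link c w, link w' c', collapse w = collapse w',
  inside w /\ inside w' & collapse w = c \/ collapse w = c'].
Proof.
have [|[w [w' [s1 s2 a1 a2 h]]]] := segment_walk; [by left | right].
exists w, w'; have /andP[l1 _] := a1; have /andP[l2 _] := a2.
have [[k1 [z wz zk]] k2] := collapse_pick (inside_notin s1) cK (connect0 _ _) a1.
split=> //; first by rewrite link_sym.
  by rewrite k2 ?inside_notin // h.
case: (inside_link (inside_connect s1 wz) zk) => [->|[->|]]; [by left|by right|].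
by move=> /inside_notin; rewrite k1.
Qed.

End Segment.

Lemma bracket i u : i \in P -> on_path i u -> u \notin kept -> exists c c',
  [/\ c \in kept /\ c' \in kept, on_path i c, on_path i c', dt i.1 c < dt i.1 u < dt i.1 c' &
  forall w, w \in kept -> on_path i w -> dt i.1 c <= dt i.1 w -> dt i.1 w <= dt i.1 c' -> w = c \/ w = c'].
Proof.
move=> iP iu uK; have [k1 k2] := ends_kept iP; have con := P_conn iP.
have o1 : on_path i i.1 by apply: between_l.
have o2 : on_path i i.2 by apply: between_r.
have le2 : dt i.1 u <= dt i.1 i.2.
  by have /and3P[_ _ /eqP <-] := iu; rewrite lerDl gdist_ge0.
have neq w : w \in kept -> on_path i w -> dt i.1 w != dt i.1 u.
  move=> wK iw; apply: contraNneq uK => E.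
  by rewrite -(between_eq (on_chain iw iu _) E) // E.
have /= := @Order.TotalTheory.arg_maxP _ _ _ i.1 (fun w => [&& w \in kept, on_path i w & dt i.1 w <= dt i.1 u]) (dt i.1).
rewrite k1 o1 gdist0 // gdist_ge0 // => /(_ isT)[c /and3P[c1 c2 c3] cm].
have /= := @Order.TotalTheory.arg_minP _ _ _ i.2 (fun w => [&& w \in kept, on_path i w & dt i.1 u <= dt i.1 w]) (dt i.1).
rewrite k2 o2 le2 => /(_ isT)[c' /and3P[c1' c2' c3'] cm'].
exists c, c'; split=> //; first by rewrite !lt_neqAle c3 c3' neq // eq_sym neq.
move=> w wK iw h1 h2; have [h|/ltW h] := leP (dt i.1 w) (dt i.1 u).
  left; have h3 : dt i.1 w <= dt i.1 c by apply: cm; rewrite wK iw.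
  by apply/esym/(between_eq (on_chain c2 iw h1))/eqP; rewrite eq_le h1 h3.
right; have h3 : dt i.1 c' <= dt i.1 w by apply: cm'; rewrite wK iw.
by apply: (between_eq (on_chain iw c2' h2)); apply/eqP; rewrite eq_le h2 h3.
Qed.

Hypothesis K0_verts : K0 \subset verts G.
Hypothesis P_verts : forall i, i \in P -> i.1 \in verts G.

Lemma path_network_DAM (T : {set V}) : T \subset K0 -> exists H l',
  [/\ minor T G H, length_function H l', (K0 \subset verts H) && (#|verts H| <= #|K0| + 2 * size P ^ 2)%N,
     forall t t', (dist G l t t' <= dist H l' t t')%E &
     forall i c c', i \in P -> c \in K0 -> c' \in K0 -> on_path i c -> on_path i c' ->
       (dist H l' c c' <= (gdist G l c c')%:E)%E].
Proof.
move=> TK; pose U := kept :|: [set v | has (on_path^~ v) P]%SET.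
have K0K : K0 \subset kept by apply: finset.subsetUl.
have KU : kept \subset U by apply: finset.subsetUl.
have onU i v : i \in P -> on_path i v -> v \in U.
  by move=> iP iv; rewrite !inE; apply/orP; right; apply/hasP; exists i.
have on_verts i v : i \in P -> on_path i v -> v \in verts G.
  move=> iP /and3P[c _ _]; have [<-|ne] := eqVneq i.1 v; first exact: P_verts.
  have /connectP[p] : conn v i.1 by rewrite conn_sym.
  by case: p => [_ E|z p /= /andP[/adj_verts[]] //]; rewrite E eqxx in ne.
have KV : kept \subset verts G.
  apply/fintype.subsetP => v; rewrite !inE mem_cat => /orP[/(fintype.subsetP K0_verts)//|].
  have self i : i \in P -> on_path i i.1 by move=> iP; apply: between_l; rewrite // P_conn.
  case/orP => /allpairsP[[i j] /= [iP jP ->]]; rewrite /meet_first /meet_last;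
    case: pickP => [w /and3P[h _ _]|_] /=; by [apply: on_verts h | apply: P_verts].
have UV : U \subset verts G.
  apply/fintype.subsetP => v; rewrite inE => /orP[/(fintype.subsetP KV)//|].
  by rewrite inE => /hasP[i iP]; apply: on_verts.
have cid v : v \in kept -> collapse v = v by rewrite /collapse => ->.
have out v : v \in U -> v \notin kept -> collapse v \in kept /\
    exists2 w, connect inner_adj v w & network_adj w (collapse v) /\ w \notin kept.
  rewrite inE => /orP[->//|]; rewrite inE => /hasP[i iP iv] vK.
  have [c [c' [[cK c'K] ic ic' /andP[h1 h2] gp]]] := bracket iP iv vK.
  have sv : [&& on_path i v, dt i.1 c < dt i.1 v & dt i.1 v < dt i.1 c'] by rewrite iv h1 h2.
  have [lk|[w [w' [s1 s2 a1 a2 h]]]] := segment_walk iP ic ic' (lt_trans h1 h2) gp.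
    have [E|E] := link_on lk ic ic' iv (ltW h1) (ltW h2); by move: vK; rewrite E ?cK ?c'K.
  have vw : connect inner_adj v w by rewrite inner_sym h.
  have [[k1 [z vz zk]] _] := collapse_pick vK cK vw a1.
  split=> //; exists z => //; split=> //.
  by apply: (inside_notin gp); apply: inside_connect vz.
have inner_U a b : inner_adj a b -> a \in U /\ b \in U.
  by move=> /and3P[/andP[_ /hasP[i iP /andP[ia ib]]] _ _]; split; apply: onU iP _.
have fib v : v \in U -> connect (fibre_adj G U collapse) v (collapse v).
  move=> vU; have [vK|vK] := boolP (v \in kept); first by rewrite cid ?connect0.
  have [k1 [w vw [wk wK]]] := out v vU vK.
  have const z : z \notin kept -> connect inner_adj v z -> collapse z = collapse v.
    by apply: (collapse_pick vK k1 vw wk).2.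
  have [wU kU] : w \in U /\ collapse v \in U.
    by move: wk => /andP[_ /hasP[i iP /andP[ia ib]]]; split; apply: onU iP _.
  have last_step : connect (fibre_adj G U collapse) w (collapse v).
    apply: connect1; rewrite /fibre_adj /= wU kU (const w wK vw) (cid _ k1) eqxx !andbT.
    by have /andP[/andP[]] := wk.
  apply: connect_trans last_step; have := connect0 inner_adj v.
  case/connectP: vw => p + ->; move: {1 3 4 5}v => x; elim: p x => //= z p IH x /andP[xz ps] vx.
  have [xU zU] := inner_U _ _ xz; have /and3P[/andP[/andP[a _] _] xK zK] := xz.
  have vz : connect inner_adj v z by apply: connect_trans vx (connect1 xz).
  apply: connect_trans (IH z ps vz); apply: connect1.
  by rewrite /fibre_adj /= a xU zU !const // eqxx.
have inK v : v \in U -> collapse v \in kept.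
  by move=> vU; have [vK|/(out _ vU)[]//] := boolP (v \in kept); rewrite cid.
have [H [l' [m1 m2 m3 m4 m5]]] := retraction_DAM l_gt0 (fintype.subset_trans TK K0K) KU UV inK cid fib.
exists H, l'; split=> //; first by rewrite m2 K0K card_kept.
(* Consecutive kept vertices of a path are handled by [segment_collapse]; other pairs by induction
   on the number of kept vertices in between, splitting at one of them. *)
pose seg i c c' := [set w in kept | [&& on_path i w, (dt i.1 c <= dt i.1 w)%R & (dt i.1 w <= dt i.1 c')%R]]%SET.
have segE i c c' z : (z \in seg i c c') = [&& z \in kept, on_path i z, dt i.1 c <= dt i.1 z & dt i.1 z <= dt i.1 c'].
  by rewrite finset.in_set.
have KK i n : i \in P -> forall c c', c \in kept -> c' \in kept -> on_path i c -> on_path i c' ->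
    dt i.1 c <= dt i.1 c' ->
    (#|seg i c c'| < n)%N ->
    (dist H l' c c' <= (gdist G l c c')%:E)%E.
  move=> iP; elim: n => // n IH c c' cK c'K ic ic' le sz.
  have [->|ne] := eqVneq c c'; first by rewrite dist_refl // gdist0.
  have cc' : dt i.1 c < dt i.1 c'.
    rewrite lt_neqAle le andbT; apply: contraNneq ne => E; apply/eqP/esym.
    by apply/esym; apply: (between_eq (on_chain ic ic' le) E).
  have [[w [wK iw h1 h2 [wc wc']]]|ng] := pselect (exists w, [/\ w \in kept, on_path i w, dt i.1 c <= dt i.1 w,
      dt i.1 w <= dt i.1 c' & w <> c /\ w <> c']).
    have /and3P[_ _ /eqP E] := between_generic l_gt0 lt_gt0 gen (on_between ic ic' iw h1 h2).
    rewrite -E EFinD; apply: le_trans (dist_tri m3 c w c') _; apply: leeD; apply: IH => //.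
      apply: leq_trans (_ : _ <= #|seg i c c'|)%N _; last by rewrite -ltnS.
      apply: proper_card; apply/properP; split.
        apply/fintype.subsetP => z; rewrite !segE => /and4P[-> -> -> h]; exact: le_trans h h2.
      exists c'; first by rewrite !segE c'K ic' lexx le.
      rewrite !segE c'K ic' le /= -ltNge lt_neqAle h2 andbT; apply/negP => /eqP E'.
      by apply: wc'; apply: (between_eq (on_chain iw ic' h2) E').
    apply: leq_trans (_ : _ <= #|seg i c c'|)%N _; last by rewrite -ltnS.
    apply: proper_card; apply/properP; split.
      apply/fintype.subsetP => z; rewrite !segE => /and4P[-> -> h ->]; rewrite (le_trans h1 h) //.
    exists c; first by rewrite !segE cK ic lexx le.
    rewrite !segE cK ic le /= andbT -ltNge lt_neqAle h1 andbT; apply/negP => /eqP E'.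
    by apply: wc; apply/esym/(between_eq (on_chain ic iw h1) E').
  have gp w : w \in kept -> on_path i w -> dt i.1 c <= dt i.1 w -> dt i.1 w <= dt i.1 c' -> w = c \/ w = c'.
    move=> wK iw h1 h2; have [->|wc] := eqVneq w c; [by left | right].
    by apply/eqP; apply: contraT => wc'; case: ng; exists w; split=> //; split; apply/eqP.
  have [cU c'U] : c \in U /\ c' \in U by split; apply: (fintype.subsetP KU).
  case: (segment_collapse iP cK c'K ic ic' cc' gp) => [/andP[a _]|[w [w' [l1 l2 E [s1 s2] h]]]].
    by have := m5 c c' cU c'U a; rewrite !cid.
  have [wU w'U] : w \in U /\ w' \in U.
    by case/and3P: s1 => iw _ _; case/and3P: s2 => iw' _ _; split; apply: onU iP _.
  have /andP[a1 _] := l1; have /andP[a2 _] := l2.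
  case: h => h.
    by have := m5 w' c' w'U c'U a2; rewrite (cid _ c'K) -E h.
  by have := m5 c w cU wU a1; rewrite (cid _ cK) h.
have sym x y : dist H l' x y = dist H l' y x.
  have [c|nc] := boolP (connect (adj H) x y).
    by rewrite !dist_conn // 1?conn_sym // (gdistC m3 c).
  by rewrite !dist_nconn // conn_sym.
move=> i c c' iP /(fintype.subsetP K0K) cK /(fintype.subsetP K0K) c'K ic ic'.
have [h|/ltW h] := leP (dt i.1 c) (dt i.1 c'); first exact: KK iP _ _ cK c'K ic ic' h (leqnn _).
have cc : conn c' c by have /and3P[] := on_chain ic' ic h.
rewrite sym -(gdistC l_gt0 cc); exact: KK iP _ _ c'K cK ic' ic h (leqnn _).
Qed.

End PathNetwork.

(** * Portals and the separator hierarchy *)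

Section Portals.
Variables (R : realType) (V : finType).
Implicit Types (A : {set V}) (D h : V -> R) (eps : R).

(** The potential [D q - (h q - h q0)] is at least [- D q0]. If [q] fails to serve some later [z],
    the first such [z] becomes the next portal, and there the potential has dropped by more than
    [eps * D z], which is at least [eps * D q0]. *)
Lemma portals_above A D h eps q0 n : 0 < eps -> (forall q, q \in A -> D q0 <= D q) ->
  (forall q, q \in A -> h q - h q0 <= D q + D q0) ->
  forall q, q \in A -> D q - (h q - h q0) < - D q0 + n%:R * (eps * D q0) ->
  exists2 Q : seq V, (size Q <= n)%N & {subset Q <= A} /\
    forall z, z \in A -> h q <= h z -> exists2 q', q' \in Q & h q' <= h z /\ D q' + (h z - h q') <= (1 + eps) * D z.
Proof.
move=> e0 Dmin tri; elim: n => [|n IH] q qA fq.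
  by exfalso; have := tri q qA; move: fq; rewrite mul0r; lra.
have [[z0 z0A [hz0 bad0]]|good] := pselect (exists2 z, z \in A & h q <= h z /\ (1 + eps) * D z < D q + (h z - h q)); last first.
  exists [:: q]; rewrite //; split; first by move=> x; rewrite inE => /eqP->.
  move=> z zA hz; exists q; rewrite ?inE //; split=> //; rewrite leNgt; apply/negP => lt.
  by apply: good; exists z.
pose badz := fun z => [&& z \in A, h q <= h z & (1 + eps) * D z < D q + (h z - h q)].
have b0 : badz z0 by rewrite /badz z0A hz0 bad0.
case: (@Order.TotalTheory.arg_minP _ _ _ z0 badz h b0) => z /and3P[zA hz bad] zmin.
have [|Q szQ [QA Qc]] := IH z zA.
  have := Dmin z zA; move: fq bad; rewrite mulrS; nra.
exists (q :: Q); first by rewrite /= ltnS.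
split; first by move=> x; rewrite inE => /orP[/eqP->|/QA].
move=> w wA hw; have [hwz|hwz] := leP (h z) (h w).
  by have [q' q'Q h'] := Qc w wA hwz; exists q'; rewrite // inE q'Q orbT.
exists q; rewrite ?inE ?eqxx //; split=> //; rewrite leNgt; apply/negP => lt.
by move: hwz; rewrite ltNge zmin // /badz wA hw lt.
Qed.

(* Greedy choice of portals along a shortest path A, with positions h and
   distances D to a fixed vertex: D q - h q drops by eps * min D at each step. *)
Lemma portals A D h eps : 0 < eps -> (forall q, 0 <= D q) ->
  (forall p q, p \in A -> q \in A -> h q - h p <= D q + D p) ->
  exists2 Q : seq V, (size Q <= 2 * (Num.truncn (2 / eps)).+1)%N & {subset Q <= A} /\
    forall z, z \in A -> exists2 q, q \in Q & D q + `|h z - h q| <= (1 + eps) * D z.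
Proof.
move=> e0 D0 tri; have [->|[x0 x0A]] := set_0Vmem A.
  by exists [::]; rewrite //; split=> // z; rewrite inE.
case: (@Order.TotalTheory.arg_minP _ _ _ x0 [in A] D x0A) => q0 q0A Dmin.
(* If [D q0 = 0], the hypothesis bounds [|h z - h q0|] by [D z], and [q0] is the only portal. *)
have := D0 q0; rewrite le_eqVlt => /orP[/eqP Dq0|Dq0].
  exists [:: q0] => //; split; first by move=> x; rewrite inE => /eqP->.
  move=> z zA; exists q0; rewrite ?inE // -Dq0 add0r.
  have t1 := tri _ _ q0A zA; have t2 := tri _ _ zA q0A; rewrite -Dq0 in t1 t2.
  have Dz := D0 z; rewrite ler_norml; apply/andP; split; nra.
(* The potential falls from [D q0] to no less than [- D q0], in steps of [eps * D q0]. *)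
set n := (Num.truncn (2 / eps)).+1.
have nP : 2 < n%:R * eps by rewrite -ltr_pdivrMr // truncnS_gt.
have st : D q0 - (h q0 - h q0) < - D q0 + n%:R * (eps * D q0) by rewrite mulrA; nra.
have [Q1 s1 [Q1A c1]] := portals_above e0 Dmin (fun q qA => tri _ _ q0A qA) q0A st.
have tri' q : q \in A -> - h q - (- h q0) <= D q + D q0.
  by move=> qA; have := tri _ _ qA q0A; lra.
have st' : D q0 - (- h q0 - (- h q0)) < - D q0 + n%:R * (eps * D q0) by rewrite mulrA; nra.
have [Q2 s2 [Q2A c2]] := @portals_above A D (fun q => - h q) eps q0 n e0 Dmin tri' q0 q0A st'.
exists (Q1 ++ Q2); first by rewrite size_cat mul2n -addnn leq_add.
split; first by move=> x; rewrite mem_cat => /orP[/Q1A|/Q2A].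
move=> z zA; have [hz|/ltW hz] := leP (h q0) (h z).
  have [q qQ [h1 h2]] := c1 z zA hz; exists q; first by rewrite mem_cat qQ.
  by rewrite ger0_norm // subr_ge0.
have [|q qQ [h1 h2]] := c2 z zA; first by rewrite lerN2.
exists q; first by rewrite mem_cat qQ orbT.
by rewrite ler0_norm; move: h1 h2; lra.
Qed.

End Portals.

Lemma size_flatten_map_le (S S' : eqType) (f : S -> seq S') s n : (forall x, x \in s -> (size (f x) <= n)%N) ->
  (size (flatten [seq f x | x <- s]) <= size s * n)%N.
Proof.
elim: s => //= x s IH h; rewrite size_cat mulSn leq_add ?h ?inE ?eqxx // IH // => y ys.
by rewrite h // inE ys orbT.
Qed.

Section Hierarchy.
Variables (R : realType) (V : finType) (G : graph V) (l lt : {set V} -> R).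
Hypotheses (l_gt0 : length_function G l) (lt_gt0 : length_function G lt).
Hypothesis gen : generic l lt.
Local Notation conn := (connect (adj G)).
Local Notation dt := (gdist G lt).
Implicit Types (r s t v w x a : V) (W : {set V}).

Lemma shortest_path_tree r : exists (par : V -> V) (rk : V -> nat), par r = r /\
  (forall v, conn r v -> v != r -> adj G v (par v) /\ (rk (par v) < rk v)%N) /\
  (forall a x, conn r a -> fconnect par a x -> between G lt r a x).
Proof.
have /choice[par parP] : forall v, exists u, (v = r -> u = r) /\ (conn r v -> v != r ->
    [/\ adj G v u, between G lt r v u & dt r u < dt r v]).
  move=> v; have [->|vr] := eqVneq v r; first by exists r.
  have [c|_] := boolP (conn r v); last by exists r; split=> // E; rewrite E eqxx in vr.
  have sp := geodesicP lt_gt0 c; have [p1 p2 _ _] := sp.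
  case: (lastP (geodesic G lt r v)) sp p1 p2 => [|q z] sp p1 p2; first by rewrite -p2 eqxx in vr.
  rewrite last_rcons in p2; rewrite {}p2 -cats1 in sp p1.
  have [c1 c2 _ E1 E2] := shortest_cat lt_gt0 sp.
  move: p1; rewrite cat_path /= andbT => /andP[_ a].
  exists (last r q); split=> [E|_ _]; first by rewrite E eqxx in vr.
  split; first by rewrite adj_sym.
    by rewrite /between c1 c2 E2 eqxx.
  by rewrite -E2 ltrDl gdist_gt0 // (adj_neq a).
(* Counting the vertices closer to [r] turns real distances into natural ranks. *)
exists par, (fun v => #|[set w | conn r w && (dt r w < dt r v)]%SET|).
split; first by have [h _] := parP r; exact: h erefl.
have step v : conn r v -> v != r -> [/\ adj G v (par v), between G lt r v (par v) & dt r (par v) < dt r v].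
  by move=> c vr; have [_] := parP v; apply.
split=> [v c vr|a x c].
  have [h1 h2 h3] := step v c vr; split=> //.
  apply: proper_card; apply/properP; split.
    by apply/fintype.subsetP => w; rewrite !inE => /andP[-> h]; rewrite (lt_trans h h3).
  have /and3P[c' _ _] := h2.
  by exists (par v); rewrite !inE c' ?h3 // ltxx.
move=> /connectP[p + ->]; elim: p a c => [|z p IH] a c /=; first by rewrite between_r.
move=> /andP[/eqP <- ps]; have [E|ar] := eqVneq a r.
  have pE : par a = a by rewrite E; have [h _] := parP r; exact: h erefl.
  by rewrite pE in ps *; apply: IH.
have [_ h2 _] := step a c ar; have /and3P[c' _ _] := h2.
exact: between_trans h2 (IH _ c' ps).
Qed.

Hypothesis planarG : planar R G.

Definition hierarchy r W (A : V -> seq V) :=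
  (forall s, (size (A s) <= 3 * trunc_log 2 #|W|)%N /\ all (conn r) (A s)) /\
  forall s t p, s \in W -> t \in W -> s != t -> path (adj G) s p -> last s p = t ->
    exists a, [/\ a \in A s, a \in A t & exists2 x, x \in s :: p & between G lt r a x].

(** A walk from [s] to [t] meets one of the three root paths of the separator, or joins [s] and [t]
    within a component off them, which has at most half of [W]. Choosing at [rt s] gives both the
    same recursive hierarchy. *)
Lemma separator_hierarchy r W : (forall w, w \in W -> conn r w) ->
  exists A, hierarchy r W A.
Proof.
have [par [rk [par_r [parP up]]]] := shortest_path_tree r.
have [n] := ubnP #|W|; elim: n W => // n IH W szn Wr.
have [W1|W2] := leqP #|W| 1.
  exists (fun=> [::]); split=> // s t p sW tW st.
  have := W1; rewrite leqNgt => /negP[].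
  by apply/card_gt1P; exists s, t.
have [X [szX [Xr sep]]] := planar_separator planarG parP Wr.
pose W' v := [set w in W | connect (off_adj G par X) v w]%SET.
have sub v : off_paths par X v -> exists A, hierarchy r (W' v) A.
  move=> ov; apply: IH => [|w]; last by rewrite inE => /andP[/Wr].
  by have := sep v ov; rewrite -/(W' v) => h; move: szn W2 h; lia.
have /choice[A' A'P] : forall v, exists A, off_paths par X v -> hierarchy r (W' v) A.
  move=> v; have [/sub[A h]|_] := boolP (off_paths par X v); first by exists A.
  by exists (fun=> [::]).
have symO : connect_sym (off_adj G par X).
  by apply: sym_connect_sym => x y; apply/and3P/and3P => -[a b c]; split; rewrite // adj_sym.
pose rt s := fingraph.root (off_adj G par X) s.
have rtP s : connect (off_adj G par X) s (rt s) by apply: connect_root.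
have off_rt s : off_paths par X s -> off_paths par X (rt s).
  move=> h; have := rtP s => /connectP[p + ->]; case/lastP: p => // p z.
  by rewrite rcons_path last_rcons => /andP[_ /and3P[]].
exists (fun s => X ++ if off_paths par X s then A' (rt s) s else [::]); split.
  move=> s; rewrite size_cat szX all_cat Xr; case: ifP => os /=; last first.
    rewrite addn0; split=> //; have := leq_trunc_log 2 W2; rewrite (trunc_log_eq (n := 1)) //; lia.
  have [/(_ s)[h1 ->] _] := A'P _ (off_rt _ os); split=> //.
  have h2 := sep _ (off_rt _ os); rewrite -/(W' _) in h2.
  (* The three new paths are paid for by the halving, which lowers [trunc_log 2] by at least one. *)
  apply: leq_trans (leq_add (leqnn 3) h1) _; rewrite -[X in (X + _)%N]muln1 -mulnDr leq_mul2l /= add1n.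
  have [E|E] := posnP #|W' (rt s)|.
    rewrite E /=; have := leq_trunc_log 2 W2; rewrite (trunc_log_eq (n := 1)) //; lia.
  by rewrite -(@trunc_logMp 2 _ isT E) //; apply: leq_trunc_log.
move=> s t p sW tW st ps pt.
have [/allP all_off|] := boolP (all (off_paths par X) (s :: p)); last first.
  move=> /allPn[x xp]; rewrite /off_paths => /allPn[a aX]; rewrite negbK => fa.
  exists a; rewrite !mem_cat aX; split=> //; exists x => //.
  by apply: up fa; apply: (allP Xr).
have os : off_paths par X s by apply: all_off; rewrite inE eqxx.
have ot : off_paths par X t by apply: all_off; rewrite -pt mem_last.
have st' : connect (off_adj G par X) s t.
  rewrite -pt; apply/connectP; exists p => //.
  elim: p s all_off ps {sW st pt os tW} => //= z p IHp s all_off /andP[sz ps].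
  rewrite /off_adj /= sz !all_off ?inE ?eqxx ?orbT //=; apply: IHp => // x xp.
  by apply: all_off; rewrite inE xp orbT.
have E : rt s = rt t by apply/(fingraph.rootP symO).
have [_ /(_ s t p)] := A'P _ (off_rt _ os).
rewrite !inE sW tW (symO (rt s)) rtP {1}E (symO (rt t)) rtP => /(_ isT isT st ps pt)[a [a1 a2 h]].
by exists a; rewrite !mem_cat os ot -E a1 a2 !orbT.
Qed.

(** The shortest path from [s] to [t] meets at some [x] a root path that both own. The route in the
    minor is [s], a portal [q] of [s], a portal [q'] of [t], [t]; its parts before and after [x] on
    the root path cost at most [1 + eps] times the distances from [s] and [t] to [x]. *)
Lemma planar_cover_DAM (eps : R) (T : {set V}) (L n : nat) : 0 < eps -> T \subset verts G ->
  L = (3 * trunc_log 2 #|T|)%N -> n = (2 * (Num.truncn (2 / eps)).+1)%N ->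
  exists H l', DAM (1 + eps) T G l H l' /\
    (#|verts H :\: T| <= #|T| * (L * n) + 2 * (#|T| * (L * n.+1)) ^ 2)%N.
Proof.
move=> e0 TG LE nE.
have csym := conn_sym G.
pose rt t := fingraph.root (adj G) t.
have rtc t : conn (rt t) t by rewrite csym connect_root.
have /choice[A AP] : forall r, exists A : V -> seq V, (forall s, (size (A s) <= L)%N /\ all (conn r) (A s)) /\
  forall s t p, s \in T -> t \in T -> conn r s -> conn r t -> s != t -> path (adj G) s p -> last s p = t ->
    exists a, [/\ a \in A s, a \in A t & exists2 x, x \in s :: p & between G lt r a x].
  move=> r; have [|A [h1 h2]] := @separator_hierarchy r [set t in T | conn r t]%SET.
    by move=> w; rewrite inE => /andP[].
  exists A; split=> [s|s t p sT tT cs ct].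
    have [h3 h4] := h1 s; split=> //; apply: leq_trans h3 _; rewrite LE leq_mul2l /=.
    by apply: leq_trunc_log; apply: subset_leq_card; apply/fintype.subsetP => w; rewrite inE => /andP[].
  by apply: h2; rewrite inE ?sT ?tT.
have /choice[Q QP] : forall ta : V * V, exists Q : seq V, ta.1 \in T -> ta.2 \in A (rt ta.1) ta.1 ->
   [/\ (size Q <= n)%N, forall q, q \in Q -> between G lt (rt ta.1) ta.2 q &
    forall z, between G lt (rt ta.1) ta.2 z -> exists2 q, q \in Q &
     gdist G l ta.1 q + `|gdist G l (rt ta.1) z - gdist G l (rt ta.1) q| <= (1 + eps) * gdist G l ta.1 z].
  move=> [t a] /=; have [tT|] := boolP (t \in T); last by exists [::].
  have ct := rtc t.
  have [||Q Q1 [Q2 Q3]] := @portals R V [set x | between G lt (rt t) a x]%SET (gdist G l t) (gdist G l (rt t)) eps e0.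
  - by move=> q; apply: gdist_ge0.
  - move=> p q; rewrite !inE => /and3P[c1 _ _] /and3P[c2 _ _].
    rewrite csym in ct; have cp := connect_trans ct c1; have cq := connect_trans ct c2.
    have cpt : conn p t by rewrite csym.
    have := gdist_tri l_gt0 cpt cq; have := gdist_tri l_gt0 c1 (connect_trans cpt cq).
    by rewrite (gdistC l_gt0 cpt); lra.
  exists Q => _ _; split; first by rewrite nE.
    by move=> q /Q2; rewrite inE.
  by move=> z zA; apply: Q3; rewrite inE.
pose At t := A (rt t) t.
pose qs t := flatten [seq Q (t, a) | a <- At t].
have At_size t : (size (At t) <= L)%N by have [/(_ t)[]] := AP (rt t).
have At_conn t a : a \in At t -> conn (rt t) a by have [/(_ t)[_ /allP h] _] := AP (rt t); exact: h.
have qs_size t : t \in T -> (size (qs t) <= L * n)%N.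
  move=> tT; apply: (@leq_trans (size (At t) * n)); last by rewrite leq_mul2r At_size orbT.
  by apply: size_flatten_map_le => a aA; have [] := QP (t, a) tT aA.
have qs_conn t q : t \in T -> q \in qs t -> conn t q.
  move=> tT /flattenP[s /mapP[a aA ->] qQ]; have [_ h _] := QP (t, a) tT aA.
  have /and3P[c _ _] := h q qQ.
  by apply: connect_trans c; rewrite csym.
pose P := flatten [seq [seq (rt t, a) | a <- At t] ++ [seq (t, q) | q <- qs t] | t <- enum T].
pose K0 := T :|: [set q in flatten [seq qs t | t <- enum T]]%SET.
have Pr t a : t \in T -> a \in At t -> (rt t, a) \in P.
  move=> tT aA; apply/flattenP; eexists; first by apply: map_f; rewrite mem_enum; exact: tT.
  by rewrite mem_cat (map_f (fun a => (rt t, a))).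
have Pq t q : t \in T -> q \in qs t -> (t, q) \in P.
  move=> tT aA; apply/flattenP; eexists; first by apply: map_f; rewrite mem_enum; exact: tT.
  by rewrite mem_cat (map_f (fun a => (t, a))) // orbT.
have PP i : i \in P -> exists2 t, t \in T & i.1 \in [:: rt t; t] /\ conn i.1 i.2.
  move=> /flattenP[s /mapP[t]]; rewrite mem_enum => tT ->; rewrite mem_cat => /orP[]/mapP[x xs ->]; exists t => //.
    by rewrite inE eqxx; split=> //; apply: At_conn.
  by rewrite !inE eqxx orbT; split=> //; apply: qs_conn.
have TV t : t \in T -> t \in verts G by move/fintype.subsetP: TG; apply.
have qK t q : t \in T -> q \in qs t -> q \in K0.
  move=> tT qq; rewrite !inE; apply/orP; right; apply/flattenP; exists (qs t) => //.
  by apply: map_f; rewrite mem_enum.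
have K0V : K0 \subset verts G.
  apply/fintype.subsetP => v; rewrite inE => /orP[/TV//|]; rewrite inE => /flattenP[s /mapP[t]].
  rewrite mem_enum => tT -> vq; exact: connect_verts (qs_conn _ _ tT vq) (TV _ tT).
have PV i : i \in P -> i.1 \in verts G.
  move=> /PP[t tT []]; rewrite !inE => /orP[]/eqP-> _; last exact: TV.
  by apply: connect_verts (TV _ tT); rewrite csym.
have Pc i : i \in P -> conn i.1 i.2 by move=> /PP[t _ []].
have [H [l' [mH l'0 /andP[K0H szH] lo up]]] := path_network_DAM l_gt0 lt_gt0 gen Pc K0V PV (finset.subsetUl _ _ : T \subset K0).
exists H, l'; split; last first.
  have szP : (size P <= #|T| * (L * n.+1))%N.
    rewrite cardE; apply: size_flatten_map_le => t; rewrite mem_enum => tT.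
    by rewrite size_cat !size_map mulnS leq_add // qs_size.
  have szK : (#|K0| <= #|T| + #|T| * (L * n))%N.
    rewrite /K0 cardsU (leq_trans (leq_subr _ _)) // leq_add2l.
    rewrite cardsE (leq_trans (card_size _)) // [X in (_ <= X * _)%N]cardE.
    by apply: size_flatten_map_le => t; rewrite mem_enum => tT; apply: qs_size.
  rewrite cardsD (_ : (verts H :&: T)%SET = T); last first.
    by apply/finset.setIidPr; apply: fintype.subset_trans K0H; apply: finset.subsetUl.
  have : (size P ^ 2 <= (#|T| * (L * n.+1)) ^ 2)%N by rewrite leq_exp2r.
  by move: szH szK; clear; lia.
split=> // s t sT tT; split=> //.
have [->|st] := eqVneq s t.
  rewrite dist_refl // mule_ge0 // ?dist_ge0 // lee_fin; lra.
have [c|nc] := boolP (conn s t); last first.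
  by rewrite [X in (_ * X)%E]dist_nconn // gt0_muley ?leey // lte_fin; lra.
have rst : rt s = rt t by apply/(fingraph.rootP csym).
have [p1 p2 p3 _] := geodesicP l_gt0 c.
have [a [as_ at_ [x xp bx]]] : exists a, [/\ a \in At s, a \in At t &
    exists2 x, x \in s :: geodesic G l s t & between G lt (rt s) a x].
  have [_ h] := AP (rt s); have := h s t (geodesic G l s t) sT tT (rtc s).
  by rewrite /At -rst; apply; rewrite // rst.
have /and3P[c1 c2 /eqP dE] := geodesic_between l_gt0 c xp.
have [_ Qs1 Qs2] := QP (s, a) sT as_; have [q qQ hq] := Qs2 x bx.
have bx' : between G lt (rt t) a x by rewrite -rst.
have [_ Qt1 Qt2] := QP (t, a) tT at_; have [q' qQ' hq'] := Qt2 x bx'.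
have bq := Qs1 q qQ; have bq' := Qt1 q' qQ'; rewrite /= -rst in bq' hq'; rewrite /= in bq hq.
have qs1 : q \in qs s by apply/flattenP; exists (Q (s, a)) => //; apply: (map_f (fun a => Q (s, a))).
have qs2 : q' \in qs t by apply/flattenP; exists (Q (t, a)) => //; apply: (map_f (fun a => Q (t, a))).
have cq := qs_conn _ _ sT qs1; have cq' := qs_conn _ _ tT qs2.
have sK : s \in K0 by rewrite inE sT.
have tK : t \in K0 by rewrite inE tT.
have e1 : (dist H l' s q <= (gdist G l s q)%:E)%E.
  by apply: (up (s, q)); [exact: Pq | exact: sK | exact: qK qs1 | exact: between_l | exact: between_r].
have e2 : (dist H l' q q' <= (gdist G l q q')%:E)%E.
  by apply: (up (rt s, a)); [exact: Pr | exact: qK qs1 | exact: qK qs2 | | ].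
have e3 : (dist H l' q' t <= (gdist G l t q')%:E)%E.
  rewrite -(gdistC l_gt0) 1?csym //.
  by apply: (up (t, q')); [exact: Pq | exact: qK qs2 | exact: tK | exact: between_r | exact: between_l].
(* Both portals lie on the shortest [lt]-path from [rt s] to [a], where [l]-distances are
   differences of positions. *)
have e4 : gdist G l q q' <= `|gdist G l (rt s) q - gdist G l (rt s) q'|.
  have /and3P[d1 _ _] := bq; have /and3P[d2 _ _] := bq'.
  have [le|/ltW le] := leP (gdist G lt (rt s) q) (gdist G lt (rt s) q').
    have := between_chain_dist l_gt0 lt_gt0 gen bq bq' le.
    by rewrite distrC ler_normr => <-; apply/orP; left; lra.
  have cqq : conn q q' by apply: connect_trans d2; rewrite csym.
  have := between_chain_dist l_gt0 lt_gt0 gen bq' bq le.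
  by rewrite (gdistC l_gt0 cqq) ler_normr => <-; apply/orP; left; lra.
rewrite (dist_conn l_gt0 c).
apply: le_trans (dist_tri l'0 s q t) _.
apply: le_trans (leeD e1 (le_trans (dist_tri l'0 q q' t) (leeD e2 e3))) _.
rewrite -!EFinD -EFinM lee_fin -dE.
have := gdistC l_gt0 c2; move: hq hq' e4 => + + + E; rewrite E.
have := ler_distD (gdist G l (rt s) x) (gdist G l (rt s) q) (gdist G l (rt s) q').
rewrite (distrC (gdist G l (rt s) q) (gdist G l (rt s) x)); clear; nra.
Qed.

End Hierarchy.

(** * The relaxed Voronoi partition *)

Section Slices.
Variables (R : realType) (n : nat) (s : nat -> nat) (wt : nat -> R).
Hypotheses (n_gt0 : (0 < n)%N) (wt_ge0 : forall b, 0 <= wt b).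
Implicit Types (A C : pred nat) (p q r : nat).

(** Positions run along a path divided into blocks [s p], and [A] is what is left of the path. From
    a [slice_start], these [q] fill a maximal run of [A] within one block, which [slice_weight]
    counts once. *)
Definition slice A p q := (p <= q)%N /\ forall r, (p <= r <= q)%N -> A r /\ s r = s p.
Definition slice_start A p := A p && [|| p == 0%N, ~~ A p.-1 | s p.-1 != s p].
Definition slice_weight A := \sum_(p < n | slice_start A p) wt (s p).

Definition first_in C := find C (iota 0 n).
Definition last_in C := (\max_(p < n | C p) p)%N.
Definition hull C p := (first_in C <= p <= last_in C)%N.
Definition cut A C : pred nat := fun p => A p && ~~ hull C p.
Definition end_cost C := if has C (iota 0 n) then wt (s (first_in C)) + wt (s (last_in C)) else 0.

Definition meets A C p := `[< exists q, slice A p q /\ hull C q >].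
Definition met_weight A C := \sum_(p < n | slice_start A p && meets A C p) wt (s p).

Lemma hull_ends C : has C (iota 0 n) ->
  [/\ C (first_in C), (first_in C < n)%N, C (last_in C), (last_in C < n)%N &
      forall p, (p < n)%N -> C p -> hull C p].
Proof.
move=> h; have f1 : (first_in C < n)%N by rewrite /first_in -{2}(size_iota 0 n) -has_find.
have f2 : C (first_in C) by have := nth_find 0%N h; rewrite nth_iota.
have [j Cj jE] : exists2 j : 'I_n, C j & last_in C = j.
  by have [j Cj E] := @eq_bigmax_cond 'I_n (fun i => C (nat_of_ord i)) (fun i => nat_of_ord i)
       (introT card_gt0P (ex_intro _ (Ordinal f1) f2)); exists j.
split=> //; rewrite ?jE // => p pn Cp; apply/andP; split; last exact: (@leq_bigmax_cond _ _ _ (Ordinal pn)).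
rewrite leqNgt; apply/negP => /(before_find 0%N); rewrite nth_iota // add0n Cp //.
Qed.

Lemma hull_has C p : hull C p -> has C (iota 0 n).
Proof.
move=> /andP[h1 h2]; apply: contraT => nC.
move: h1 h2; rewrite /first_in (hasNfind nC) size_iota /last_in big_pred0; first by lia.
move=> j; apply/negbTE; apply: contra nC => Cj; apply/hasP; exists (nat_of_ord j) => //.
by rewrite mem_iota add0n ltn_ord.
Qed.

Lemma slice_start_exists A q : A q -> exists2 p, slice_start A p & slice A p q.
Proof.
elim: q => [|q IH] Aq.
  exists 0%N; first by rewrite /slice_start Aq eqxx.
  by split=> // r; rewrite leqn0 => /eqP->.
have [h|h] := boolP (slice_start A q.+1).
  by exists q.+1 => //; split=> // r; rewrite -eqn_leq => /eqP<-.
move: h; rewrite /slice_start Aq /= negb_or !negbK => /andP[A1 /eqP E].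
have [p sp [h1 h2]] := IH A1; exists p => //; split; first exact: leq_trans h1 _.
move=> r /andP[h3]; rewrite leq_eqVlt => /orP[/eqP->|h4].
  by split=> //; rewrite -E; have [|_ ->] := h2 q; rewrite ?h1 ?leqnn.
by apply: h2; rewrite h3 -ltnS.
Qed.

Lemma met_weight0 A : met_weight A pred0 = 0.
Proof.
apply: big_pred0 => p; apply/negbTE; rewrite negb_and; apply/orP; right.
by apply/asboolP => -[q [_ /hull_has/hasP[]]].
Qed.

Section Charge.
Variables (A C C' : pred nat) (wmax : R).
Hypotheses (A_n : forall p, A p -> (p < n)%N) (CC' : forall p, C p -> C' p) (C'A : forall p, C' p -> A p).
Hypothesis spread : forall p x y, slice A p x -> slice A p y -> C x -> C' y.
Hypothesis wt_max : forall p, (p < n)%N -> wt (s p) <= wmax.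

Let hull_mono p : hull C p -> hull C' p.
Proof.
move=> hp; have := hull_has hp => hC; have [c1 c2 c3 c4 _] := hull_ends hC.
have hC' : has C' (iota 0 n) by apply: sub_has hC.
have [_ _ _ _ h] := hull_ends hC'.
have /andP[h1 _] := h _ c2 (CC' c1); have /andP[_ h2] := h _ c4 (CC' c3).
by move: hp; rewrite /hull; lia.
Qed.

Let meets_mono p : meets A C p -> meets A C' p.
Proof. by move=> /asboolP[q [h1 /hull_mono h2]]; apply/asboolP; exists q. Qed.

(** If [q] is outside the hull of [C], the slice contains the end of that hull on the side of [q];
    [spread] carries the capture from there to [q]. *)
Let meets_hull p q : meets A C p -> slice A p q -> hull C' q.
Proof.
move=> /asboolP[x [[px hx] hul]] [pq hq].
have [c1 c2 c3 c4 _] := hull_ends (hull_has hul).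
have cap y : C' y -> hull C' y.
  move=> C'y; have yn := A_n (C'A C'y).
  have hC' : has C' (iota 0 n) by apply/hasP; exists y; rewrite // mem_iota add0n.
  by have [_ _ _ _ h] := hull_ends hC'; apply: h.
have [hqC|] := boolP (hull C q); first exact: hull_mono.
rewrite /hull negb_and -!ltnNge => /orP[lt|lt]; apply: cap.
  apply: (spread (p := p) _ _ c1) => //; split; first by lia.
  by move=> r hr; apply: hx; move: hul; rewrite /hull; lia.
apply: (spread (p := p) _ _ c3) => //; split; first by move: hul; rewrite /hull; lia.
by move=> r hr; apply: hq; lia.
Qed.

Let gap := Num.min (met_weight A C' - met_weight A C) wmax.

Lemma met_weight_le : met_weight A C <= met_weight A C'.
Proof.
rewrite /met_weight big_mkcond [leRHS]big_mkcond /=; apply: ler_sum => p _.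
case: ifP => [/andP[-> /meets_mono->]//|_]; by case: ifP.
Qed.

Let fresh p : slice_start A p -> meets A C' p -> ~~ meets A C p -> wt (s p) <= gap.
Proof.
move=> sp m' m; have pn : (p < n)%N by apply: A_n; case/andP: sp.
rewrite /gap le_min wt_max // andbT lerBrDr.
rewrite /met_weight [leRHS](bigD1 (Ordinal pn)) /=; last by rewrite sp m'.
rewrite lerD2l big_mkcond [leRHS]big_mkcond /=; apply: ler_sum => q _.
case: ifP => [/andP[sq mq]|_]; last by case: ifP.
rewrite sq (meets_mono mq) /=; case: eqP => [E|//].
by move: mq; rewrite E /= (negPf m).
Qed.

Let end_le y : C' y -> hull C' y -> wt (s y) <= gap + met_weight A C.
Proof.
move=> C'y hy; have [p sp spy] := slice_start_exists (C'A C'y).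
have -> : s y = s p by have [h1 h2] := spy; have [|_ ->] := h2 y; rewrite ?h1 ?leqnn.
have m' : meets A C' p by apply/asboolP; exists y.
have pn : (p < n)%N by apply: A_n; case/andP: sp.
have gap0 : 0 <= gap by rewrite le_min subr_ge0 met_weight_le /= (le_trans (wt_ge0 (s 0%N))) // wt_max.
have [m|m] := boolP (meets A C p).
  rewrite /met_weight (bigD1 (Ordinal pn)) /=; last by rewrite sp m.
  by rewrite addrCA ler_wpDr // addr_ge0 // sumr_ge0.
by apply: le_trans (fresh sp m' m) _; rewrite ler_wpDr // sumr_ge0.
Qed.

(** Slices met by [C] vanish by [meets_hull]. The only new start is just after the hull of [C'],
    where a slice is cut in two; that slice is not met by [C], so [fresh] bounds its weight. *)
Let cut_weight : slice_weight (cut A C') + met_weight A C <= slice_weight A + gap.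
Proof.
have gap0 : 0 <= gap by rewrite le_min subr_ge0 met_weight_le /= (le_trans (wt_ge0 (s 0%N))) // wt_max.
pose fresh_start p := slice_start (cut A C') p && ~~ slice_start A p.
have freshP p : fresh_start p -> p = (last_in C').+1 /\ wt (s p) <= gap.
  move=> /andP[/andP[/andP[Ap hp] h1]]; rewrite /slice_start Ap /= !negb_or !negbK => /and3P[p0 A1 /eqP E].
  move: h1; rewrite (negPf p0) E eqxx orbF /cut A1 /= negbK => hp1.
  have pE : p = (last_in C').+1 by move: p0 hp hp1; rewrite /hull; lia.
  split=> //; have [x sx slx] := slice_start_exists A1; have [xp hx] := slx.
  have slp : slice A x p.
    split; first by lia.
    move=> r hr; have [->|rp] := eqVneq r p; last by apply: hx; lia.
    by split=> //; rewrite -E; apply: (hx _ _).2; lia.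
  have -> : s p = s x by have [h1 h2] := slp; have [|_ ->] := h2 p; rewrite ?h1 ?leqnn.
  apply: fresh => //; first by apply/asboolP; exists p.-1.
  by apply: contra hp => m; apply: meets_hull slp.
have fresh_sum : \sum_(p < n | fresh_start p) wt (s p) <= gap.
  have [ln|ln] := ltnP (last_in C').+1 n; last first.
    by rewrite big_pred0 // => p; apply/negbTE/negP => /freshP[E _]; have := ltn_ord p; rewrite E; lia.
  have [hf|hf] := boolP (fresh_start (last_in C').+1).
    rewrite (big_pred1 (Ordinal ln)) /=; first by have [] := freshP _ hf.
    move=> p; apply/idP/eqP => [/freshP[E _]|->//]; exact: val_inj.
  rewrite big_pred0 // => p; apply/negbTE/negP => h; have [E _] := freshP _ h.
  by rewrite E in h; rewrite h in hf.
have -> : slice_weight (cut A C') = \sum_(p < n | fresh_start p) wt (s p) +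
    \sum_(p < n | slice_start (cut A C') p && slice_start A p) wt (s p).
  by rewrite /slice_weight (bigID (fun p : 'I_n => slice_start A p)) /= addrC.
suff : \sum_(p < n | slice_start (cut A C') p && slice_start A p) wt (s p) + met_weight A C <= slice_weight A.
  by move: fresh_sum; lra.
rewrite /slice_weight /met_weight [leRHS](bigID (fun p : 'I_n => meets A C p)) /= [leLHS]addrC lerD2l.
rewrite big_mkcond [leRHS]big_mkcond /=; apply: ler_sum => p _.
case: ifP => [/andP[sc sp]|_]; last by case: ifP.
rewrite sp; case: ifP => // /negbFE m; exfalso.
have /andP[/andP[Ap hp] _] := sc; move/negP: hp; apply; apply: meets_hull m _.
by split=> // r; rewrite -eqn_leq => /eqP<-.
Qed.

(* C and C' are the positions captured at consecutive levels. By [spread], a slice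
   meeting the hull of C is swallowed whole by the hull of C', and its weight pays
   for the ends of the hull; otherwise the slice at an end is newly met. *)
Lemma charge : end_cost C' + 4 * slice_weight (cut A C') - 4 * slice_weight A <=
  6 * Num.min (met_weight A C' - met_weight A C) wmax - 2 * met_weight A C.
Proof.
rewrite -/gap; have := cut_weight; rewrite /end_cost; case: ifP => [h|_]; last first.
  have : 0 <= gap by rewrite le_min subr_ge0 met_weight_le /= (le_trans (wt_ge0 (s 0%N))) // wt_max.
  have : 0 <= met_weight A C by apply: sumr_ge0.
  lra.
have [c1 c2 c3 c4 hh] := hull_ends h.
(* Two ends and four times [cut_weight]: [2 + 4] times the gap and [2 - 4] times the met weight. *)
have := end_le c1 (hh _ c2 c1); have := end_le c3 (hh _ c4 c3); lra.
Qed.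

End Charge.
End Slices.

(** * Averages over a truncated geometric level *)

Section LevelAverage.
Variable R : realType.
Implicit Types (h e x : nat -> R) (m g : nat).

(* The mean of h over the level g, where g = j < m has weight (1/10) (9/10)^j and
   g = m has the remaining weight (9/10)^m. *)
Fixpoint level_average m h : R :=
  if m is m'.+1 then h 0%N / 10 + 9 / 10 * level_average m' (fun g => h g.+1) else h 0%N.

Lemma level_average_sum (I : finType) (P : pred I) m (F : I -> nat -> R) :
  level_average m (fun g => \sum_(i | P i) F i g) = \sum_(i | P i) level_average m (F i).
Proof.
elim: m F => //= m IH F; rewrite (IH (fun i g => F i g.+1)) mulr_suml mulr_sumr -big_split.
by apply: eq_bigr => i _; rewrite mulrC.
Qed.

Lemma level_averageZ m h c : level_average m (fun g => c * h g) = c * level_average m h.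
Proof. by elim: m h => //= m IH h; rewrite IH; lra. Qed.

Lemma level_average_min m h b : level_average m h <= b -> exists2 g, (g <= m)%N & h g <= b.
Proof.
elim: m h => [|m IH] h /= hb; first by exists 0%N.
have [h0|h0] := leP (h 0%N) b; first by exists 0%N.
have [|g gm hg] := IH (fun g => h g.+1); last by exists g.+1.
by move: hb h0; lra.
Qed.

Lemma expR_le_inv (y : R) : y < 1 -> expR y <= (1 - y)^-1.
Proof.
move=> y1; rewrite -[expR y]invrK -expRN lef_pV2 ?posrE ?expR_gt0 ?subr_gt0 //.
exact: expR_ge1Dx.
Qed.

(* With z = exp (2 (x_(g+1) - x_g)) truncated at exp (1/5), the recursion closes
   because z^3 / 10 + (9/10) / z <= 1. *)
Lemma level_average_exp m e x b : 0 <= b -> b <= 10^-1 -> (forall g, x g <= x g.+1) ->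
  (forall g, (g <= m)%N -> e g <= 6 * Num.min (x g.+1 - x g) b - 2 * x g) ->
  level_average m (fun g => expR (e g)) <= expR (- 2 * x 0%N) * (1 + 4 * (9 / 10) ^+ m).
Proof.
move=> b0 b1; elim: m e x => [|m IH] e x xm he.
all: set y := Num.min (x 1%N - x 0%N) b.
all: have y0 : 0 <= y by rewrite le_min subr_ge0 xm.
all: have yb : y <= 10^-1 by rewrite ge_min b1 orbT.
all: pose z := expR (2 * y).
all: have z1 : 1 <= z by rewrite -expR0 ler_expR mulr_ge0.
(* Here [2 * y <= 1 / 5], and [expR (1 / 5) <= 1 / (1 - 1 / 5)]. *)
all: have z2 : z <= 5 / 4 
  by apply: le_trans (expR_le_inv _) _; [lra|rewrite invf_ple ?posrE; lra].
all: have e0 : expR (e 0%N) <= expR (- 2 * x 0%N) * z ^+ 3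
  by rewrite -expRM_natl -expRD ler_expR; have := he 0%N isT; rewrite -/y; lra.
  rewrite /= expr0 mulr1; apply: le_trans e0 _; rewrite ler_pM2l ?expR_gt0 //.
  by move: z1 z2; clear; nra.
rewrite /=; have := IH (fun g => e g.+1) (fun g => x g.+1) (fun g => xm g.+1) (fun g gm => he g.+1 gm).
set F := level_average _ _; set t := _ ^+ m => hF; rewrite exprS -/t.
have t0 : 0 <= t by apply: exprn_ge0; lra.
have ex1 : expR (- 2 * x 1%N) <= expR (- 2 * x 0%N) * z^-1.
  rewrite -expRN -expRD ler_expR; have : y <= x 1%N - x 0%N by rewrite ge_min lexx.
  lra.
have zi : z^-1 * z = 1 by rewrite mulVf // gt_eqF // expR_gt0.
have zi0 : 0 < z^-1 by rewrite invr_gt0 expR_gt0.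
have key : z ^+ 3 / 10 + 9 / 10 * z^-1 <= 1.
  rewrite -(@ler_pM2r _ z) ?expR_gt0 // mul1r mulrDl -[9 / 10 * _ * _]mulrA zi.
  have z3 : z ^+ 2 <= 5 / 2 by move: z1 z2; clear; nra.
  have z4 : z ^+ 3 <= 25 / 8 by move: z1 z2 z3; clear; nra.
  (* Multiplied by [10 * z], the claim is [z ^+ 4 - 10 * z + 9 <= 0], whose left side has the root
     1. *)
  have : 0 <= (z - 1) * (9 - z - z ^+ 2 - z ^+ 3) by apply: mulr_ge0; lra.
  by clear; lra.
have zi1 : z^-1 <= 1 by rewrite invf_le1 ?expR_gt0.
have E0 : 0 < expR (- 2 * x 0%N) by apply: expR_gt0.
move: E0 hF e0 ex1; set E := expR (- 2 * x 0%N); set E1 := expR _ => E0 hF e0 ex1.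
have hF2 : F <= E * z^-1 * (1 + 4 * t) by apply: le_trans hF _; rewrite ler_wpM2r //; lra.
apply: (@le_trans _ _ (E * (z ^+ 3 / 10 + 9 / 10 * z^-1 * (1 + 4 * t)))); first by move: e0 hF2; lra.
rewrite ler_pM2l //; move: key zi1 t0 zi0; clear; nra.
Qed.

End LevelAverage.

(** * Division of a path into blocks of nearly constant terminal distance *)

Section Blocks.
Variables (R : realType) (pos D : nat -> R) (dl : R).
Hypotheses (dl0 : 0 <= dl) (dl1 : dl <= 3^-1) (D_ge0 : forall p, 0 <= D p).

(** A block is named by its first position. It is extended greedily while its length is at most [dl]
    times [D] at the start, so a Lipschitz [D] varies little on it. *)
Fixpoint block p : nat :=
  if p is q.+1 then if pos q.+1 - pos (block q) <= dl * D (block q) then block q else q.+1 else 0%N.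

Lemma block_le p : (block p <= p)%N.
Proof. by elim: p => //= p IH; case: ifP => // _; apply: leqW. Qed.

Lemma block_near p : pos p - pos (block p) <= dl * D (block p).
Proof. by elim: p => [|p IH] /=; [rewrite subrr mulr_ge0|case: ifP => //; rewrite subrr mulr_ge0]. Qed.

Variable M : nat.
Hypothesis pos_mono : {in [pred p | (p <= M)%N] &, {homo pos : p q / (p <= q)%N >-> p <= q}}.
Hypothesis D_lip : {in [pred p | (p <= M)%N] &, forall p q, (p <= q)%N -> `|D p - D q| <= pos q - pos p}.

Lemma block_third p : dl * D (block p) <= 3^-1 * D (block p).
Proof. by rewrite ler_wpM2r. Qed.

(** [D q] is at least [2 / 3] of its value at the block start, as [dl <= 1 / 3]. The factor is
    written [2^-1 * (3 * dl)] to fit [capture_along]. *)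
Lemma block_close p q : (p <= M)%N -> (q <= M)%N -> block p = block q ->
  `|pos p - pos q| <= 2^-1 * (3 * dl) * D q.
Proof.
move=> pM qM E; have := block_near p; have := block_near q; rewrite -E.
have bp := block_le p; have bq := block_le q; rewrite -E in bq.
have bM := leq_trans bp pM.
have := pos_mono bM pM bp; have := pos_mono bM qM bq.
have := D_lip bM qM bq; rewrite ler_distl => /andP[_ h1] h2 h3 h4 h5.
have P3 := block_third p.
have : 0 <= dl * (D q - 2 / 3 * D (block p)) by apply: mulr_ge0 => //; lra.
by rewrite mulrBr ler_distl; lra.
Qed.

Lemma block_weight p : (p <= M)%N -> D p <= 4 / 3 * D (block p).
Proof.
move=> pM; have bp := block_le p; have := D_lip (leq_trans bp pM) pM bp.
rewrite ler_distl => /andP[h1 h2]; have := block_near p; have := block_third p; lra.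
Qed.

(** From one block start to the next the position advances by more than the term of the block. The
    last term is paid by the remaining length, which is at least [D (block M)] because [D M = 0]. *)
Lemma block_sum : D M = 0 -> \sum_(p < M.+1 | block p == p) dl * D p <= pos M - pos 0%N.
Proof.
move=> DM.
suff h q : \sum_(p < q.+1 | block p == p) dl * D p <= pos (block q) - pos 0%N + dl * D (block q).
  have bM := block_le M; have := D_lip bM (leqnn M) bM; rewrite DM subr0 ger0_norm //.
  by have := h M; have := block_third M; have := D_ge0 (block M); lra.
elim: q => [|q IH].
  by rewrite big_mkcond big_ord_recl big_ord0 /= addr0 subrr add0r.
rewrite big_mkcond big_ord_recr -big_mkcond /=.
case: (boolP (pos q.+1 - pos (block q) <= dl * D (block q))) => [le|].
  by rewrite ltn_eqF ?addr0 // ltnS block_le.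
by rewrite -ltNge eqxx; move: IH; lra.
Qed.

End Blocks.

Section NearestTerminal.
Variables (R : realType) (V : finType) (G : graph V) (l : {set V} -> R) (T : {set V}).
Hypothesis l_gt0 : length_function G l.
Local Notation conn := (connect (adj G)).

Definition reached v := [exists t in T, conn t v].

Lemma reached_conn v w : reached v -> conn v w -> reached w.
Proof.
move=> /exists_inP[t tT c] c'; apply/exists_inP; exists t => //; exact: connect_trans c'.
Qed.

Lemma terminal_distance : exists D : V -> R, [/\ forall v, 0 <= D v, forall t, t \in T -> D t = 0,
  forall v w, adj G v w -> D w <= D v + l [set v; w]%SET &
  forall v, reached v -> v \notin T ->
    exists w, [/\ adj G w v, 0 < l [set w; v]%SET & D v = D w + l [set w; v]%SET]].
Proof.
(* [D] is the distance to [T], set to 0 where no terminal reaches. *)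
have /choice[D DP] : forall v, exists d : R, [/\ 0 <= d,
    forall t, t \in T -> conn t v -> d <= gdist G l t v,
    reached v -> exists2 t, t \in T & conn t v /\ d = gdist G l t v & ~~ reached v -> d = 0].
  move=> v; have [/exists_inP[t0 t0T c0]|nr] := boolP (reached v); last first.
    exists 0; split=> // t tT c; first exact: gdist_ge0.
  have b0 : (t0 \in T) && conn t0 v by rewrite t0T.
  case: (@Order.TotalTheory.arg_minP _ _ _ t0 (fun t => (t \in T) && conn t v) (gdist G l ^~ v) b0) => t /andP[tT c] tmin.
  exists (gdist G l t v); split=> //; first exact: gdist_ge0.
    by move=> t' t'T c'; apply: tmin; rewrite t'T.
  by move=> _; exists t.
have lip v w : adj G v w -> D w <= D v + l [set v; w]%SET.
  move=> vw; have [_ h1 h2 h3] := DP w; have [_ h4 h5 h6] := DP v.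
  have [r|nr] := boolP (reached v); last first.
    rewrite h3 ?addr_ge0 //; [by have [] := DP v|by apply/ltW/l_gt0|].
    by apply: contra nr => r; apply: reached_conn r (connect1 _); rewrite adj_sym.
  have [t tT [c ->]] := h5 r.
  apply: le_trans (h1 t tT (connect_trans c (connect1 vw))) _.
  by apply: le_trans (gdist_tri l_gt0 c (connect1 vw)) _; rewrite lerD2l gdist_adj.
exists D; split=> //; first by move=> v; have [] := DP v.
  move=> t tT; have [h0 h1 _ _] := DP t; apply/eqP; rewrite eq_le h0 andbT.
  by have := h1 t tT (connect0 _ _); rewrite gdist0.
move=> v r vT; have [h0 h1 h2 _] := DP v; have [t tT [c E]] := h2 r.
have sp := geodesicP l_gt0 c; have [p1 p2 _ _] := sp.
case: (lastP (geodesic G l t v)) sp p1 p2 => [|q z] sp p1 p2.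
  by move: vT; rewrite -p2 /= tT.
rewrite last_rcons in p2; rewrite {}p2 -cats1 in sp p1.
have [c1 c2 _ E1 E2] := shortest_cat l_gt0 sp.
move: p1; rewrite cat_path /= andbT => /andP[_ a].
exists (last t q); split=> //; first exact: l_gt0.
apply/eqP; rewrite eq_le lip //=; rewrite E -E2 -E1 walk_cons walk_nil addr0 lerD2r.
by have [_ h _ _] := DP (last t q); apply: h.
Qed.

End NearestTerminal.

(** * Growth of a single cluster *)

Section Growth.
Variables (R : realType) (V : finType) (G : graph V) (l : {set V} -> R) (T : {set V}) (D : V -> R).
Hypothesis l_gt0 : length_function G l.
Hypotheses (D_ge0 : forall v, 0 <= D v) (D_T : forall t, t \in T -> D t = 0).
Hypothesis D_lip : forall v w, adj G v w -> D w <= D v + l [set v; w]%SET.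
Local Notation conn := (connect (adj G)).
Implicit Types (Cl : {set V}) (t v w : V) (rho r : R).

(* grow v r: v is reached from t by a walk of length r outside Cl, each of whose
   prefixes has length at most rho times the terminal distance of its end. *)
Inductive grow Cl t rho : V -> R -> Prop :=
| grow0 : grow Cl t rho t 0
| growS v w r : grow Cl t rho v r -> adj G v w -> w \notin Cl ->
    r + l [set v; w]%SET <= rho * D w -> grow Cl t rho w (r + l [set v; w]%SET).

Definition capture Cl t rho := [set v | `[< exists r, grow Cl t rho v r >]]%SET.

Lemma captureP Cl t rho v : reflect (exists r, grow Cl t rho v r) (v \in capture Cl t rho).
Proof. by rewrite inE; apply: asboolP. Qed.

Lemma grow_ge0 Cl t rho v r : grow Cl t rho v r -> 0 <= r.
Proof. by elim=> // v' w r' _ h a _ _; rewrite addr_ge0 // ltW // l_gt0. Qed.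

Lemma grow_le Cl t rho v r : t \in T -> grow Cl t rho v r -> r <= rho * D v.
Proof. by move=> tT; case=> //; rewrite D_T // mulr0. Qed.

Lemma grow_mono Cl t rho rho' v r : rho <= rho' -> grow Cl t rho v r -> grow Cl t rho' v r.
Proof.
move=> le; elim=> [|v' w r' _ h a wC hr]; first exact: grow0.
by apply: growS => //; apply: le_trans hr _; rewrite ler_wpM2r.
Qed.

Lemma grow_notin Cl t rho v r : t \notin Cl -> grow Cl t rho v r -> v \notin Cl.
Proof. by move=> tC; case. Qed.

(** [D] vanishes on terminals, so no walk of positive length may end at one. *)
Lemma grow_terminal Cl t rho v r : grow Cl t rho v r -> v \in T -> v = t.
Proof.
case=> // v' w r' h a _ hr /D_T E; move: hr; rewrite E mulr0.
by move=> le; exfalso; have := grow_ge0 h; have := l_gt0 a; lra.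
Qed.

Lemma grow_dist Cl t rho v r : grow Cl t rho v r -> conn t v /\ gdist G l t v <= r.
Proof.
elim=> [|v' w r' _ [c h] a _ _]; first by rewrite connect0 gdist0.
split; first exact: connect_trans c (connect1 a).
by apply: le_trans (gdist_tri l_gt0 c (connect1 a)) _; apply: lerD => //; apply: gdist_adj.
Qed.

Lemma capture_mono Cl t rho rho' : rho <= rho' -> capture Cl t rho \subset capture Cl t rho'.
Proof.
by move=> le; apply/fintype.subsetP => v /captureP[r h]; apply/captureP; exists r; apply: grow_mono h.
Qed.

Lemma capture_self Cl t rho : t \in capture Cl t rho.
Proof. by apply/captureP; exists 0; apply: grow0. Qed.

Lemma capture_connect Cl t rho v : v \in capture Cl t rho ->
  connect [rel a b | [&& adj G a b, a \in capture Cl t rho & b \in capture Cl t rho]] v t.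
Proof.
move=> /captureP[r]; elim=> [|v' w r' h IH a wC hr]; first exact: connect0.
apply: connect_trans IH; apply: connect1; rewrite /= adj_sym a /=; apply/andP; split; apply/captureP.
  by eexists; apply: growS h a wC hr.
by exists r'.
Qed.

(** Along an edge that leads straight away from [T], the bound [rho * D] grows by [rho] times the
    length, hence at least by the length. *)
Lemma capture_tight Cl t rho v w : t \in T -> 1 <= rho -> v \in capture Cl t rho -> adj G v w ->
  w \notin Cl -> D w = D v + l [set v; w]%SET -> w \in capture Cl t rho.
Proof.
move=> tT r1 /captureP[r h] a wC E; apply/captureP; exists (r + l [set v; w]%SET); apply: growS => //.
have := grow_le tT h; rewrite E mulrDr => ?; apply: lerD => //.
by rewrite ler_peMl // ltW // l_gt0.
Qed.

(** At a position [q] on the way the walk has length at most [rho * D (u x) + |pos x - pos q|].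
    Replacing [D (u x)] by [D (u q)] and walking to [q] each cost at most a fraction [dl / 2] of
    [rho * D (u q)]. *)
Lemma capture_along Cl t rho dl (u : nat -> V) (pos : nat -> R) x y : t \in T -> 1 <= rho -> 0 <= dl ->
  (forall q, (minn x y <= q < maxn x y)%N -> adj G (u q) (u q.+1) /\ l [set u q; u q.+1]%SET = pos q.+1 - pos q) ->
  (forall q, (minn x y <= q <= maxn x y)%N -> [/\ u q \notin Cl, `|D (u x) - D (u q)| <= `|pos x - pos q| &
     `|pos x - pos q| <= 2^-1 * dl * D (u q)]) ->
  u x \in capture Cl t rho -> u y \in capture Cl t (rho * (1 + dl)).
Proof.
move=> tT r1 d0 step near /captureP[rx hx].
have rx_le := grow_le tT hx; set rho' := rho * (1 + dl).
have rr : rho <= rho' by rewrite /rho' mulrDr mulr1 lerDl mulr_ge0 //; lra.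
have reach q : (minn x y <= q <= maxn x y)%N -> rx + `|pos x - pos q| <= rho' * D (u q).
  move=> hq; have [_ h1 h2] := near q hq; have := D_ge0 (u q); have := D_ge0 (u x).
  move: h1; rewrite ler_distl => /andP[_ h1] h3 h4.
  have h5 : D (u x) <= D (u q) + 2^-1 * dl * D (u q) by lra.
  have h6 : rho * D (u x) <= rho * (D (u q) + 2^-1 * dl * D (u q)) by rewrite ler_wpM2l //; lra.
  have h7 : 2^-1 * dl * D (u q) <= rho * (2^-1 * dl * D (u q)) by rewrite ler_peMl // !mulr_ge0.
  rewrite /rho'; lra.
have [xy|/ltnW yx] := leqP x y.
  rewrite (minn_idPl xy) (maxn_idPr xy) in step near reach.
  suff H k : (x + k <= y)%N -> grow Cl t rho' (u (x + k)%N) (rx + (pos (x + k)%N - pos x)) /\ pos x <= pos (x + k)%N.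
    by apply/captureP; have [h _] := H (y - x)%N ltac:(lia); exists (rx + (pos (x + (y - x))%N - pos x)); move: h; rewrite subnKC.
  elim: k => [|k IH] hk; first by rewrite addn0 subrr addr0; split=> //; apply: grow_mono hx.
  have [h1 h2] := IH ltac:(lia); rewrite addnS in hk *.
  have [a E] := step (x + k)%N ltac:(lia); have [nC _ _] := near (x + k).+1 ltac:(lia).
  have h3 : pos x <= pos (x + k).+1 by have := l_gt0 a; rewrite E; lra.
  split=> //; have -> : rx + (pos (x + k).+1 - pos x) = rx + (pos (x + k)%N - pos x) + l [set u (x + k)%N; u (x + k).+1]%SET by rewrite E; lra.
  apply: growS => //; rewrite E; have := reach (x + k).+1 ltac:(lia).
  by rewrite ler0_norm; lra.
rewrite (minn_idPr yx) (maxn_idPl yx) in step near reach.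
suff H k : (k <= x - y)%N -> grow Cl t rho' (u (x - k)%N) (rx + (pos x - pos (x - k)%N)) /\ pos (x - k)%N <= pos x.
  by apply/captureP; have [h _] := H (x - y)%N (leqnn _); exists (rx + (pos x - pos (x - (x - y))%N)); move: h; rewrite subKn.
elim: k => [|k IH] hk; first by rewrite subn0 subrr addr0; split=> //; apply: grow_mono hx.
have [h1 h2] := IH ltac:(lia).
have Ek : (x - k)%N = (x - k.+1).+1 by lia.
have [a E] := step (x - k.+1)%N ltac:(lia); have [nC _ _] := near (x - k.+1)%N ltac:(lia).
have rk := reach (x - k.+1)%N ltac:(lia).
rewrite Ek in h1 h2; rewrite finset.setUC in E.
have h3 : pos (x - k.+1)%N <= pos x by have := l_gt0 a; rewrite finset.setUC E; lra.
split=> //; have -> : rx + (pos x - pos (x - k.+1)%N) = rx + (pos x - pos (x - k.+1).+1) + l [set u (x - k.+1).+1; u (x - k.+1)%N]%SET.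
  by rewrite E; lra.
apply: growS => //; first by rewrite adj_sym.
rewrite E; move: rk.
by rewrite ger0_norm; lra.
Qed.

End Growth.

Section WalkPositions.
Variables (R : realType) (V : finType) (G : graph V) (l : {set V} -> R).
Hypothesis l_gt0 : length_function G l.
Variables (x : V) (p : seq V).
Hypothesis px : path (adj G) x p.

Definition walk_at q := nth x (x :: p) q.
Definition walk_pos q := walk_length l x (take q p).

Lemma last_take q : (q <= size p)%N -> last x (take q p) = walk_at q.
Proof.
rewrite /walk_at; elim: p x q => [|y p' IH] x' [|q] //= h; rewrite IH // (set_nth_default x') //=.
Qed.

Lemma walk_at_last : walk_at (size p) = last x p.
Proof. by rewrite -last_take // take_size. Qed.

Lemma walk_step q : (q < size p)%N ->
  adj G (walk_at q) (walk_at q.+1) /\ l [set walk_at q; walk_at q.+1]%SET = walk_pos q.+1 - walk_pos q.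
Proof.
move=> qp; split; first by have /pathP := px; apply.
rewrite /walk_pos (take_nth x) // -cats1 walk_cat walk_cons walk_nil last_take 1?ltnW //.
by rewrite /walk_at /=; lra.
Qed.

Lemma walk_pos_mono : {in [pred q | (q <= size p)%N] &, {homo walk_pos : q r / (q <= r)%N >-> q <= r}}.
Proof.
move=> q r _; rewrite inE => rp qr; rewrite -(subnKC qr) in rp *.
elim: (r - q)%N rp => [|k IH]; first by rewrite addn0.
rewrite addnS => h; apply: le_trans (IH (ltnW h)) _.
by have [a E] := walk_step h; have := l_gt0 a; rewrite E; lra.
Qed.

Lemma walk_lip (D : V -> R) : (forall v w, adj G v w -> D w <= D v + l [set v; w]%SET) ->
  {in [pred q | (q <= size p)%N] &, forall q r, (q <= r)%N -> `|D (walk_at q) - D (walk_at r)| <= walk_pos r - walk_pos q}.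
Proof.
move=> lip q r _; rewrite inE => rp qr; rewrite -(subnKC qr) in rp *.
elim: (r - q)%N rp => [|k IH]; first by rewrite addn0 !subrr normr0.
rewrite addnS => h; have := IH (ltnW h).
have [a E] := walk_step h; have := lip _ _ a; have := lip _ _ (etrans (adj_sym _ _ _) a).
by rewrite finset.setUC E !ler_distl => *; apply/andP; split; lra.
Qed.

End WalkPositions.

(** * Bypassing the captured parts of a path *)

Section Detours.
Variables (R : realType) (V : finType).
Variables (n : nat) (s : nat -> nat) (wt : nat -> R) (u : nat -> V).
Hypotheses (n_gt0 : (0 < n)%N) (wt_ge0 : forall b, 0 <= wt b).
Implicit Types (Cl : {set V}) (f : V -> V) (A : pred nat) (al be : nat -> nat) (c : R).

(* A is the set of positions not yet bypassed; an inactive position p lies in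
   the maximal detour [al p, be p], whose ends have the same image under f. *)
Definition detours Cl f A al be c := [/\
  forall p, A p -> (p < n)%N /\ u p \notin Cl,
  forall p, (p < n)%N -> ~~ A p -> [/\ (al p <= p <= be p)%N /\ (be p < n)%N, u (al p) \in Cl, u (be p) \in Cl,
     f (u (al p)) = f (u (be p)) &
     forall q, (al p <= q <= be p)%N -> [/\ ~~ A q, al q = al p & be q = be p]] &
  \sum_(p < n | ~~ A p && (al p == p)) (wt (s p) + wt (s (be p))) <= c].

(** The ends of the new hull are active positions, so an old detour lies inside the hull or is
    disjoint from it. Swallowed detours are no longer charged. *)
Lemma detours_step Cl f A al be c (Cap : {set V}) t : [disjoint Cl & Cap] -> detours Cl f A al be c ->
  let C p := A p && (u p \in Cap) in
  detours (Cl :|: Cap) (fun v => if v \in Cap then t else f v) (cut n A C)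
    (fun p => if hull n C p then first_in n C else al p) (fun p => if hull n C p then last_in n C else be p)
    (c + end_cost n s wt C).
Proof.
move=> dis [h1 h2 h3] C.
have ClCap v : v \in Cl -> v \in Cap = false by move=> vC; exact: (disjointFr dis vC).
have ends p : hull n C p -> [/\ C (first_in n C), (first_in n C < n)%N, C (last_in n C) & (last_in n C < n)%N].
  by move=> /(hull_has n_gt0)/hull_ends[].
have old p : (p < n)%N -> ~~ A p -> ~~ hull n C p -> forall q, (al p <= q <= be p)%N -> ~~ hull n C q.
  move=> pn Ap hp q qr; apply/negP => hq; have [/andP[c1 _] _ /andP[c2 _] _] := ends q hq.
  have [_ _ _ _ hr] := h2 p pn Ap; have [[pr _] _ _ _ _] := h2 p pn Ap.
  have n1 : ~~ (al p <= first_in n C <= be p)%N by apply/negP => /hr[]; rewrite c1.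
  have n2 : ~~ (al p <= last_in n C <= be p)%N by apply/negP => /hr[]; rewrite c2.
  by move: hp hq n1 n2 pr qr; rewrite /hull; lia.
split.
- move=> p /andP[Ap hp]; have [pn uC] := h1 p Ap; split=> //.
  rewrite inE negb_or uC /=; apply: contra hp => uCap.
  have hC : has C (iota 0 n) by apply/hasP; exists p; rewrite ?mem_iota ?add0n // /C Ap.
  by have [_ _ _ _ h] := hull_ends hC; apply: h; rewrite // /C Ap.
- move=> p pn cp; have [hp|hp] := boolP (hull n C p).
    have [c1 c2 c3 c4] := ends p hp; have /andP[_ d1] := c1; have /andP[_ d2] := c3.
    rewrite d1 d2 !inE d1 d2 !orbT; split=> // q hq.
    by rewrite /cut (_ : hull n C q) ?andbF.
  have Ap : ~~ A p by move: cp; rewrite /cut (negPf hp) andbT.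
  have [e1 e2 e3 e4 e5] := h2 p pn Ap.
  rewrite !inE e2 e3 !ClCap // e4; split=> // q hq.
  by have [g1 g2 g3] := e5 q hq; rewrite /cut (negPf g1) (negPf (old p pn Ap hp q hq)).
rewrite (bigID (fun p : 'I_n => hull n C p)) /= addrC; apply: lerD.
  apply: le_trans h3; rewrite big_mkcond [leRHS]big_mkcond; apply: ler_sum => p _ /=.
  have [hp|hp] := boolP (hull n C p); first by rewrite andbF; case: ifP => // _; apply: addr_ge0.
  by rewrite andbT /cut (negPf hp) andbT.
rewrite /end_cost; case: ifP => [hC|nC]; last first.
  rewrite big_pred0 // => p; apply/negbTE; rewrite negb_and; apply/orP; right.
  by apply: contraFN nC => /(hull_has n_gt0).
have [c1 c2 c3 c4 _] := hull_ends hC.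
rewrite big_mkcond (bigD1 (Ordinal c2)) //= big1 ?addr0.
  by case: ifP => [/andP[_ ->]//|_]; apply: addr_ge0.
move=> p pE; case: ifP => // /andP[/andP[_ h] hp]; rewrite hp in h.
by case/eqP: pE; apply: val_inj; rewrite /= (eqP h).
Qed.

(** A detour is bridged for free, its ends having the same image. Between consecutive detours one
    edge is used, charged to the end of one and the start of the next. *)
Lemma detours_route (H : graph V) (l' : {set V} -> R) (pos : nat -> R) (K : R) Cl f A al be c M : n = M.+1 -> 0 <= K ->
  length_function H l' -> (forall p q, (p <= q)%N -> (q <= M)%N -> pos p <= pos q) ->
  (forall p, (p < M)%N -> (dist H l' (f (u p)) (f (u p.+1)) <=
     (K * wt (s p) + K * wt (s p.+1) + (pos p.+1 - pos p))%:E)%E) ->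
  (forall p, ~~ A p) -> detours Cl f A al be c -> (dist H l' (f (u 0%N)) (f (u M)) <= (pos M - pos 0%N + K * c)%:E)%E.
Proof.
move=> nE K0 l'0 mono step A0 [_ h2]; rewrite (eq_bigl (fun p : 'I_n => al p == p)) => [h3|p]; last by rewrite A0.
pose S p := \sum_(q < n | (p <= q)%N && (al q == q)) (wt (s q) + wt (s (be q))).
have S0 p : 0 <= S p by apply: sumr_ge0 => *; apply: addr_ge0.
have S_start p : (p < n)%N -> al p = p -> (p <= be p)%N ->
    wt (s p) + wt (s (be p)) + S (be p).+1 <= S p.
  move=> pn alp pb; rewrite /S [leRHS](bigD1 (Ordinal pn)) /=; last by rewrite leqnn alp eqxx.
  rewrite lerD2l big_mkcond [leRHS]big_mkcond /=; apply: ler_sum => q _.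
  case: ifP => [/andP[q1 ->]|_]; last by case: ifP => // _; apply: addr_ge0.
  have -> : (p <= q)%N by lia.
  by have -> : q != Ordinal pn by apply: contraTneq q1 => -> /=; lia.
suff main k p : (p <= M)%N -> (M - p <= k)%N -> al p = p ->
    (dist H l' (f (u p)) (f (u M)) <= (pos M - pos p + K * (S p - wt (s p)))%:E)%E.
  have al0 : al 0%N = 0%N by have [[]] := h2 0%N n_gt0 (A0 _); lia.
  apply: le_trans (main M 0%N isT _ al0) _; first by rewrite subn0.
  rewrite lee_fin lerD2l ler_wpM2l //; apply: le_trans h3.
  by rewrite lerBlDr ler_wpDr.
elim: k p => [|k IH] p pM Mk alp.
all: have pn : (p < n)%N by rewrite nE.
all: have [[/andP[_ pb] bn] _ _ E br] := h2 p pn (A0 _); rewrite alp in E br.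
all: have SE := S_start p pn alp pb.
all: have [bM|bM] := eqVneq (be p) M.
all: try by rewrite E bM (dist_refl l'0) lee_fin addr_ge0 ?mulr_ge0 ?subr_ge0 ?mono //;
  have := S0 (be p).+1; have := wt_ge0 (s (be p)); move: SE; lra.
  by exfalso; lia.
have bM' : (be p < M)%N by lia.
have alb : al (be p).+1 = (be p).+1.
  have [[/andP[a1 a2] a3] _ _ _ a4] := h2 (be p).+1 ltac:(lia) (A0 _).
  apply/eqP; rewrite eqn_leq a1 leqNgt; apply/negP => lt.
  have [_ _ E1] := a4 (be p) ltac:(lia); have [_ _ E2] := br (be p) ltac:(lia).
  by move: a2; rewrite -E1 E2 ltnn.
have IHb := IH (be p).+1 bM' ltac:(lia) alb.
rewrite E; apply: le_trans (dist_tri l'0 _ (f (u (be p).+1)) _) _.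
apply: le_trans (leeD (step _ bM') IHb) _; rewrite -EFinD lee_fin.
have posb : pos p <= pos (be p) by apply: mono => //; lia.
have : K * (wt (s (be p)) + S (be p).+1) <= K * (S p - wt (s p)) by apply: ler_wpM2l => //; move: SE; lra.
by move: posb; lra.
Qed.

End Detours.

Lemma expR_half_le2 (R : realType) : expR (2^-1 : R) <= 2.
Proof. by apply: le_trans (expR_le_inv _) _; first lra; rewrite invf_ple ?posrE; lra. Qed.

Lemma expR1_le4 (R : realType) : expR (1 : R) <= 4.
Proof.
have h2 := expR_half_le2 R.
have -> : 1 = 2^-1 + 2^-1 :> R by lra.
by rewrite expRD; apply: (le_trans (ler_pM _ _ h2 h2)); rewrite ?expR_ge0 //; lra.
Qed.

Lemma between_minmax p x y q : (p <= x)%N -> (p <= y)%N -> (minn x y <= q <= maxn x y)%N ->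
  (p <= q <= x)%N || (p <= q <= y)%N.
Proof. by lia. Qed.

(** * The clusters of all terminals and their total cost *)

Section RelaxedVoronoi.
Variables (R : realType) (V : finType) (G : graph V) (l : {set V} -> R) (T : {set V}) (D : V -> R).
Hypotheses (l_gt0 : length_function G l) (D_ge0 : forall v, 0 <= D v) (D_T : forall t, t \in T -> D t = 0).
Hypothesis D_lip : forall v w, adj G v w -> D w <= D v + l [set v; w]%SET.
Variable m : nat.
Hypothesis m_gt0 : (0 < m)%N.
Local Notation conn := (connect (adj G)).

(** Chosen so that [1 + 3 * dl] is the ratio of consecutive values of [rho]: a slice touched at one
    level is captured entirely at the next. *)
Let dl : R := 3^-1 * m%:R^-1.
Let rho g : R := (1 + m%:R^-1) ^+ g.
Let P (i : V * V) := [&& i.1 \in T, i.2 \in T, conn i.1 i.2 & i.1 != i.2].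
Let len (i : V * V) := gdist G l i.1 i.2.
Let pth (i : V * V) := geodesic G l i.1 i.2.
Let n i := (size (pth i)).+1.
Let u i := walk_at i.1 (pth i).
Let pos i := walk_pos l i.1 (pth i).
Let s i := block (pos i) (fun p => D (u i p)) dl.
Let wt i b : R := dl * D (u i b) / (10 * len i).

Let m1 : 0 < (m%:R^-1 : R) /\ (m%:R^-1 : R) <= 1.
Proof. by split; rewrite ?invr_gt0 ?invf_le1 ?ltr0n ?ler1n. Qed.
Let dl0 : 0 <= dl. Proof. by rewrite /dl; case: m1; lra. Qed.
Let dl3 : dl <= 3^-1. Proof. by rewrite /dl; case: m1; lra. Qed.

Let rho1 g : 1 <= rho g.
Proof. by apply: exprn_ege1; case: m1; lra. Qed.

Let rho4 g : (g <= m)%N -> rho g <= 4.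
Proof.
move=> gm; apply: (@le_trans _ _ (rho m)); first by apply: ler_weXn2l => //; case: m1; lra.
apply: le_trans (expR1_le4 R); have -> : (1 : R) = m%:R * m%:R^-1 by rewrite divff // pnatr_eq0 -lt0n.
rewrite expRM_natl lerXn2r ?nnegrE ?expR_ge0 //; last exact: expR_ge1Dx.
Qed.

Let wt_ge0 i b : 0 <= wt i b.
Proof. by rewrite /wt divr_ge0 ?mulr_ge0 // gdist_ge0. Qed.

Section Pair.
Variable i : V * V.
Hypothesis Pi : P i.

Let ci : conn i.1 i.2. Proof. by case/and4P: Pi. Qed.
Let len_gt0 : 0 < len i. Proof. by case/and4P: Pi => _ _ c ne; apply: gdist_gt0. Qed.
Let pi_path : path (adj G) i.1 (pth i). Proof. by have [] := geodesicP l_gt0 ci. Qed.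
Let D_last : D (u i (size (pth i))) = 0.
Proof. by rewrite /u walk_at_last; have [_ -> _ _] := geodesicP l_gt0 ci; apply: D_T; case/and4P: Pi. Qed.
Let pos0 : pos i 0%N = 0. Proof. by rewrite /pos /walk_pos take0 walk_nil. Qed.
Let pos_last : pos i (size (pth i)) = len i. Proof. by rewrite /pos /walk_pos take_size. Qed.
Let pos_mono := walk_pos_mono l_gt0 pi_path.
Let D_lip_i := walk_lip pi_path D_lip.
Let sub_n p : (p < n i)%N -> p \in [pred q | (q <= size (pth i))%N].
Proof. by rewrite inE ltnS. Qed.

Let wt_max p : (p < n i)%N -> wt i (s i p) <= 10^-1.
Proof.
move=> pn; have bp : (s i p <= p)%N by apply: block_le.
have bn : (s i p <= size (pth i))%N by apply: leq_trans bp _; rewrite -ltnS.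
have := D_lip_i bn (leqnn _) bn; rewrite -/(u i) -/(u i) D_last subr0 ger0_norm // -/(pos i) pos_last.
have := pos_mono (isT : 0%N \in [pred q | (q <= size (pth i))%N]) bn (leq0n _); rewrite -/(pos i) pos0 => h1 h2.
rewrite /wt ler_pdivrMr ?mulr_gt0 // mulrA mulVf // mul1r.
have := ler_wpM2r (D_ge0 (u i (s i p))) dl3; move: (D_ge0 (u i (s i p))) h1 h2 len_gt0; lra.
Qed.

Let full_weight : slice_weight (n i) (s i) (wt i) (fun p => (p < n i)%N) <= 10^-1.
Proof.
have hs := block_sum dl3 (fun p => D_ge0 (u i p)) D_lip_i D_last.
rewrite -/(pos i) pos0 subr0 pos_last in hs.
apply: (@le_trans _ _ (\sum_(p < n i | s i p == p) dl * D (u i p) / (10 * len i))).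
  rewrite /slice_weight big_mkcond [leRHS]big_mkcond /=; apply: ler_sum => p _.
  case: ifP => [/andP[_ h]|_]; last by case: ifP => // _; apply: wt_ge0.
  have [E|/eqP E] := eqVneq (s i p) p; first by rewrite /wt E. exfalso; apply: E.
  move: h; case: (nat_of_ord p) (ltn_ord p) => [|q] qn //=; rewrite (ltnW qn) /= /s /=.
  by case: ifP => // _; rewrite eqxx.
rewrite -mulr_suml ler_pdivrMr ?mulr_gt0 // mulrA mulVf // mul1r.
exact: hs.
Qed.

(** The exponent is at most [2 / 5], and [1 / (1 - 2 / 5) = 5 / 3]. *)
Lemma initial_potential : expR (0 + 4 * slice_weight (n i) (s i) (wt i) (fun p => (p < n i)%N)) <= 5 / 3.
Proof.
rewrite add0r; apply: le_trans (expR_le_inv _) _; first by move: full_weight; lra.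
by rewrite invf_ple ?posrE; move: full_weight; lra.
Qed.

Variables (Cl : {set V}) (t : V) (A : pred nat).
Hypotheses (tT : t \in T) (A_n : forall p, A p -> (p < n i)%N /\ u i p \notin Cl).

Definition captured g : pred nat := fun p => A p && (u i p \in capture G l D Cl t (rho g)).

Lemma captured_mono g g' p : (g <= g')%N -> captured g p -> captured g' p.
Proof.
move=> gg /andP[Ap h]; rewrite /captured Ap /=; have le : rho g <= rho g' by apply: ler_weXn2l => //; case: m1; lra.
by have /fintype.subsetP := capture_mono G l D_ge0 Cl t le; apply.
Qed.

Let spread g p x y : slice (s i) A p x -> slice (s i) A p y -> captured g x -> captured g.+1 y.
Proof.
move=> [px hx] [py hy] /andP[_ cx]; have [|Ay sy] := hy y; first by rewrite py leqnn.
have [|Ax sx] := hx x; first by rewrite px leqnn.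
rewrite /captured Ay /= (_ : rho g.+1 = rho g * (1 + 3 * dl)); last first.
  by rewrite /rho exprSr /dl; congr (_ * (1 + _)); lra.
have rng q : (minn x y <= q <= maxn x y)%N -> A q /\ s i q = s i p.
  by move=> /(between_minmax px py)/orP[/hx|/hy].
apply: (capture_along l_gt0 D_ge0 D_T (pos := pos i) (x := x)) => //.
- by rewrite mulr_ge0.
- by move=> q hq; apply: walk_step => //; have [|Aq _] := rng q.+1; [by case/andP: hq => /leqW -> ->|have [] := A_n Aq].
move=> q hq; have [Aq sq] := rng q hq; have [qn uq] := A_n Aq; have [xn _] := A_n Ax; split=> //.
  have [xq|/ltnW qx] := leqP x q.
    by have := D_lip_i (sub_n xn) (sub_n qn) xq; rewrite -/(pos i) => /le_trans; apply; rewrite distrC ler_norm.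
  by have := D_lip_i (sub_n qn) (sub_n xn) qx; rewrite distrC -/(pos i) => /le_trans; apply; rewrite ler_norm.
have := block_close dl0 dl3 (fun p => D_ge0 (u i p)) pos_mono D_lip_i (sub_n xn) (sub_n qn); apply.
by rewrite -/(s i) sx sq.
Qed.

Definition increment g := end_cost (n i) (s i) (wt i) (captured g) +
  4 * slice_weight (n i) (s i) (wt i) (cut (n i) A (captured g)) - 4 * slice_weight (n i) (s i) (wt i) A.

(** [charge] at consecutive levels, with [pred0] below level 0, is the hypothesis of
    [level_average_exp] for the met weights. *)
Lemma increment_average : level_average m (fun g => expR (increment g)) <= 1 + 4 * (9 / 10) ^+ m.
Proof.
have n0 : (0 < n i)%N by [].
pose x g := if g is g'.+1 then met_weight (n i) (s i) (wt i) A (captured g') else 0.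
pose C g : pred nat := if g is g'.+1 then captured g' else pred0.
have xE g : x g = met_weight (n i) (s i) (wt i) A (C g) by case: g => //=; rewrite met_weight0.
have CC g p : C g p -> captured g p by case: g => //= g; apply: captured_mono.
have := @level_average_exp R m increment x 10^-1; rewrite /= mulr0 expR0 mul1r; apply; rewrite ?invr_ge0 //.
  by move=> g; rewrite !xE; apply: met_weight_le => // p; apply: CC.
move=> g gm; rewrite !xE; apply: charge => //.
- by move=> p /A_n[].
- by move=> p; apply: CC.
- by move=> p /andP[].
- by case: g {gm} => [|g] //= p y z; apply: spread.
Qed.

End Pair.

Let tail : R := 4 * (9 / 10) ^+ m.

(* The state after the terminals of r have been processed: the third clause makes
   the clusters absorb every shortest path to T, so that finally all vertices
   connected to T are covered, and the fifth bounds the potential. *)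
Definition voronoi (r : seq V) (Cl : {set V}) (f : V -> V) (A : V * V -> pred nat)
    (al be : V * V -> nat -> nat) (c : V * V -> R) := [/\
  (forall t, t \in r -> t \in Cl /\ f t = t) /\ (forall t, t \in T -> t \notin r -> t \notin Cl),
  forall v, v \in Cl -> [/\ f v \in r, connect (fibre_adj G Cl f) v (f v), conn (f v) v & gdist G l (f v) v <= 4 * D v],
  forall v w, v \in Cl -> adj G v w -> D w = D v + l [set v; w]%SET -> w \in Cl,
  forall i, P i -> detours (n i) (s i) (wt i) (u i) Cl f (A i) (al i) (be i) (c i) &
  \sum_(i | P i) expR (c i + 4 * slice_weight (n i) (s i) (wt i) (A i)) <= (1 + tail) ^+ size r * (\sum_(i | P i) (5 / 3))].

Lemma voronoi_init : voronoi [::] finset.set0 id (fun i p => (p < n i)%N) (fun _ => id) (fun _ => id) (fun _ => 0).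
Proof.
split.
- by split=> t // _ _; rewrite finset.in_set0.
- by move=> v; rewrite finset.in_set0.
- by move=> v w; rewrite finset.in_set0.
- move=> i _; split=> [p pn|p pn|]; [by rewrite inE|by rewrite pn|].
  by rewrite big_pred0 // => p; rewrite ltn_ord.
by rewrite expr0 mul1r; apply: ler_sum => i Pi; apply: initial_potential.
Qed.

(** One level must serve all pairs of terminals. It is picked from the mean of the summed potential,
    which [increment_average] bounds term by term. *)
Lemma voronoi_step r Cl f A al be c t : t \in T -> t \notin r -> voronoi r Cl f A al be c ->
  exists Cl' f' A' al' be' c', voronoi (t :: r) Cl' f' A' al' be' c'.
Proof.
move=> tT tr [[v1 v2] v3 v4 v5 v6].
have tC := v2 t tT tr.
have A_n i : P i -> forall p, A i p -> (p < n i)%N /\ u i p \notin Cl by move=> /v5[].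
pose pot i := c i + 4 * slice_weight (n i) (s i) (wt i) (A i).
have [g gm hg] : exists2 g, (g <= m)%N & \sum_(i | P i) expR (pot i) * expR (increment i Cl t (A i) g)
    <= (1 + tail) * \sum_(i | P i) expR (pot i).
  apply: level_average_min; rewrite level_average_sum mulr_sumr; apply: ler_sum => i Pi.
  by rewrite level_averageZ mulrC ler_wpM2r ?expR_ge0 // increment_average // ; apply: A_n.
pose Cap := capture G l D Cl t (rho g).
have CapC v : v \in Cap -> v \notin Cl by move=> /captureP[x]; apply: grow_notin.
have dis : [disjoint Cl & Cap].
  by rewrite disjoint_sym; apply/pred0P => v /=; apply/negbTE/negP => /andP[/CapC/negbTE->].
pose f' v := if v \in Cap then t else f v.
have fCl v : v \in Cl -> f' v = f v by move=> vC; rewrite /f' (disjointFr dis vC).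
have tCap : t \in Cap by apply: capture_self.
exists (Cl :|: Cap)%SET, f', (fun i => cut (n i) (A i) (captured i Cl t (A i) g)).
do 2 eexists; exists (fun i => c i + end_cost (n i) (s i) (wt i) (captured i Cl t (A i) g)).
split.
- split=> [x|x xT].
    rewrite in_cons finset.in_setU => /orP[/eqP->|/v1[xC fx]]; first by rewrite tCap orbT /f' tCap.
    by rewrite xC fCl.
  rewrite in_cons negb_or => /andP[xt xr]; rewrite finset.in_setU negb_or v2 //=.
  by apply: contra xt => /captureP[y /(grow_terminal l_gt0 D_T)] ->.
- move=> v; rewrite finset.in_setU => /orP[vC|vC].
    have [w1 w2 w3 w4] := v3 v vC; rewrite fCl // in_cons w1 orbT; split=> //.
    apply: (@connect_hom _ _ _ _ id) w2 => a b /and4P[ab aC bC fab]; right.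
    by rewrite /fibre_adj /= ab !finset.in_setU aC bC !fCl.
  have fv : f' v = t by rewrite /f' vC.
  have /captureP[y hy] := vC; have [c1 c2] := grow_dist l_gt0 hy.
  rewrite fv in_cons eqxx c1; split=> //.
    apply: (@connect_hom _ _ _ _ id) (capture_connect vC) => a b /and3P[ab aC bC]; right; rewrite -/Cap in aC bC.
    by rewrite /fibre_adj /= ab !finset.in_setU aC bC !orbT /f' aC bC eqxx.
  apply: le_trans c2 (le_trans (grow_le D_T tT hy) _).
  by rewrite ler_wpM2r // rho4.
- move=> v w; rewrite !finset.in_setU => /orP[vC|vC] vw E; first by rewrite (v4 v w vC vw E).
  have [//|wC] := boolP (w \in Cl).
  exact: (capture_tight l_gt0 D_T tT (rho1 g) vC vw wC E).
- move=> i Pi; have := detours_step (isT : (0 < n i)%N) (wt_ge0 i) t dis (v5 i Pi); apply.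
rewrite /= exprS -mulrA; apply: le_trans (_ : (1 + tail) * \sum_(i | P i) expR (pot i) <= _); last first.
  by apply: ler_wpM2l => //; rewrite addr_ge0 // mulr_ge0 // exprn_ge0 // divr_ge0.
apply: le_trans hg; apply: ler_sum => i Pi; rewrite -expRD ler_expR /pot /increment; lra.
Qed.

Lemma voronoi_all r : uniq r -> {subset r <= T} -> exists Cl f A al be c, voronoi r Cl f A al be c.
Proof.
elim: r => [|t r IH] /=.
  by do 6 eexists; apply: voronoi_init.
move=> /andP[tr ur] sub; have [|Cl [f [A [al [be [c h]]]]]] := IH ur.
  by move=> x xr; apply: sub; rewrite inE xr orbT.
by apply: voronoi_step h => //; apply: sub; rewrite inE eqxx.
Qed.

Hypothesis D_pred : forall v, reached G T v -> v \notin T ->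
  exists w, [/\ adj G w v, 0 < l [set w; v]%SET & D v = D w + l [set w; v]%SET].

(** An uncovered vertex nearest to [T] has a covered predecessor on a shortest path from [T], and
    the clusters are closed under such edges. *)
Lemma voronoi_cover Cl f A al be c v : voronoi (enum T) Cl f A al be c -> reached G T v -> v \in Cl.
Proof.
move=> [[v1 _] _ v4 _ _] rv; apply: contraT => vC.
have b0 : reached G T v && (v \notin Cl) by rewrite rv.
case: (@Order.TotalTheory.arg_minP _ _ _ v (fun v => reached G T v && (v \notin Cl)) D b0) => w /andP[rw wC] wmin.
have wT : w \notin T by apply: contra wC => wT; have [] := v1 w; rewrite ?mem_enum.
have [x [xw l0 E]] := D_pred rw wT.
have rx : reached G T x by apply: reached_conn rw (connect1 _); rewrite adj_sym.
have [xC|xC] := boolP (x \in Cl); first by rewrite (v4 x w xC xw E) in wC.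
by have := wmin x; rewrite rx xC E => /(_ isT); move: l0; lra.
Qed.

Lemma voronoi_minor (B : R) : T \subset verts G -> 
  (1 + tail) ^+ #|T| * (5 / 3 * #|T|%:R ^+ 2) <= expR B ->
  exists H l', [/\ minor T G H, length_function H l', verts H = T &
    forall t t', t \in T -> t' \in T -> (dist G l t t' <= dist H l' t t')%E /\
      (dist H l' t t' <= (1 + 160 * m%:R * B)%:E * dist G l t t')%E].
Proof.
move=> TG hB; have [||Cl [f [A [al [be [c vor]]]]]] := @voronoi_all (enum T).
- exact: enum_uniq.
- by move=> x; rewrite mem_enum.
have cover := voronoi_cover vor.
have [[v1 _] v3 _ v5 v6] := vor.
have TCl : T \subset Cl by apply/fintype.subsetP => t tT; have [] := v1 t; rewrite ?mem_enum.
have fT v : v \in Cl -> f v \in T by move=> /v3[+ _ _ _]; rewrite mem_enum.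
have ClG : Cl \subset verts G.
  apply/fintype.subsetP => v vC; have [_ _ cv _] := v3 v vC.
  by apply: connect_verts cv _; move/fintype.subsetP: TG; apply; apply: fT.
have fid t : t \in T -> f t = t by move=> tT; have [] := v1 t; rewrite ?mem_enum.
have fcon v : v \in Cl -> connect (fibre_adj G Cl f) v (f v) by move=> /v3[].
have [H [l' [h1 h2 h3 h4 h5]]] := retraction_DAM l_gt0 (fintype.subxx T) TCl ClG fT fid fcon.
exists H, l'; split=> // t t' tT t'T; split; first exact: h4.
have tail0 : 0 <= tail by rewrite mulr_ge0 // exprn_ge0 // divr_ge0.
have B0 : 0 <= B.
  rewrite -ler_expR expR0; apply: le_trans hB.
  rewrite -[leLHS]mulr1; apply: ler_pM => //; first by apply: exprn_ege1; rewrite lerDl.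
  have : 1 <= (#|T|%:R : R) by rewrite ler1n; apply/card_gt0P; exists t.
  by move=> T1; have := exprn_ege1 2 T1; lra.
have c0 : 0 <= 160 * m%:R * B by rewrite !mulr_ge0.
have [->|tt'] := eqVneq t t'.
  by rewrite (dist_refl h3) mule_ge0 ?(dist_ge0 l_gt0) // lee_fin addr_ge0.
have [ct|nc] := boolP (conn t t'); last first.
  by rewrite [X in (_ * X)%E]dist_nconn // gt0_muley ?leey // lte_fin ltr_wpDr.
pose i := (t, t'); have Pi : P i by rewrite /P /= tT t'T ct.
have [p1 p2 _ _] := geodesicP l_gt0 ct.
(* One term of the potential is at most the whole sum, which has at most [#|T| ^ 2] terms. *)
have ci_le : c i <= B.
  rewrite -ler_expR; apply: le_trans hB; apply: (@le_trans _ _ (\sum_(i | P i) expR (c i + 4 * slice_weight (n i) (s i) (wt i) (A i)))).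
    rewrite (bigD1 i) //= ler_wpDr //; first by apply: sumr_ge0 => *; apply: expR_ge0.
    rewrite ler_expR lerDl mulr_ge0 // sumr_ge0 //.
  apply: le_trans v6 _; rewrite -cardE ler_wpM2l //.
    by rewrite exprn_ge0 // addr_ge0.
  apply: (@le_trans _ _ (\sum_(j in finset.setX T T) (5 / 3))).
    rewrite big_mkcond [leRHS]big_mkcond /=; apply: ler_sum => -[j j'] _.
    by case: ifP => [/and4P[/= j1 j2 _ _]|_]; [rewrite finset.in_setX j1 j2 | case: ifP].
  by rewrite sumr_const cardsX -[leLHS]mulr_natr natrM expr2.
have conn_u p : (p < n i)%N -> u i p \in Cl.
  move=> pn; apply: cover; apply/exists_inP; exists t => //.
  have := path_conn (_ : path (adj G) t (take p (pth i))); rewrite last_take //; apply.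
  by move: p1; rewrite -/(pth i) -{1}(cat_take_drop p (pth i)) cat_path => /andP[].
have A0 p : ~~ A i p.
  by apply/negP => Ap; have [hA _ _] := v5 i Pi; have [pn] := hA p Ap; rewrite conn_u.
have len0 : 0 < len i by apply: gdist_gt0.
have m0 : 0 < m%:R :> R by rewrite ltr0n.
(* A vertex is within [4 * D] of its terminal, and [D] is at most [4 / 3] of its value at the block
   start; [16 / 3] divided by [dl / (10 * len i)] is this [K]. *)
pose K := 160 * len i * m%:R.
have DK p : (p < n i)%N -> 4 * D (u i p) <= K * wt i (s i p).
  move=> pn; have -> : K * wt i (s i p) = 16 / 3 * D (u i (s i p)).
    rewrite /K /wt /dl; field; rewrite !gt_eqF //.
  have := block_weight dl0 dl3 (fun p => D_ge0 (u i p)) (walk_lip p1 D_lip) (_ : (p <= size (pth i))%N).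
  move=> /(_ pn); rewrite -/(u i) -/(pos i) -/(s i); lra.
have K0 : 0 <= K by rewrite /K !mulr_ge0 // ltW.
have := @detours_route R V (n i) (s i) (wt i) (u i) isT (wt_ge0 i) H l' (pos i) K Cl f (A i) (al i) (be i) (c i) (size (pth i)) erefl K0 h3.
have -> : f (u i 0%N) = t by apply: fid.
have -> : f (u i (size (pth i))) = t' by rewrite /u walk_at_last p2 fid.
have -> : pos i (size (pth i)) - pos i 0%N = len i.
  by rewrite /pos /walk_pos take_size take0 walk_nil subr0.
move=> /(_ _ _ A0 (v5 i Pi)) route; have : (dist H l' t t' <= (len i + K * c i)%:E)%E.
  apply: route => [p q pq qM|p pM].
    by apply: (walk_pos_mono l_gt0 p1) => //; rewrite inE // (leq_trans pq).
  have [a E] := walk_step l p1 pM.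
  have pC := conn_u p (leqW pM); have qC := conn_u p.+1 pM.
  apply: le_trans (h5 _ _ pC qC a) _; rewrite lee_fin -E.
  have [_ _ b1 b2] := v3 _ pC; have [_ _ b3 b4] := v3 _ qC.
  have b5 : conn (u i p.+1) (f (u i p.+1)) by rewrite conn_sym.
  have := gdist_tri l_gt0 b1 (connect_trans (connect1 a) b5).
  have := gdist_tri l_gt0 (connect1 a) b5; rewrite -(gdistC l_gt0 b3).
  have := gdist_adj l_gt0 a; have := DK p (leqW pM); have := DK p.+1 pM.
  by move: b2 b4; rewrite /u; lra.
move=> /le_trans; apply; rewrite dist_conn // -EFinM lee_fin -/(len i).
have : K * c i <= K * B by rewrite ler_wpM2l // /K !mulr_ge0 // ltW.
by rewrite /K; lra.
Qed.

End RelaxedVoronoi.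

(** * Numerical estimates and the two regimes *)

Lemma level_tail (R : realType) (x : R) m : 10 * (x + 3) <= m%:R -> 4 * (9 / 10) ^+ m <= expR (- x).
Proof.
move=> hm; have h0 : 0 <= 9 / 10 :> R by lra.
have h1 : 9 / 10 <= expR (- 10^-1 : R) by apply: le_trans (expR_ge1Dx _); lra.
have h2 : (9 / 10) ^+ m <= expR (- (x + 3)).
  apply: (@le_trans _ _ (expR (- 10^-1) ^+ m)); first by apply: lerXn2r; rewrite ?nnegrE ?expR_ge0.
  by rewrite -expRM_natl ler_expR; move: hm; clear; lra.
have h3 : 4 <= expR (3 : R) by apply: le_trans (expR_ge1Dx _); lra.
have -> : - x = 3 - (x + 3) by clear; lra.
by rewrite expRD; apply: ler_pM => //; apply: exprn_ge0.
Qed.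

(** With [t <= 1 / k] the [k] steps multiply the potential by at most [expR 1], and a second
    [expR 1] covers [5 / 3]. *)
Lemma potential_bound (R : realType) k (t : R) : (0 < k)%N -> 0 <= t -> t <= k%:R^-1 ->
  (1 + t) ^+ k * (5 / 3 * k%:R ^+ 2) <= expR (2 + 2 * ln k%:R).
Proof.
move=> k0 t0 tk.
have h1 : (1 + t) ^+ k <= expR (1 : R).
  apply: (@le_trans _ _ (expR k%:R^-1 ^+ k)).
    apply: lerXn2r; rewrite ?nnegrE ?expR_ge0 ?addr_ge0 //.
    by apply: le_trans (expR_ge1Dx _); rewrite lerD2l.
  by rewrite -expRM_natl divff // pnatr_eq0 -lt0n.
have h2 : 5 / 3 <= expR (1 : R) by apply: le_trans (expR_ge1Dx _); lra.
have -> : k%:R ^+ 2 = expR (2 * ln k%:R) :> R by rewrite expRM_natl lnK // posrE ltr0n.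
have -> : 2 + 2 * ln k%:R = 1 + (1 + 2 * ln k%:R) :> R by clear; lra.
rewrite !expRD; apply: ler_pM => //; first by rewrite exprn_ge0 // addr_ge0.
by rewrite ler_wpM2r ?expR_ge0.
Qed.

(** [160 * 31 * 2 = 9920], which is where the constant 100 comes from. *)
Lemma stretch_bound (R : realType) (x m : R) : 0 <= x -> m <= 31 * (1 + x) ->
  160 * m * (2 + 2 * x) <= (100 * (1 + x)) ^+ 2.
Proof.
move=> x0 hm; have : m * (1 + x) <= 31 * (1 + x) * (1 + x) by rewrite ler_wpM2r //; lra.
by have := sqr_ge0 (1 + x); rewrite !expr2; lra.
Qed.

Lemma terminal_minor (R : realType) (V : finType) (G : graph V) (l : {set V} -> R) (T : {set V}) :
  length_function G l -> T \subset verts G ->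
  exists H l', [/\ minor T G H, length_function H l', verts H = T &
    forall t t', t \in T -> t' \in T -> (dist G l t t' <= dist H l' t t')%E /\
      (dist H l' t t' <= (1 + (100 * (1 + ln (#|T|%:R : R))) ^+ 2)%:E * dist G l t t')%E].
Proof.
move=> l0 TG; have [D [D0 DT Dlip Dpred]] := terminal_distance T l0.
set x := ln _; have [T0|T0] := posnP #|T|.
  have [|H [l' [h1 h2 h3 h4]]] := @voronoi_minor R V G l T D l0 D0 DT Dlip 1 isT Dpred 0 TG.
    by rewrite T0 expr0 expR0 mulr0n expr0n !mulr0.
  by exists H, l'; split=> // t t' tT; move/cards0_eq: T0 tT => ->; rewrite finset.in_set0.
have x0 : 0 <= x by apply: ln_ge0; rewrite ler1n.
have kE : #|T|%:R = expR x by rewrite lnK // posrE ltr0n.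
have xm : 0 <= 10 * (x + 3) by rewrite mulr_ge0 ?addr_ge0.
(* Just large enough for [level_tail] to bound the tail by [1 / #|T|]. *)
pose m := (Num.truncn (10 * (x + 3))).+1.
have m_lo : 10 * (x + 3) <= m%:R by apply/ltW/truncnS_gt.
have m_hi : m%:R <= 31 * (1 + x).
  have : (Num.truncn (10 * (x + 3)))%:R <= 10 * (x + 3) by rewrite truncn_le.
  by rewrite /m -natr1; move: x0; clear; lra.
have tail0 : 0 <= 4 * (9 / 10) ^+ m :> R by rewrite mulr_ge0 // exprn_ge0 // divr_ge0.
have tail : 4 * (9 / 10) ^+ m <= #|T|%:R^-1 :> R by rewrite kE -expRN level_tail.
have [H [l' [h1 h2 h3 h4]]] := @voronoi_minor R V G l T D l0 D0 DT Dlip m isT Dpred _ TG (potential_bound T0 tail0 tail).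
exists H, l'; split=> // t t' tT t'T; have [lo up] := h4 t t' tT t'T; split=> //.
apply: le_trans up _; apply: lee_wpmul2r; first exact: dist_ge0.
by rewrite lee_fin lerD2l stretch_bound.
Qed.

(** The factor 2 comes from [expR (1 / 2) <= 2]. *)
Lemma trunc_log2_le (R : realType) k : (0 < k)%N -> (trunc_log 2 k)%:R <= 2 * ln (k%:R : R).
Proof.
move=> k0; rewrite -ler_pdivrMl // -ler_expR lnK ?posrE ?ltr0n //.
apply: (@le_trans _ _ ((2 : R) ^+ trunc_log 2 k)); last by rewrite -natrX ler_nat trunc_logP.
rewrite mulrC expRM_natl; apply: lerXn2r; rewrite ?nnegrE ?expR_ge0 //; exact: expR_half_le2.
Qed.

(** [L <= 6 * y] and [n + 1 <= 7 / e] give [42 * (y / e)], and [42 + 2 * 42 ^ 2 = 3570]. *)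
Lemma planar_cover_count (R : realType) (k L n : nat) (e : R) : 0 < e -> e <= 1 ->
  L = (3 * trunc_log 2 k)%N -> n = (2 * (Num.truncn (2 / e)).+1)%N ->
  (k * (L * n) + 2 * (k * (L * n.+1)) ^ 2)%:R <= 3600 * (k%:R * ((1 + ln (k%:R : R)) / e)) ^+ 2.
Proof.
move=> e0 e1 LE nE; have [->|k0] := posnP k; first by rewrite !mul0n expr2 !mul0r mulr0.
have x0 : 0 <= ln (k%:R : R) by apply: ln_ge0; rewrite ler1n.
have k1 : 1 <= (k%:R : R) by rewrite ler1n.
set y := 1 + ln _.
have L_le : L%:R <= 6 * y by rewrite LE natrM; have := trunc_log2_le R k0; rewrite /y; lra.
have i1 : 1 <= e^-1 by rewrite invf_ge1.
have n_le : n.+1%:R <= 7 * e^-1.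
  have h : (Num.truncn (2 / e))%:R <= 2 / e by rewrite truncn_le divr_ge0 // ltW.
  by rewrite nE -natr1 natrM -natr1; move: h i1; clear; lra.
have a1 : 1 <= y / e by rewrite -[1]mulr1 ler_pM // /y; lra.
have Ln1 : (L * n.+1)%:R <= 42 * (y / e).
  by rewrite natrM; apply: le_trans (ler_pM _ _ L_le n_le) _ => //; lra.
have Ln : (L * n)%:R <= 42 * (y / e).
  by apply: le_trans Ln1; rewrite ler_nat leq_mul2l leqnSn orbT.
set b := y / e in a1 Ln Ln1 *; have b0 : 0 <= b by apply: le_trans a1.
have h1 : (k * (L * n))%:R <= 42 * (k%:R * b) ^+ 2.
  rewrite natrM; apply: (@le_trans _ _ (42 * (k%:R * b))).
    by rewrite mulrCA ler_wpM2l.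
  have kb1 : 1 <= k%:R * b by apply: (le_trans k1); rewrite ler_peMr.
  by rewrite ler_wpM2l // expr2 ler_peMl // (le_trans _ kb1).
have h2 : ((k * (L * n.+1)) ^ 2)%:R <= (42 * (k%:R * b)) ^+ 2.
  rewrite natrX; apply: lerXn2r; rewrite ?nnegrE ?ler0n //; first by rewrite mulr_ge0 // mulr_ge0.
  by rewrite natrM mulrCA ler_wpM2l.
have h3 : 0 <= (k%:R * b) ^+ 2 by apply: sqr_ge0.
rewrite natrD [(2 * _)%:R]natrM; move: h1 h2 h3; rewrite exprMn; clear; lra.
Qed.

Theorem theorem6p9 (R : realType) :
  exists C c : nat,
  forall (eps : R) (V : finType) (G : graph V) (l : {set V} -> R) (T : {set V}),
    0 < eps -> planar R G -> length_function G l -> T \subset verts G ->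
    exists (H : graph V) (l' : {set V} -> R),
      sized_DAM (1 + eps)
        (C%:R * (1 + ln (#|T|%:R : R)) ^+ c * (#|T|%:R / eps) ^+ 2)
        T G l H l'.
Proof.
have [C CE] : exists C : nat, C%:R = 3600 * 100 ^+ 4 :> R.
  by exists (3600 * 100 ^ 4)%N; rewrite natrM natrX.
exists C, 6%N => eps V G l T e0 planarG l0 TG.
set k : R := #|T|%:R; set y := 1 + ln k.
have y1 : 1 <= y.
  (* For empty [T] the convention [ln 0 = 0] gives [y = 1]. *)
  rewrite lerDl /k; have [->|T0] := posnP #|T|; first by rewrite ln0.
  by apply: ln_ge0; rewrite ler1n.
have [big|small] := leP ((100 * y) ^+ 2) eps.
  have [H [l' [h1 h2 h3 h4]]] := terminal_minor l0 TG.
  exists H, l'; split; last first.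
    rewrite h3 finset.setDv cards0 mulr_ge0 ?sqr_ge0 // mulr_ge0 ?ler0n // exprn_ge0 //.
    exact: le_trans y1.
  split=> // t t' tT t'T; have [lo up] := h4 t t' tT t'T; split=> //.
  apply: le_trans up _; apply: lee_wpmul2r; first exact: dist_ge0.
  by rewrite lee_fin lerD2l.
pose e := Num.min eps 1.
have e'0 : 0 < e by rewrite lt_min e0 ltr01.
have e1 : e <= 1 by rewrite ge_min lexx orbT.
have ee : e <= eps by rewrite ge_min lexx.
have [lt [lt0 gen]] := generic_lengths l0.
have [H [l' [[h1 h2 h3] h4]]] := planar_cover_DAM l0 lt0 gen planarG e'0 TG erefl erefl.
exists H, l'; split.
  split=> // t t' tT t'T; have [lo up] := h3 t t' tT t'T; split=> //.
  apply: le_trans up _; apply: lee_wpmul2r; first exact: dist_ge0.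
  by rewrite lee_fin lerD2l.
apply: le_trans (_ : 3600 * (k * (y / e)) ^+ 2 <= _).
  by apply: le_trans (planar_cover_count e'0 e1 erefl erefl); rewrite ler_nat.
(* For [eps <= 1] a factor of at least 1 is given away; otherwise [e = 1] and the upper bound on
   [eps] is used. Squared, this yields [100 ^+ 4] and four of the six powers of [y]. *)
have ie : e^-1 <= (100 * y) ^+ 2 / eps.
  rewrite ler_pdivlMr // ler_pdivrMl //; rewrite /e; case: (leP eps 1) => h.
    by rewrite ler_peMr ?(ltW e0) // exprn_ege1 //; move: y1; clear; lra.
  by rewrite mul1r ltW.
have y0 : 0 <= y by lra.
have -> : C%:R * y ^+ 6 * (k / eps) ^+ 2 = 3600 * (k * (y * ((100 * y) ^+ 2 / eps))) ^+ 2.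
  by rewrite CE; field; rewrite gt_eqF.
have A0 : 0 <= k * (y / e) by rewrite mulr_ge0 ?ler0n // divr_ge0 // ltW.
have AB : k * (y / e) <= k * (y * ((100 * y) ^+ 2 / eps)).
  by rewrite ler_wpM2l ?ler0n // ler_wpM2l.
by rewrite ler_wpM2l ?ler0n // lerXn2r ?nnegrE // (le_trans A0).
Qed.
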